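(* Let $\mathfrak{g}$ be a vector space over $\mathbf{k}$, let $\lambda\in\mathbf{k}$ (and $\mu=0$), and let $\mathfrak{m}:=\mathrm{Hom}(\bigwedge\mathfrak{g},\mathfrak{g})$, $\mathfrak{a}:=\mathrm{Hom}(\bigwedge\mathfrak{g},\mathfrak{g})$. There exists an $L_\infty[1]$-algebra structure on $s\mathfrak{m}\oplus\mathfrak{a}$ (the $L_\infty[1]$-algebra of modified Rota-Baxter Lie algebras) given as follows, for $f\in\mathrm{Hom}(\wedge^{n+1}\mathfrak{g},\mathfrak{g})\subseteq\mathfrak{m}$, $g\in\mathrm{Hom}(\wedge^{m+1}\mathfrak{g},\mathfrak{g})\subseteq\mathfrak{m}$, $\xi_j\in\mathrm{Hom}(\wedge^{m_j+1}\mathfrak{g},\mathfrak{g})\subseteq\mathfrak{a}$, $1\le j\le i-1$: $$l_1(sf)=\begin{cases}(-\lambda)^{\frac{n+1}{2}}f\in\mathfrak{a}, & n \text{ odd},\\ 0,& n\text{ even},\end{cases}\qquad l_2(sf,sg)=(-1)^{|f|}s[f,g]_{\mathrm{NR}};$$ for $i\ge2$ and $n-i$ even, $$l_i(sf,\xi_1,\dots,\xi_{i-1})=\sum_{\tau\in\mathrm{Sh}(m_1+1,\dots,m_{i-1}+1,n+2-i)}\mathrm{sgn}(\tau)(-\lambda)^{\frac{n-i+2}{2}}\big(f(\xi_1\otimes\cdots\otimes\xi_{i-1}\otimes\mathrm{Id}^{\otimes n+2-i})\big)\tau^{-1}$$ $$-\sum_{k=1}^{i-1}\sum_{\tau\in\mathrm{Sh}(m_1+1,\dots,\widehat{m_k+1},\dots,m_{i-1}+1,n+3-i,m_k)}(-1)^{(n+\sum_{j=1}^{k-1}m_j)m_k}\,\mathrm{sgn}(\tau)(-\lambda)^{\frac{n-i+2}{2}}\,\xi_k\big(f(\xi_1\otimes\cdots\otimes\widehat{\xi_k}\otimes\cdots\otimes\xi_{i-1}\otimes\mathrm{Id}^{\otimes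 n+3-i})\otimes\mathrm{Id}^{\otimes m_k}\big)\tau^{-1};$$ for $i\ge2$ and $n-i$ odd, $l_i(sf,\xi_1,\dots,\xi_{i-1})=0$; all components of $\{l_i\}_{i\ge1}$ other than $l_1(sf)$, $l_2(sf,sg)$, $l_i(sf,\xi_1,\dots,\xi_{i-1})$ for $i\ge2$, and those obtained from these components by graded symmetry, vanish (a hat means omission, and $(-\lambda)^0=1$).
   Context: $\mathbf{k}$ is a field of characteristic $0$ containing a square root of $-4\lambda$ (equivalently of $-\lambda$). A modified Rota-Baxter Lie algebra of weight $\lambda$ is a Lie algebra with a linear operator $T$ satisfying $[T(a),T(b)]=T([T(a),b]+[a,T(b)])+\lambda[a,b]$. Grading: $\mathrm{Hom}(\bigwedge\mathfrak{g},\mathfrak{g})=\bigoplus_{n\ge -1}\mathrm{Hom}(\wedge^{n+1}\mathfrak{g},\mathfrak{g})$, with $|f|=n$ if $f\in\mathrm{Hom}(\wedge^{n+1}\mathfrak{g},\mathfrak{g})$. The shift is $(sV)^n=V^{n+1}$, so $sf$ has degree $|f|-1$. $\mathrm{Sh}(i_1,\dots,i_r)$ is the set of permutations increasing on each of the consecutive blocks of sizes $i_1,\dots,i_r$; sums over shuffles with a negative block size are zero. $(F\sigma^{-1})(x_1,\dots,x_N):=F(x_{\sigma(1)},\dots,x_{\sigma(N)})$. Nijenhuis-Richardson bracket: for $|P|=p,|Q|=q$, $[P,Q]_{\mathrm{NR}}=P\bar\circ Q-(-1)^{pq}Q\bar\circ P$, $(P\bar\circ Q)(x_1,\dots,x_{p+q+1})=\sum_{\sigma\in\mathrm{Sh}(q+1,p)}\mathrm{sgn}(\sigma)P(Q(x_{\sigma(1)},\dots,x_{\sigma(q+1)}),x_{\sigma(q+2)},\dots,x_{\sigma(p+q+1)})$.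 Koszul rule (elements of $\mathfrak{g}$ count as odd): $f(\eta_1\otimes\cdots\otimes\eta_p\otimes\mathrm{Id}^{\otimes q})$, with $\eta_a$ of degree $r_a$ and arity $r_a+1$, applies the $\eta_a$ to consecutive blocks of inputs, then $f$, with sign $(-1)^{\sum_{1\le a<b\le p}r_b(r_a+1)}$; $\xi(F\otimes\mathrm{Id}^{\otimes r})$ inserts $F$ in the first slot of $\xi$ with no extra sign. An $L_\infty[1]$-algebra is a graded vector space $L$ with maps $l_n:L^{\otimes n}\to L$, $n\ge1$, of degree $1$ such that $l_n(x_{\sigma(1)},\dots,x_{\sigma(n)})=\varepsilon(\sigma)l_n(x_1,\dots,x_n)$ and $\sum_{i=1}^n\sum_{\sigma\in\mathrm{Sh}(i,n-i)}\varepsilon(\sigma)l_{n-i+1}(l_i(x_{\sigma(1)},\dots,x_{\sigma(i)}),x_{\sigma(i+1)},\dots,x_{\sigma(n)})=0$, where $\varepsilon(\sigma)$ is the Koszul sign. *)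

(* Defs.v *)
From HB Require Import structures.
From mathcomp Require Import all_boot all_order all_algebra all_fingroup.
From mathcomp Require Import boolp classical_sets functions.

Set Implicit Arguments.
Unset Strict Implicit.
Unset Printing Implicit Defensive.

Import GRing.Theory.

Local Open Scope ring_scope.

(* A family of maps F_N : V^N -> W, N >= 0, is encoded as a single function    *)
(* F : seq V -> W, whose restriction to sequences of length N is F_N.          *)

Section Families.
Variables (k : fieldType) (V W : lmodType k).
Implicit Types F : seq V -> W.

(* each F_N is linear in each of its N arguments *)
Definition multilinear F : Prop :=
  forall (s t : seq V) (a : k) (u v : V),
    F (s ++ (a *: u + v) :: t) = a *: F (s ++ u :: t) + F (s ++ v :: t).

Definition alternating F : Prop :=
  forall (s t r : seq V) (u : V), F (s ++ u :: t ++ u :: r) = 0.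

(* F_N = 0 for N large *)
Definition bounded F : Prop :=
  exists B : nat, forall s : seq V, (B <= size s)%N -> F s = 0.

End Families.

(* The direct sum of the spaces Hom(wedge^N g, g), N >= 0.                     *)

Section AltSpace.
Variables (k : fieldType) (g : lmodType k).

Definition is_alt : {pred seq g -> g} :=
  fun F => `[< [/\ multilinear F, alternating F & bounded F] >].

Record alt := Alt { alt_fun :> seq g -> g; _ : alt_fun \in is_alt }.

HB.instance Definition _ := [isSub for alt_fun].
HB.instance Definition _ := [Choice of alt by <:].

Fact is_alt_submod_closed : submod_closed is_alt.
Proof.
split=> [|a F G].
  apply/asboolP; split=> [s t b u v|s t r u|]; last by exists 0%N.
  - by rewrite /GRing.zero /= scaler0 addr0.
  - by [].
move=> /asboolP[mF aF [BF bF]] /asboolP[mG aG [BG bG]].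
have E x : (a *: F + G) x = a *: F x + G x by [].
apply/asboolP; split=> [s t b u v|s t r u|].
- by rewrite !E mF mG !scalerDr !scalerA [a * b]mulrC addrACA.
- by rewrite E aF aG scaler0 addr0.
- exists (maxn BF BG) => s; rewrite geq_max => /andP[sF sG].
  by rewrite E bF // bG // scaler0 addr0.
Qed.

HB.instance Definition _ :=
  GRing.isSubmodClosed.Build k (seq g -> g) is_alt is_alt_submod_closed.
HB.instance Definition _ := [SubChoice_isSubLmodule of alt by <:].

(* f has degree n if f lies in Hom(wedge^(n+1) g, g); this is {0} if n < -1.   *)
Definition alt_deg (n : int) : set alt :=
  [set f | forall x : seq g, f x != 0 -> (size x)%:Z = n + 1]%classic.

End AltSpace.

Section Gradings.
Variable k : fieldType.

Definition is_grading (L : lmodType k) (H : int -> set L) : Prop :=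
  [/\ forall d, H d 0 /\ (forall (a : k) u v, H d u -> H d v -> H d (a *: u + v)),
      forall x : L, exists (ds : seq int) (y : int -> L),
        (forall d, H d (y d)) /\ x = \sum_(d <- ds) y d
    & forall (ds : seq int) (y : int -> L), uniq ds -> (forall d, H d (y d)) ->
        \sum_(d <- ds) y d = 0 -> forall d, d \in ds -> y d = 0].

Definition shift_deg (V : lmodType k) (H : int -> set V) : int -> set V :=
  fun n => H (n + 1).

Definition sum_deg (V W : lmodType k) (H : int -> set V) (K : int -> set W) :
    int -> set (V * W)%type :=
  fun n => [set x | H n x.1 /\ K n x.2]%classic.

End Gradings.

(* The set Sh(b_1, ..., b_r) of shuffles in 'S_N; it is empty unless all the   *)
(* b_j are nonnegative and add up to N. Permutations act on {0, ..., N - 1};   *)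
(* [reshape_index c i] is the block of sizes c that contains i.                *)
Definition Sh (N : nat) (b : seq int) : {set 'S_N} :=
  let c := [seq absz z | z <- b] in
  [set s : 'S_N | [&& all (fun z => 0 <= z) b, sumn c == N &
     [forall i : 'I_N, [forall j : 'I_N,
       (i < j)%N && (reshape_index c i == reshape_index c j) ==>
       (s i < s j)%N]]]].

(* (x_sigma(1), ..., x_sigma(N)) *)
Definition permute (T : nmodType) (x : seq T) (s : 'S_(size x)) : seq T :=
  [seq x`_(s i) | i <- enum 'I_(size x)].

Section LInfinity.
Variables (k : fieldType) (L : lmodType k) (H : int -> set L).

(* The Koszul sign of s for elements of degrees d_1, ..., d_N. *)
Definition koszul_sign (N : nat) (d : seq int) (s : 'S_N) : k :=
  \prod_(i < N) \prod_(j < N | (i < j)%N && (s j < s i)%N)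
    (-1) ^ (d`_(s i) * d`_(s j)).

Definition homogeneous (d : seq int) (x : seq L) : Prop :=
  size d = size x /\ forall i, (i < size x)%N -> H d`_i x`_i.

(* l_n is the restriction of l to sequences of length n >= 1; the value at     *)
(* [::] is irrelevant.                                                         *)
Definition Linfty1_algebra (l : seq L -> L) : Prop :=
  [/\ is_grading H,
      multilinear l,
      forall d x, x != [::] -> homogeneous d x -> H (\sum_(z <- d) z + 1) (l x),
      forall d x (s : 'S_(size x)), x != [::] -> homogeneous d x ->
        l (permute s) = koszul_sign d s *: l x
    & forall d x, x != [::] -> homogeneous d x ->
        \sum_(1 <= i < (size x).+1)
          \sum_(s in Sh (size x) [:: i%:Z; (size x - i)%N%:Z])
            koszul_sign d s *:
              l (l (take i (permute s)) :: drop i (permute s)) = 0].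

End LInfinity.

Section Operations.
Variables (k : fieldType) (g : lmodType k).
Implicit Types (F G : seq g -> g) (x : seq g).

(* F (G (x) Id^r) *)
Definition insert F G (r : int) : seq g -> g := fun x =>
  let N := (size x - absz r)%N in F (G (take N x) :: drop N x).

(* f (eta_1 (x) ... (x) eta_p (x) Id^q) with eta_a of degree r_a, with the     *)
(* Koszul sign; q is the number of inputs left over by the eta_a.              *)
Definition compose F (r : seq int) (eta : seq (alt g)) : seq g -> g := fun x =>
  let c := [seq absz (z + 1) | z <- r] in
  (-1 : k) ^ (\sum_(b < size r) \sum_(a < b) r`_b * (r`_a + 1)) *:
  F ([seq (e.1 : alt g) e.2 | e <- zip eta (reshape c x)] ++ drop (sumn c) x).

(* the sum over tau in Sh(b) of sgn(tau) F tau^-1 *)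
Definition shuffle_sum (b : seq int) F : seq g -> g := fun x =>
  \sum_(t in Sh (size x) b) (-1 : k) ^+ (odd_perm t) *: F (permute t).

(* P bar-circ Q and [P, Q]_NR, for P and Q of degrees p and q *)
Definition NR_comp (p q : int) F G : seq g -> g :=
  shuffle_sum [:: q + 1; p] (insert F G p).

Definition NR_bracket (p q : int) F G : seq g -> g := fun x =>
  NR_comp p q F G x - (-1 : k) ^ (p * q) *: NR_comp q p G F x.

End Operations.

(* a sequence with its entry of index i (counted from 0) omitted *)
Definition omit (T : Type) (i : nat) (s : seq T) : seq T :=
  take i s ++ drop i.+1 s.

Section ModifiedRotaBaxter.
Variables (k : fieldType) (g : lmodType k).

Definition smL : lmodType k := (alt g * alt g)%type.

Definition smL_deg : int -> set smL :=
  sum_deg (shift_deg (@alt_deg k g)) (@alt_deg k g).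

Definition in_sm (f : alt g) : smL := (f, 0).
Definition in_a (xi : alt g) : smL := (0, xi).

Definition pure (y : alt g + alt g) : smL :=
  match y with inl f => in_sm f | inr xi => in_a xi end.

(* The formula for l_i(sf, xi_1, ..., xi_(i-1)), n - i even, where f has       *)
(* degree n and xi_j degree m_j. The index j < i - 1 is counted from 0.        *)
Definition mRB_formula (lam : k) (n : int) (f : alt g)
    (m : seq int) (xi : seq (alt g)) : seq g -> g := fun x =>
  let i : int := (size xi).+1 in
  let c : k := (- lam) ^ ((n - i + 2) %/ 2)%Z in
  c *: shuffle_sum (rcons [seq z + 1 | z <- m] (n + 2 - i)) (compose f m xi) x
  - \sum_(j < size xi)
      ((-1) ^ ((n + \sum_(h < j) m`_h) * m`_j) * c) *:
      shuffle_sum ([seq z + 1 | z <- omit j m] ++ [:: n + 3 - i; m`_j])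
        (insert (xi`_j) (compose f (omit j m) (omit j xi)) m`_j) x.

End ModifiedRotaBaxter.

(* Main.v *)
(* A modified Rota-Baxter operator T of weight lam is the same thing as a
   subalgebra {T a + eps a} of g[eps], where eps ^ 2 = - lam. Accordingly the
   structure is an instance of Voronov's derived brackets: the big graded Lie
   algebra consists of the alternating functions on g[eps] with the
   Nijenhuis-Richardson bracket, sm is mapped into it by extension of scalars,
   a = Hom(wedge (eps g), g) is an abelian subalgebra, and the projection onto a
   (restriction to eps g, component in g) has a subalgebra as its kernel. Then
   l_i(s f, xi_1, ..., xi_(i-1)) is the projection of
   [...[f, xi_1], ..., xi_(i-1)], and the parity of the number of factors eps
   explains the vanishing of half of these brackets.

   Alternating functions are treated as functions on lists and all identities are
   proved by induction on the list of inputs: contraction with the first input is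
   a derivation of every operation involved. On the side of permutations this
   corresponds to the removal of 0 from the word of a shuffle. *)

Require Import Defs.
From mathcomp Require Import all_boot all_order all_algebra all_fingroup.
From mathcomp Require Import boolp classical_sets functions.
From mathcomp Require Import zify.

Set Implicit Arguments.
Unset Strict Implicit.
Unset Printing Implicit Defensive.

Import GRing.Theory.

Local Open Scope ring_scope.

(** * Linear identities in a Z-module *)

(** The structure is one function on all lists of pairs, so the brackets must make sense on
    inhomogeneous elements: signs depending on a degree are applied componentwise by [tau], [ev] and
    [od]. The powers of [- lam] count inputs. If [p] slots of [f], of degree [n], are filled by the
    [xi], then [f] receives [q = n + 1 - p] inputs from [eps g], and [eps ^ q] lies in [g] only for
    even [q], where it equals [(- lam) ^ (q / 2)]. When some [xi_k] is outermost, [f] receives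
    [q + 1] such inputs and [xi_k] reads the [eps]-component, so again [q] is even and the power is
    the same. Voronov's identity concerns two elements of [sm] followed by elements of [a]; general
    lists are reduced to sorted ones by multilinearity and graded symmetry, and the number of
    arguments in [sm] decides: with at most one, no composite survives; two is Voronov's identity;
    exactly three and nothing else is the Jacobi identity of the Nijenhuis-Richardson bracket; in
    the remaining cases every composite contains a bracket with two arguments in [sm] other than
    [l_2(sf, sg)]. *)

Section ZmodNormalization.
Variable V : zmodType.

Inductive zexp := ZVar of nat | ZZero | ZAdd of zexp & zexp | ZOpp of zexp.

Fixpoint zeval (e : seq V) t :=
  match t with
  | ZVar i => e`_i
  | ZZero => 0
  | ZAdd t1 t2 => zeval e t1 + zeval e t2
  | ZOpp t1 => - zeval e t1
  end.

Fixpoint zcoef t (i : nat) : int :=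
  match t with
  | ZVar j => (i == j)%:Z
  | ZZero => 0
  | ZAdd t1 t2 => zcoef t1 i + zcoef t2 i
  | ZOpp t1 => - zcoef t1 i
  end.

Lemma zevalE e t : zeval e t = \sum_(i < size e) e`_i *~ zcoef t i.
Proof.
elim: t => [j||t1 IH1 t2 IH2|t1 IH1] /=.
- have [lt_j|le_j] := ltnP j (size e).
    rewrite (bigD1 (Ordinal lt_j)) //= eqxx big1 ?addr0 // => i ne_ij.
    by rewrite -val_eqE /= in ne_ij; rewrite (negPf ne_ij).
  (* A variable beyond the environment evaluates to the default [0], and the sum contains no term
     for it. *)
  rewrite nth_default // big1 // => i _.
  by rewrite (ltn_eqF (leq_trans (ltn_ord i) le_j)).
- by rewrite big1.
- by rewrite IH1 IH2 -big_split; apply: eq_bigr => i _; rewrite mulrzDr.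
- by rewrite IH1 -sumrN; apply: eq_bigr => i _; rewrite mulrNz.
Qed.

(** Reflection principle of the tactic [zmod]: the integer coefficients of the finitely many atoms
    are compared by computation. *)
Lemma zmod_eq e t1 t2 :
  all (fun i => zcoef t1 i == zcoef t2 i) (iota 0 (size e)) ->
  zeval e t1 = zeval e t2.
Proof.
move=> /allP E; rewrite !zevalE; apply: eq_bigr => i _.
by rewrite (eqP (E i _)) // mem_iota /=.
Qed.

End ZmodNormalization.

(* Atoms are compared up to conversion, as the instances they contain may be
   reached along different inheritance paths. *)
Ltac zmod_same x y := first [constr_eq x y | unify x y].

Ltac zmod_add x e :=
  let rec aux e0 :=
    match e0 with
    | nil => constr:(x :: e)
    | ?y :: _ => let _ := match goal with _ => zmod_same x y end in e
    | _ :: ?e1 => aux e1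
    end in aux e.

Ltac zmod_atoms x e :=
  lazymatch x with
  | 0 => e
  | ?a + ?b => let e1 := zmod_atoms a e in zmod_atoms b e1
  | - ?a => zmod_atoms a e
  | _ => zmod_add x e
  end.

Ltac zmod_index x e :=
  match e with
  | ?y :: _ => let _ := match goal with _ => zmod_same x y end in constr:(0%N)
  | _ :: ?e1 => let i := zmod_index x e1 in constr:(S i)
  end.

Ltac zmod_reify x e :=
  lazymatch x with
  | 0 => constr:(ZZero)
  | ?a + ?b => let s := zmod_reify a e in let t := zmod_reify b e in
               constr:(ZAdd s t)
  | - ?a => let s := zmod_reify a e in constr:(ZOpp s)
  | _ => let i := zmod_index x e in constr:(ZVar i)
  end.

Ltac zmod :=
  lazymatch goal with
  | |- @eq ?T ?x ?y =>
    let e0 := zmod_atoms x (@nil T) in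
    let e := zmod_atoms y e0 in
    let s := zmod_reify x e in
    let t := zmod_reify y e in
    change (zeval e s = zeval e t); apply: zmod_eq; vm_compute; reflexivity
  end.

Section Pointwise.
Variables (k : fieldType) (T : Type) (W : lmodType k).
Implicit Types (F G : T -> W).

Lemma appD F G x : (F + G) x = F x + G x. Proof. by []. Qed.
Lemma appN F x : (- F) x = - F x. Proof. by []. Qed.
Lemma appZ a F x : (a *: F) x = a *: F x. Proof. by []. Qed.
Lemma app0 x : (0 : T -> W) x = 0. Proof. by []. Qed.
Definition appE := (appD, appN, appZ, app0).

End Pointwise.

(** * The Nijenhuis-Richardson product *)

Section Contraction.
Variables (k : fieldType) (W W' : lmodType k).

Definition malt (F : seq W -> W') := multilinear F /\ alternating F.

Definition ctr (z : W) (F : seq W -> W') : seq W -> W' := fun s => F (z :: s).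

(** Common form of the operators acting by a scalar on each component: the sign [tau], the even and
    odd parts, the projections onto homogeneous components. *)
Definition wt (c : nat -> k) (F : seq W -> W') : seq W -> W' :=
  fun s => c (size s) *: F s.

Lemma malt_ctr z F : malt F -> malt (ctr z F).
Proof. by case=> mF aF; split=> [s t|s t];
  [exact: (mF (z :: s))|exact: (aF (z :: s))]. Qed.

Lemma malt0 : malt (0 : seq W -> W').
Proof. by split=> // s t a u v; rewrite /GRing.zero /= scaler0 addr0. Qed.

Lemma malt_lin (a : k) F G : malt F -> malt G -> malt (a *: F + G).
Proof.
have E x : (a *: F + G) x = a *: F x + G x by [].
case=> mF aF [mG aG]; split=> [s t b u v|s t r u]; rewrite !E.
  by rewrite mF mG !scalerDr !scalerA [a * b]mulrC addrACA.
by rewrite aF aG scaler0 addr0.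
Qed.

Lemma malt_wt c F : malt F -> malt (wt c F).
Proof.
case=> mF aF; split=> [s t b u v|s t r u]; rewrite /wt.
  by rewrite !size_cat /= mF scalerDr !scalerA [b * _]mulrC.
by rewrite aF scaler0.
Qed.

Lemma ctr_lin F : malt F -> forall a u v,
  ctr (a *: u + v) F = a *: ctr u F + ctr v F.
Proof. by case=> mF _ a u v; apply/funext => s; exact: (mF [::]). Qed.

Lemma malt_D F : malt F -> forall s u v t,
  F (s ++ (u + v) :: t) = F (s ++ u :: t) + F (s ++ v :: t).
Proof. by case=> mF _ s u v t; have := mF s t 1 u v; rewrite !scale1r. Qed.

Lemma malt_0 F : malt F -> forall s t, F (s ++ 0 :: t) = 0.
Proof.
move=> mF s t; apply: (@addrI _ (F (s ++ 0 :: t))).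
by rewrite -malt_D // !addr0.
Qed.

Lemma malt_Z F : malt F -> forall s a u t,
  F (s ++ (a *: u) :: t) = a *: F (s ++ u :: t).
Proof.
move=> mF s a u t; have := mF.1 s t a u 0.
by rewrite malt_0 // !addr0.
Qed.

Lemma malt_swap F : malt F -> forall s u v t,
  F (s ++ u :: v :: t) = - F (s ++ v :: u :: t).
Proof.
move=> mF s u v t; apply/eqP; rewrite -addr_eq0; apply/eqP.
have D a : F (s ++ a :: (u + v) :: t) =
  F (s ++ a :: u :: t) + F (s ++ a :: v :: t).
  by rewrite -!(cat_rcons a) malt_D.
have := mF.2 s [::] t (u + v); rewrite /= (malt_D mF) !D.
by rewrite !(mF.2 s [::] t) /= add0r addr0.
Qed.

(** Polarization on adjacent entries gives the sign of a transposition, and transpositions bring two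
    distant equal entries together. *)
Lemma malt_adj F : multilinear F ->
  (forall s u t, F (s ++ u :: u :: t) = 0) -> malt F.
Proof.
move=> mF aF.
have D s u v t : F (s ++ (u + v) :: t) = F (s ++ u :: t) + F (s ++ v :: t).
  by have := mF s t 1 u v; rewrite !scale1r.
have sw s u v t : F (s ++ u :: v :: t) = - F (s ++ v :: u :: t).
  apply/eqP; rewrite -addr_eq0; apply/eqP.
  have D2 a : F (s ++ a :: (u + v) :: t) =
    F (s ++ a :: u :: t) + F (s ++ a :: v :: t).
    by rewrite -!(cat_rcons a) D.
  have := aF s (u + v) t; rewrite D !D2.
  by rewrite !aF add0r addr0.
split=> // s t; elim: t s => [|v t IH] s r u /=; first exact: aF.
by rewrite sw -cat_rcons IH oppr0.
Qed.

End Contraction.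

Arguments ctr {k W W'} z F s /.

Section CircleProduct.
Variables (k : fieldType) (W : lmodType k).
Implicit Types F G H : seq W -> W.

(* Functions of n arguments have degree n - 1. *)
Definition tau (W' : lmodType k) (F : seq W -> W') : seq W -> W' :=
  wt (fun n => (-1) ^+ n.+1) F.

(* The Nijenhuis-Richardson product: the first input is either fed to [G], or to
   [F] after passing [G]. *)
Fixpoint circ (W' : lmodType k) (F : seq W -> W') G (s : seq W) : W' :=
  if s is z :: s' then circ F (ctr z G) s' + circ (ctr z F) (tau G) s'
  else F [:: G [::]].

Lemma circ_cons (W' : lmodType k) (F : seq W -> W') G z s :
  circ F G (z :: s) = circ F (ctr z G) s + circ (ctr z F) (tau G) s.
Proof. by []. Qed.

Lemma ctr_circ (W' : lmodType k) (F : seq W -> W') G z :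
  ctr z (circ F G) = circ F (ctr z G) + circ (ctr z F) (tau G).
Proof. by []. Qed.

Lemma ctrD (W' : lmodType k) a (F F' : seq W -> W') z :
  ctr z (a *: F + F') = a *: ctr z F + ctr z F'.
Proof. by []. Qed.

Lemma ctrB (W' : lmodType k) (F F' : seq W -> W') z :
  ctr z (F - F') = ctr z F - ctr z F'.
Proof. by []. Qed.

Lemma circDl (W' : lmodType k) a (F F' : seq W -> W') G :
  circ (a *: F + F') G = a *: circ F G + circ F' G.
Proof.
apply/funext => s; rewrite !appE.
elim: s F F' G => [|z s IH] F F' G //.
by rewrite !circ_cons ctrD !IH scalerDr addrACA.
Qed.

Lemma tau_lin (W' : lmodType k) a (F G : seq W -> W') : tau (a *: F + G) =
  a *: tau F + tau G.
Proof.
apply/funext => s; rewrite /tau /wt !appE.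
by rewrite scalerDr !scalerA mulrC.
Qed.

(** Unlike linearity in [F], this needs [F] multilinear, since the recursion ends with the value of
    [G] as an argument of [F]. *)
Lemma circDr (W' : lmodType k) a (F : seq W -> W') G G' : malt F ->
  circ F (a *: G + G') = a *: circ F G + circ F G'.
Proof.
move=> mF; apply/funext => s; rewrite [RHS]/(a *: circ F G s + circ F G' s).
elim: s F G G' mF => [|z s IH] F G G' mF; first exact: (mF.1 [::]).
rewrite !circ_cons ctrD tau_lin (IH (ctr z F)) ?(IH F _ _ mF).
  by rewrite scalerDr addrACA.
exact: malt_ctr.
Qed.

Lemma circAl (W' : lmodType k) (F F' : seq W -> W') G :
  circ (F + F') G = circ F G + circ F' G.
Proof. by have := circDl 1 F F' G; rewrite !scale1r. Qed.

Lemma circ0l (W' : lmodType k) G : circ (0 : seq W -> W') G = 0.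
Proof. by have := circDl (-1) 0 (0 : seq W -> W') G;
  rewrite addr0 scaler0 scaleN1r addNr. Qed.

Lemma circZl (W' : lmodType k) a (F : seq W -> W') G :
  circ (a *: F) G = a *: circ F G.
Proof. by have := circDl a F 0 G; rewrite circ0l !addr0. Qed.

Lemma circNl (W' : lmodType k) (F : seq W -> W') G : circ (- F) G = - circ F G.
Proof. by rewrite -scaleN1r circZl scaleN1r. Qed.

Lemma circAr (W' : lmodType k) (F : seq W -> W') G G' : malt F ->
  circ F (G + G') = circ F G + circ F G'.
Proof. by move=> mF; have := circDr 1 G G' mF; rewrite !scale1r. Qed.

Lemma circ0r (W' : lmodType k) (F : seq W -> W') : malt F -> circ F 0 = 0.
Proof.
by move=> mF; have := circDr (-1) 0 0 mF; rewrite addr0 scaler0 scaleN1r addNr.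
Qed.

Lemma circZr (W' : lmodType k) a (F : seq W -> W') G : malt F ->
  circ F (a *: G) = a *: circ F G.
Proof. by move=> mF; have := circDr a G 0 mF; rewrite circ0r // !addr0. Qed.

Lemma circNr (W' : lmodType k) (F : seq W -> W') G : malt F ->
  circ F (- G) = - circ F G.
Proof. by move=> mF; rewrite -scaleN1r circZr // scaleN1r. Qed.

Lemma maltZ (W' : lmodType k) a (F : seq W -> W') : malt F -> malt (a *: F).
Proof. by move=> mF; rewrite -[_ *: _]addr0; apply: malt_lin => //;
  apply: malt0. Qed.

Lemma maltD (W' : lmodType k) (F G : seq W -> W') : malt F -> malt G ->
  malt (F + G).
Proof. by move=> mF mG; rewrite -[F]scale1r; apply: malt_lin. Qed.

Lemma maltN (W' : lmodType k) (F : seq W -> W') : malt F -> malt (- F).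
Proof. by move=> mF; rewrite -scaleN1r; apply: maltZ. Qed.

Lemma malt_tau (W' : lmodType k) (F : seq W -> W') : malt F -> malt (tau F).
Proof. exact: malt_wt. Qed.

(** Contraction lowers the degree by one. *)
Lemma tau_ctr (W' : lmodType k) z (F : seq W -> W') : ctr z (tau F) =
  - tau (ctr z F).
Proof.
by apply/funext => s; rewrite /tau /wt /= appN exprS mulN1r scaleNr.
Qed.

Lemma tauZ (W' : lmodType k) a (F : seq W -> W') : tau (a *: F) = a *: tau F.
Proof.
have tau0 : tau (0 : seq W -> W') = 0 by apply/funext => s; apply: scaler0.
by have := tau_lin a F 0; rewrite tau0 !addr0.
Qed.

Lemma tauD (W' : lmodType k) (F G : seq W -> W') : tau (F + G) = tau F + tau G.
Proof. by have := tau_lin 1 F G; rewrite !scale1r. Qed.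

Ltac malt_auto :=
  repeat first [assumption | apply: malt_ctr | apply: malt_tau | apply: maltZ
               | apply: maltD | apply: maltN | apply: malt0].

(** In a double contraction with [u] the two terms contracting [F] once and [G] once cancel, because
    [tau] anticommutes with contraction; the other two vanish as [F] and [G] alternate. *)
Lemma malt_circ (W' : lmodType k) (F : seq W -> W') G :
  malt F -> malt G -> malt (circ F G).
Proof.
move=> mF mG; apply: malt_adj => s.
  elim: s F G mF mG => [|z s IH] F G mF mG t a u v.
    rewrite /= !ctr_lin // circDl circDr //.
    rewrite !appE scalerDr; zmod.
  rewrite !cat_cons !circ_cons !IH.
    by rewrite scalerDr; zmod.
  all: try by malt_auto.
elim: s F G mF mG => [|z s IH] F G mF mG u t.
  rewrite !cat0s !circ_cons tau_ctr circNr; last exact: malt_ctr.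
  have E (W1 : lmodType k) (H : seq W -> W1) : malt H -> ctr u (ctr u H) = 0.
    by move=> mH; apply/funext => r; apply: (mH.2 [::] [::]).
  by rewrite (E _ G) // (E _ F) // circ0r // circ0l !appE; zmod.
rewrite !cat_cons !circ_cons !IH ?addr0 //.
all: try by malt_auto.
Qed.

Lemma tau_circ (W' : lmodType k) (F : seq W -> W') G :
  malt F -> tau (circ F G) = circ (tau F) (tau G).
Proof.
move=> mF; apply/funext => s; elim: s F G mF => [|z s IH] F G mF.
  rewrite /tau /wt /= expr1 -[- 1]/(-1) !expr2 mulN1r opprK scale1r.
  by rewrite (malt_Z mF [::]).
rewrite circ_cons -[LHS]/(ctr z (tau (circ F G)) s) tau_ctr ctr_circ tauD.
rewrite !appE opprD !IH //; last exact: malt_ctr.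
rewrite -[ctr z (tau G)]opprK -[ctr z (tau F)]opprK tau_ctr tau_ctr !opprK.
by rewrite circNl circNr //; exact: malt_tau.
Qed.

(** Parity of the degree as an eigenvalue of [tau]: implied by homogeneity and flipped by each
    contraction, which suits inductions on the inputs. *)
Definition par (W' : lmodType k) (p : bool) (F : seq W -> W') :=
  tau F = (-1) ^+ p *: F.

Lemma par_ctr (W' : lmodType k) p (F : seq W -> W') z : par p F ->
  par (~~ p) (ctr z F).
Proof.
move=> pF; rewrite /par -[LHS]opprK -tau_ctr pF.
by case: p {pF}; apply/funext => s;
  rewrite /= !appE ?expr1 ?scaleN1r ?scale1r ?opprK.
Qed.

Lemma par_circ (W' : lmodType k) p q (F : seq W -> W') G : malt F -> par p F ->
  par q G ->
  par (p (+) q) (circ F G).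
Proof.
by move=> mF pF pG; rewrite /par tau_circ // pF pG circZl circZr // scalerA
  signr_addb.
Qed.

Definition assoc (W' : lmodType k) (F : seq W -> W') G H :=
  circ (circ F G) H - circ F (circ G H).

(** The vector [z] reaches [G] after passing [H], and [F] after passing both [G] and [H]; this is
    the origin of the two signs. *)
Lemma ctr_assoc (W' : lmodType k) (F : seq W -> W') G H g h z :
  malt F -> malt G -> malt H -> par g G -> par h H ->
  ctr z (assoc F G H) = assoc F G (ctr z H) + (-1) ^+ h *: assoc F (ctr z G) H
    + (-1) ^+ (g (+) h) *: assoc (ctr z F) G H.
Proof.
move=> mF mG mH pG pH.
have mFz : malt (ctr z F) by apply: malt_ctr.
have mG' : malt (ctr z G) by apply: malt_ctr.
have [mFG mFG' mF'G] : [/\ malt (circ F G),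
  malt (circ F (ctr z G)) & malt (circ (ctr z F) G)].
  by split; apply: malt_circ.
rewrite /assoc ctrB !ctr_circ (circAr _ _ mF) circAl tau_circ // pG pH
  !(circZl, circZr) //; last exact: maltZ.
by case: g h {pG pH} => -[] /=; rewrite ?expr1 ?expr0 ?scaleN1r ?scale1r; zmod.
Qed.

(* Contraction with z acts on the associator as a derivation, so it suffices to
   compare both sides on the empty sequence. *)
Lemma pre_Lie (W' : lmodType k) (F : seq W -> W') G H g h :
  malt F -> malt G -> malt H -> par g G -> par h H ->
  assoc F G H = (-1) ^+ (g && h) *: assoc F H G.
Proof.
move=> mF mG mH pG pH; apply/funext => s; rewrite appZ.
elim: s F G H g h mF mG mH pG pH => [|z s IH] F G H g h mF mG mH pG pH.
  have E (q : bool) (K : seq W -> W) : par q K -> K [::] =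
    (-1) ^+ (~~ q) *: K [::].
    move=> /(congr1 (fun K => K [::])); rewrite /tau /wt /= appZ expr1 scaleN1r.
    by case: q => /=; rewrite ?expr1 ?expr0 ?scaleN1r ?scale1r // => {1}<-;
      rewrite opprK.
  rewrite /assoc !appE /= ?appE /= /tau /wt /= !expr1 !scaleN1r.
  have mN u v : F [:: u; - v] = - F [:: u; v].
    by rewrite -scaleN1r (malt_Z mF [:: u]) scaleN1r.
  (* On the empty list the associator reduces to [F [:: G [::]; H [::]]], antisymmetric in [G] and
     [H] as required when both are odd. Constants have degree -1, so the constant term of an even
     function is its own negative, which settles the other cases. *)
  have x_odd : ~~ (g && h) -> F [:: G [::]; H [::]] = - F [:: G [::]; H [::]].
    have mN1 u v : F [:: - u; v] = - F [:: u; v].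
      by rewrite -scaleN1r (malt_Z mF [::]) scaleN1r.
    move: (E _ _ pG) (E _ _ pH).
    by case: g h {pG pH} => -[] //= EG EH _;
      [rewrite {1}EH|rewrite {1}EG|rewrite {1}EG];
        rewrite expr1 scaleN1r ?mN ?mN1.
  rewrite !mN [F [:: H [::]; _]](malt_swap mF [::]) /=.
  case: (g && h) x_odd => /= [_|x_odd].
    rewrite expr1 scaleN1r; zmod.
  rewrite expr0 scale1r; transitivity (F [:: G [::]; H [::]]); first by zmod.
  by rewrite {1}x_odd //; zmod.
rewrite -![assoc _ _ _ (z :: s)]/(ctr z (assoc _ _ _) s).
rewrite (ctr_assoc z mF mG mH pG pH) (ctr_assoc z mF mH mG pH pG) !appE.
have [mFz mGz mHz] : [/\ malt (ctr z F),
  malt (ctr z G) & malt (ctr z H)] by split; apply: malt_ctr.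
rewrite (IH F G (ctr z H) g (~~ h)) ?(IH F (ctr z G) H (~~ g) h) ?(IH (ctr z F)
  G H g h) //; last 2 first.
- exact: par_ctr.
- exact: par_ctr.
case: g h {pG pH} => -[] /=; rewrite ?expr1 ?expr0 ?scaleN1r ?scale1r; zmod.
Qed.

End CircleProduct.

Arguments circ {k W W'} F G s.

(** * The Nijenhuis-Richardson bracket of inhomogeneous functions *)

Section Bracket.
Variables (k : fieldType) (W : lmodType k).
Implicit Types F G H : seq W -> W.

(** An odd number of arguments means an even degree. *)
Definition ev F := wt (fun n => (odd n)%:R) F.
Definition od F := wt (fun n => (~~ odd n)%:R) F.

(** The sign [(-1)^(pq)] without degrees: it is trivial on the even part of [G], and on the odd part
    it is the action of [tau] on [F]. *)
Definition br F G := circ F G - circ (ev G) F - circ (od G) (tau F).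

Lemma evD_od F : ev F + od F = F.
Proof.
apply/funext => s; rewrite appD /ev /od /wt.
by case: odd; rewrite scale0r scale1r ?addr0 ?add0r.
Qed.

Lemma tauE F : tau F = ev F - od F.
Proof.
apply/funext => s; rewrite !appE /tau /ev /od /wt exprS -signr_odd.
by case: odd; rewrite /= ?expr1 ?expr0 ?mulN1r ?opprK !(scale0r, scale1r,
  scaleN1r); zmod.
Qed.

Lemma malt_ev F : malt F -> malt (ev F). Proof. exact: malt_wt. Qed.
Lemma malt_od F : malt F -> malt (od F). Proof. exact: malt_wt. Qed.

Lemma brE p q F G : malt G -> par p F -> par q G ->
  br F G = circ F G - (-1) ^+ (p && q) *: circ G F.
Proof.
move=> mG pF pG; rewrite /br pF circZr; last exact: malt_od.
case: p {pF} => /=.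
  rewrite -(circZl _ G) -pG tauE circAl circNl expr1 scaleN1r; zmod.
by rewrite expr0 !scale1r -[X in _ = _ - circ X _]evD_od circAl; zmod.
Qed.

Lemma brC p q F G : malt F -> malt G -> par p F -> par q G ->
  br G F = - ((-1) ^+ (p && q) *: br F G).
Proof.
move=> mF mG pF pG; rewrite (brE mG pF pG) (brE mF pG pF) andbC.
by case: (p && q); rewrite /= ?expr1 ?expr0 ?scaleN1r ?scale1r; zmod.
Qed.

Lemma malt_br F G : malt F -> malt G -> malt (br F G).
Proof.
move=> mF mG; apply: maltD; [apply: maltD; [|apply: maltN]|apply: maltN];
  apply: malt_circ => //.
- exact: malt_ev.
- exact: malt_od.
- exact: malt_tau.
Qed.

Lemma par_lin p a F G : par p F -> par p G -> par p (a *: F + G).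
Proof.
move=> pF pG; rewrite /par tau_lin pF pG.
by case: p {pF pG}; rewrite /= ?expr1 ?expr0 ?scaleN1r ?scale1r ?scalerN; zmod.
Qed.

Lemma par0 p : par p (0 : seq W -> W).
Proof. by rewrite /par scaler0; apply/funext => s; apply: scaler0. Qed.

Lemma parZ p a F : par p F -> par p (a *: F).
Proof. by move=> pF; rewrite -[_ *: _]addr0; apply: par_lin => //;
  apply: par0. Qed.

Lemma parN p F : par p F -> par p (- F).
Proof. by move=> pF; rewrite -scaleN1r; apply: parZ. Qed.

Lemma parD p F G : par p F -> par p G -> par p (F + G).
Proof. by move=> pF pG; rewrite -[F]scale1r; apply: par_lin. Qed.

Lemma par_br p q F G : malt F -> malt G -> par p F -> par q G ->
  par (p (+) q) (br F G).
Proof.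
move=> mF mG pF pG; rewrite (brE mG pF pG); apply: parD; first exact: par_circ.
by apply/parN/parZ; rewrite addbC; apply: par_circ.
Qed.

Lemma brDl a F F' G : malt G ->
  br (a *: F + F') G = a *: br F G + br F' G.
Proof.
move=> mG; rewrite /br tau_lin circDl !circDr;
  try by [exact: malt_ev|exact: malt_od].
by rewrite !scalerBr; zmod.
Qed.

Lemma brDr a F G G' : malt F ->
  br F (a *: G + G') = a *: br F G + br F G'.
Proof.
move=> mF.
have E c : wt c (a *: G + G') = a *: wt c G + wt c G'.
  by apply/funext => s; rewrite /wt !appE scalerDr !scalerA mulrC.
by rewrite /br /ev /od !E !circDl circDr // !scalerBr; zmod.
Qed.

Lemma brBl F F' G : malt G -> br (F - F') G = br F G - br F' G.
Proof. by move=> mG; have := brDl (-1) F' F mG; rewrite !scaleN1r addrC => ->;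
  rewrite addrC. Qed.

Lemma brBr F G G' : malt F -> br F (G - G') = br F G - br F G'.
Proof. by move=> mF; have := brDr (-1) G' G mF; rewrite !scaleN1r addrC => ->;
  rewrite addrC. Qed.

Lemma br0l G : malt G -> br 0 G = 0.
Proof. by move=> mG; have := brBl 0 0 mG; rewrite !subrr. Qed.

Lemma br0r F : malt F -> br F 0 = 0.
Proof. by move=> mF; have := brDr (-1) 0 0 mF;
  rewrite addr0 scaler0 scaleN1r addNr. Qed.

Lemma brZl a F G : malt G -> br (a *: F) G = a *: br F G.
Proof. by move=> mG; have := brDl a F 0 mG; rewrite br0l // !addr0. Qed.

(** The commutator of a graded pre-Lie product is a Lie bracket: the three instances of [pre_Lie]
    eliminate all associators. The form chosen says that [br _ H] is a derivation, as iterated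
    brackets add operands on the right. *)
Lemma br_jacobi p q r F G H : malt F -> malt G -> malt H ->
  par p F -> par q G -> par r H ->
  br (br F G) H = br F (br G H) + (-1) ^+ (q && r) *: br (br F H) G.
Proof.
move=> mF mG mH pF pG pH.
have [mFG mGH mFH] : [/\ malt (br F G),
  malt (br G H) & malt (br F H)] by split; apply: malt_br.
rewrite (brE mH (par_br mF mG pF pG) pH) (brE mGH pF (par_br mG mH pG pH)).
rewrite (brE mG (par_br mF mH pF pH) pG) (brE mG pF pG) (brE mH pG pH) (brE mH
  pF pH).
have E1 := pre_Lie mF mG mH pG pH; have E2 := pre_Lie mG mH mF pH pF.
have E3 := pre_Lie mH mF mG pF pG; move: E1 E2 E3; rewrite /assoc.
rewrite !(circAl, circNl, circZl, circAr _ _ mF, circNr _ mF, circZr _ _ mF,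
  circAr _ _ mG, circNr _ mG, circZr _ _ mG, circAr _ _ mH, circNr _ mH,
    circZr _ _ mH).
move=> /(canRL (subrK _)) -> /(canRL (subrK _)) -> /(canRL (subrK _)) ->.
by case: p q r {pF pG pH} => -[] -[];
  rewrite /= ?expr1 ?expr0 ?scaleN1r ?scale1r; zmod.
Qed.

End Bracket.

Arguments br {k W} F G.

(** * Vanishing bounds and degrees *)

Section BoundsAndDegrees.
Variables (k : fieldType) (W W' : lmodType k).

Definition vanish_from (B : nat) (F : seq W -> W') :=
  forall s, (B <= size s)%N -> F s = 0.

(** The condition of [alt_deg] for bare functions on any module; on [alt g] the two are
    convertible. *)
Definition hdeg (n : int) (F : seq W -> W') :=
  forall s, F s != 0 -> (size s)%:Z = n + 1.

End BoundsAndDegrees.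

Section BoundsAndDegreesTheory.
Variables (k : fieldType) (W W' : lmodType k).

Lemma vanish_circ A B (F : seq W -> W') (G : seq W -> W) : malt F ->
  vanish_from A F -> vanish_from B G -> vanish_from (A + B) (circ F G).
Proof.
move=> mF bF bG s; elim: s A B F G mF bF bG => [|z s IH] A B F G mF bF bG.
  by rewrite leqn0 addn_eq0 => /andP[/eqP A0 _]; apply: bF; rewrite A0.
case: A bF => [|A] bF lt_s.
  rewrite (_ : F = 0) ?circ0l //.
  by apply/funext => r; apply: bF.
case: B bG lt_s => [|B] bG lt_s.
  rewrite (_ : G = 0) ?circ0r //.
  by apply/funext => r; apply: bG.
rewrite /= in lt_s.
have bG' : vanish_from B (ctr z G) by move=> r ?; apply: bG.
have bF' : vanish_from A (ctr z F) by move=> r ?; apply: bF.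
have btG : vanish_from B.+1 (tau G) by move=> r ?; rewrite /tau /wt bG ?scaler0.
rewrite circ_cons (IH _ _ _ _ mF bF bG') ?(IH _ _ _ _ (malt_ctr z mF) bF' btG)
  ?addr0 //; lia.
Qed.

Lemma vanish_wt c B (F : seq W -> W') : vanish_from B F ->
  vanish_from B (wt c F).
Proof. by move=> bF s ?; rewrite /wt bF ?scaler0. Qed.

Lemma hdeg_wt c n (F : seq W -> W') : hdeg n F -> hdeg n (wt c F).
Proof.
move=> dF s; have [F0|F0 _] := eqVneq (F s) 0; last exact: dF.
by rewrite /wt F0 scaler0 eqxx.
Qed.

Lemma hdeg_ctr n z (F : seq W -> W') : hdeg n F -> hdeg (n - 1) (ctr z F).
Proof. by move=> dF s /dF /= H; rewrite subrK; apply: (addIr 1);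
  rewrite -H intS addrC. Qed.

Lemma hdeg0 n : hdeg n (0 : seq W -> W').
Proof. by move=> s; rewrite eqxx. Qed.

Lemma hdegD n (F G : seq W -> W') : hdeg n F -> hdeg n G -> hdeg n (F + G).
Proof.
move=> dF dG s; rewrite appD; have [F0|F0 _] := eqVneq (F s) 0; last exact: dF.
by rewrite F0 add0r; apply: dG.
Qed.

Lemma hdegZ n a (F : seq W -> W') : hdeg n F -> hdeg n (a *: F).
Proof. by move=> dF s; apply: (@hdeg_wt (fun=> a) n F dF). Qed.

Lemma hdegN n (F : seq W -> W') : hdeg n F -> hdeg n (- F).
Proof. by rewrite -scaleN1r; apply: hdegZ. Qed.

End BoundsAndDegreesTheory.

Section DegreeOfCircle.
Variables (k : fieldType) (W W' : lmodType k).

Lemma hdeg_circ p q (F : seq W -> W') (G : seq W -> W) : malt F ->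
  hdeg p F -> hdeg q G -> hdeg (p + q) (circ F G).
Proof.
move=> mF dF dG s; elim: s p q F G mF dF dG => [|z s IH] p q F G mF dF dG.
  rewrite /=; have [->|/dG G0] := eqVneq (G [::]) 0.
    by rewrite (malt_0 mF [::] [::]) eqxx.
  by move=> /dF /= F1; rewrite -addrA -G0 addr0; apply: (addIr 1); rewrite -F1.
rewrite circ_cons -addrA.
have [E|/IH E _] := eqVneq (circ F (ctr z G) s) 0; last first.
  by have := E p (q - 1) mF dF (hdeg_ctr dG); rewrite /=; lia.
rewrite E add0r => /IH E1.
have {E1} := E1 (p - 1) q; rewrite /= => E1.
suff : (size s)%:Z = p - 1 + q + 1 by lia.
apply: E1.
- exact: malt_ctr.
- exact: hdeg_ctr.
- exact: hdeg_wt.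
Qed.

Lemma hdeg_par n (F : seq W -> W') : hdeg n F -> par (odd (absz n)) F.
Proof.
move=> dF; rewrite /par; apply/funext => s; rewrite appZ /tau /wt.
have [->|/dF ds] := eqVneq (F s) 0; first by rewrite !scaler0.
congr (_ *: _); rewrite -signr_odd; congr (_ ^+ _).
have -> : n = (size s)%:Z - 1 by rewrite ds addrK.
by case: (size s) => [|m] //; rewrite intS addrC addKr /= negbK.
Qed.

End DegreeOfCircle.

(** * Extension of scalars to g[eps] *)

Section Extension.
Variables (k : fieldType) (g : lmodType k) (lam : k).
Let W : lmodType k := (g * g)%type.
Implicit Types (F G : seq g -> g) (A B : seq W -> W).

(* [W] is g[eps] with eps ^ 2 = - lam, the pair (a, b) standing for a + eps b. *)
Definition eps (z : W) : W := (- lam *: z.2, z.1).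

Lemma epsD u v : eps (u + v) = eps u + eps v.
Proof. by congr (_, _); rewrite scalerDr. Qed.

Lemma epsZ a u : eps (a *: u) = a *: eps u.
Proof. by congr (_, _); rewrite /= !scalerA mulrC. Qed.

Lemma eps_lin a u v : eps (a *: u + v) = a *: eps u + eps v.
Proof. by rewrite epsD epsZ. Qed.

Lemma eps0 : eps 0 = 0.
Proof. by congr (_, _); rewrite /= scaler0. Qed.

Lemma epsN u : eps (- u) = - eps u.
Proof. by rewrite -scaleN1r epsZ scaleN1r. Qed.

Lemma epsK u : eps (eps u) = - lam *: u.
Proof. by []. Qed.

Fixpoint ext F (s : seq W) : W :=
  if s is z :: s' then ext (ctr z.1 F) s' + eps (ext (ctr z.2 F) s')
  else (F [::], 0).

Lemma ext_lin a F G : ext (a *: F + G) = a *: ext F + ext G.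
Proof.
apply/funext => s; rewrite !appE.
elim: s F G => [|z s IH] F G; first by congr (_, _); rewrite /= ?scaler0 ?addr0.
by rewrite [LHS]/= ctrD !IH epsD epsZ /= scalerDr; zmod.
Qed.

Lemma ext0 : ext 0 = 0.
Proof. by have := ext_lin (-1) 0 0; rewrite addr0 scaler0 scaleN1r addNr. Qed.

Lemma extD F G : ext (F + G) = ext F + ext G.
Proof. by have := ext_lin 1 F G; rewrite !scale1r. Qed.

Lemma extZ a F : ext (a *: F) = a *: ext F.
Proof. by have := ext_lin a F 0; rewrite ext0 !addr0. Qed.

Lemma extN F : ext (- F) = - ext F.
Proof. by rewrite -scaleN1r extZ scaleN1r. Qed.

Lemma ctr_ext F z : ctr z (ext F) = ext (ctr z.1 F) + (eps \o ext (ctr z.2 F)).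
Proof. by []. Qed.

(** In a double contraction with [a + eps b] the [eps]-terms contract [F] with [a], [b] in both
    orders and cancel. *)
Lemma malt_ext F : malt F -> malt (ext F).
Proof.
move=> mF; apply: malt_adj => s.
  elim: s F mF => [|z s IH] F mF t a u v.
    rewrite /= !ctr_lin // !ext_lin !appE eps_lin scalerDr; zmod.
  by rewrite /= !IH ?eps_lin ?scalerDr; [zmod|exact: malt_ctr..].
elim: s F mF => [|z s IH] F mF u t; last first.
  by rewrite /= !IH ?add0r ?eps0 //; exact: malt_ctr.
rewrite /= epsD epsK.
have E0 v : ctr v (ctr v F) = 0.
  by apply/funext => r; apply: (mF.2 [::] [::]).
have -> : ctr u.1 (ctr u.2 F) = - ctr u.2 (ctr u.1 F).
  by apply/funext => r; apply: (malt_swap mF [::]).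
rewrite !E0 ext0 extN !appE epsN scaler0; zmod.
Qed.

Lemma ext_wt c F : ext (wt c F) = wt c (ext F).
Proof.
apply/funext => s; elim: s c F => [|z s IH] c F.
  by rewrite /wt /=; congr (_, _); rewrite ?scaler0.
have E y : ctr y (wt c F) = wt (c \o succn) (ctr y F) by [].
by rewrite [LHS]/= !E !IH /wt /= epsZ scalerDr.
Qed.

Definition eps_linear A := forall s y t,
  A (s ++ eps y :: t) = eps (A (s ++ y :: t)).

Lemma ext_eps_linear F : malt F -> eps_linear (ext F).
Proof.
move=> mF s; elim: s F mF => [|z s IH] F mF y t.
  rewrite /= epsD epsK (_ : ctr (- lam *: y.2) F = - lam *: ctr y.2 F).
    by rewrite extZ !appE addrC.
  by apply/funext => r; apply: (malt_Z mF [::]).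
by rewrite /= !IH ?epsD; [|exact: malt_ctr..].
Qed.

Lemma circ_epsr A B : eps_linear A -> circ A (eps \o B) = eps \o circ A B.
Proof.
move=> eA; apply/funext => s; rewrite [RHS]/=;
  elim: s A B eA => [|z s IH] A B eA.
  exact: (eA [::] _ [::]).
have tE : tau (eps \o B) = eps \o tau B.
  by apply/funext => r; rewrite /tau /wt /= epsZ.
rewrite !circ_cons tE -[ctr z (eps \o B)]/(eps \o ctr z B) !IH ?epsD //.
by move=> r; apply: (eA (z :: r)).
Qed.

Lemma circ_epsl A B : circ (eps \o A) B = eps \o circ A B.
Proof.
apply/funext => s; rewrite [RHS]/=; elim: s A B => [|z s IH] A B //.
by rewrite !circ_cons -[ctr z (eps \o A)]/(eps \o ctr z A) !IH epsD.
Qed.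

(** Contracting [ext G] produces a factor [eps], which [ext F] lets through because it is
    [eps]-linear in each argument. *)
Lemma ext_circ F G : malt F -> ext (circ F G) = circ (ext F) (ext G).
Proof.
move=> mF; apply/funext => s; elim: s F G mF => [|z s IH] F G mF.
  by rewrite /= (malt_0 mF [::] [::]) -[(0, 0)]/(0 : W) eps0 addr0.
have mFz y : malt (ctr y F) by apply: malt_ctr.
have tE : tau (ext G) = ext (tau G) by rewrite /tau ext_wt.
have eA : eps_linear (ext F) by apply: ext_eps_linear.
rewrite circ_cons -[LHS]/(ctr z (ext (circ F G)) s) !ctr_ext !ctr_circ tE.
rewrite !extD !(circAr _ _ (malt_ext mF)) circ_epsr // circAl circ_epsl.
by rewrite !appE /= !appE !IH // epsD; zmod.
Qed.

Lemma ext_br F G : malt F -> malt G -> ext (br F G) = br (ext F) (ext G).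
Proof.
move=> mF mG; rewrite /br /ev /od /tau !extD !extN -!ext_wt !ext_circ //;
  exact: malt_wt.
Qed.

Lemma par_ext p F : par p F -> par p (ext F).
Proof. by rewrite /par /tau -ext_wt => ->; rewrite extZ. Qed.

Lemma vanish_ext N F : vanish_from N F -> vanish_from N (ext F).
Proof.
move=> bF s; elim: s N F bF => [|z s IH] N F bF ltB /=; first by rewrite bF.
have H y : ext (ctr y F) s = 0.
  apply: (IH N.-1) => [r le_r|]; last by move: ltB => /=; lia.
  by apply: bF => /=; lia.
by rewrite !H eps0 addr0.
Qed.

Lemma hdeg_ext n F : hdeg n F -> hdeg n (ext F).
Proof.
move=> dF s; elim: s n F dF => [|z s IH] n F dF /=.
  by move=> F0; apply: (dF [::]); apply: contraNneq F0 => ->.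
have H y : ext (ctr y F) s != 0 -> (size s).+1%:Z = n + 1.
  by move=> /(IH (n - 1) _ (hdeg_ctr dF)); lia.
have [->|/H //] := eqVneq (ext (ctr z.1 F) s) 0.
have [->|/H //] := eqVneq (ext (ctr z.2 F) s) 0.
by rewrite eps0 addr0 eqxx.
Qed.

(** * The abelian subalgebra and the projection *)

Definition emb (x : g) : W := (0, x).

Definition hat F : seq W -> W := fun s => (F (map snd s), 0).

(* [pr] and [hat] restrict a function on g[eps] to eps g with values in g, and
   extend such a function by zero. *)
Definition pr A : seq g -> g := fun x => (A (map emb x)).1.

Lemma hatK F : pr (hat F) = F.
Proof. by apply/funext => x; rewrite /pr /hat /= -map_comp map_id. Qed.

Lemma malt_hat F : malt F -> malt (hat F).
Proof.
move=> [mF aF]; split=> [s t a u v|s t r u]; rewrite /hat !map_cat /=.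
  by rewrite mF; congr (_, _); rewrite /= scaler0 addr0.
by rewrite !map_cat /= aF.
Qed.

Lemma malt_pr A : malt A -> malt (pr A).
Proof.
move=> [mA aA]; split=> [s t a u v|s t r u]; rewrite /pr !map_cat /=;
  last first.
  by rewrite map_cat /= aA.
by rewrite (_ : emb _ = a *: emb u + emb v) ?mA //; congr (_, _);
  rewrite /= scaler0 addr0.
Qed.

Lemma hat_wt c F : hat (wt c F) = wt c (hat F).
Proof.
by apply/funext => s; rewrite /hat /wt size_map; congr (_, _);
  rewrite /= scaler0.
Qed.

Lemma hat_lin a F G : hat (a *: F + G) = a *: hat F + hat G.
Proof. by apply/funext => s; rewrite /hat !appE; congr (_, _);
  rewrite /= scaler0 addr0. Qed.

Lemma hat0 : hat 0 = 0.
Proof. by []. Qed.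

Lemma hatZ a F : hat (a *: F) = a *: hat F.
Proof. by have := hat_lin a F 0; rewrite hat0 !addr0. Qed.

Lemma pr_wt c A : pr (wt c A) = wt c (pr A).
Proof. by apply/funext => s; rewrite /pr /wt size_map. Qed.

Lemma pr_lin a A B : pr (a *: A + B) = a *: pr A + pr B.
Proof. by []. Qed.

Lemma prB A B : pr (A - B) = pr A - pr B.
Proof. by []. Qed.

Lemma prZ a A : pr (a *: A) = a *: pr A.
Proof. by []. Qed.

Lemma par_hat p F : par p F -> par p (hat F).
Proof. by rewrite /par /tau -hat_wt => ->; rewrite hatZ. Qed.

Lemma par_pr p A : par p A -> par p (pr A).
Proof. by rewrite /par /tau -pr_wt => ->; rewrite prZ. Qed.

Lemma vanish_hat N F : vanish_from N F -> vanish_from N (hat F).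
Proof. by move=> bF s sB; rewrite /hat bF ?size_map. Qed.

Lemma vanish_pr N A : vanish_from N A -> vanish_from N (pr A).
Proof. by move=> bA s sB; rewrite /pr bA ?size_map. Qed.

Lemma hdeg_hat n F : hdeg n F -> hdeg n (hat F).
Proof.
move=> dF s F0; rewrite -(size_map snd s); apply: dF.
by apply: contraNneq F0; rewrite /hat => ->.
Qed.

Lemma hdeg_pr n A : hdeg n A -> hdeg n (pr A).
Proof.
move=> dA s A0; rewrite -(size_map emb s); apply: dA.
by apply: contraNneq A0; rewrite /pr => ->.
Qed.

Definition kills_base A := forall s y t, y.2 = 0 -> A (s ++ y :: t) = 0.
Definition base_valued A := forall s, (A s).2 = 0.

Lemma hat_kills_base F : malt F -> kills_base (hat F).
Proof.
by move=> mF s y t y0; rewrite /hat map_cat /= y0 (malt_0 mF).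
Qed.

Lemma hat_base_valued F : base_valued (hat F).
Proof. by []. Qed.

(** The values of [B] lie in [g], and [A] vanishes as soon as one argument does. Between functions
    of the form [hat F] all products are therefore zero. *)
Lemma circ_kills A B : kills_base A -> base_valued B -> circ A B = 0.
Proof.
move=> kA vB; apply/funext => s; elim: s A B kA vB => [|z s IH] A B kA vB.
  by apply: (kA [::] _ [::]).
rewrite circ_cons !IH ?addr0 //.
- by move=> r; apply: (kA (z :: r)).
- by move=> r; rewrite /tau /wt /= vB scaler0.
- by move=> r; apply: vB.
Qed.

(** The kernel of [pr] consists of the functions that send inputs in [eps g] to values in [eps g], a
    property that composition preserves. *)
Lemma ker_pr_circ A B : pr A = 0 -> pr B = 0 -> pr (circ A B) = 0.
Proof.
move=> kA kB; apply/funext => x; elim: x A B kA kB => [|z x IH] A B kA kB.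
  have B0 : B [::] = emb (B [::]).2.
    by rewrite [LHS]surjective_pairing; congr (_, _);
      apply: (congr1 (fun f => f [::]) kB).
  by rewrite /pr /= B0; apply: (congr1 (fun f => f [:: _]) kA).
have kC C : pr C = 0 -> pr (ctr (emb z) C) = 0.
  by move=> kC; apply/funext => r; apply: (congr1 (fun f => f (z :: r)) kC).
rewrite /pr [map _ _]/= circ_cons -[LHS]/(pr (circ A (ctr (emb z) B)) x + pr
  (circ (ctr (emb z) A) (tau B)) x).
rewrite !IH ?addr0 //; try exact: kC.
by rewrite pr_wt kB; apply/funext => r; apply: scaler0.
Qed.

Lemma ker_pr_br A B : pr A = 0 -> pr B = 0 -> pr (br A B) = 0.
Proof.
move=> kA kB.
have kw c C : pr C = 0 -> pr (wt c C) = 0.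
  by move=> kC; rewrite pr_wt kC; apply/funext => r; apply: scaler0.
by rewrite /br !prB !ker_pr_circ ?subr0 //; apply: kw.
Qed.

(* [ker pr] is a subalgebra and [hat] has an abelian image, as in Voronov's
   derived bracket construction. *)
Lemma pr_br p q A B : malt A -> malt B -> par p A -> par q B ->
  pr (br A B) = pr (br (hat (pr A)) B) + pr (br A (hat (pr B))).
Proof.
move=> mA mB pA pB.
have mpA := malt_hat (malt_pr mA); have mpB := malt_hat (malt_pr mB).
(* Both [A - hat (pr A)] and [B - hat (pr B)] lie in the kernel. Of the four terms of the expanded
   bracket, the one with two [hat] factors is zero. *)
have : pr (br (A - hat (pr A)) (B - hat (pr B))) = 0.
  by apply: ker_pr_br; rewrite prB hatK subrr.
have -> : br (A - hat (pr A)) (B - hat (pr B)) =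
    br A B - br (hat (pr A)) B - br A (hat (pr B)) + br (hat (pr A)) (hat (pr
      B)).
  have mB' : malt (B - hat (pr B)) by apply: maltD => //; apply: maltN.
  by rewrite brBl // !brBr //; zmod.
have -> : br (hat (pr A)) (hat (pr B)) = 0.
  rewrite (brE mpB (par_hat (par_pr pA)) (par_hat (par_pr pB))).
  by rewrite !circ_kills ?scaler0 ?subr0 //;
    try exact: hat_kills_base (malt_pr _).
by rewrite addr0 !prB => /(canRL (subrK _));
  rewrite add0r => /(canRL (subrK _)) ->; rewrite addrC.
Qed.

End Extension.

Arguments ext {k g} lam F s.
Arguments emb {k g} x.
Arguments hat {k g} F s.
Arguments pr {k g} A x.

(** * Shuffles *)

Section ShuffleRecursion.

(** Sizes are integers on purpose: shortening an empty block gives -1, for which [Sh] is empty, so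
    recursions may run over all blocks. *)
Definition decr (b : seq int) (j : nat) : seq int := set_nth 0 b j (b`_j - 1).
Definition offset (b : seq int) (j : nat) : nat := sumn (take j (map absz b)).

Lemma reshape_index_cons n c i :
  reshape_index (n :: c) i =
  if (i < n)%N then 0%N else (reshape_index c (i - n)).+1.
Proof.
rewrite /reshape_index /= subn_eq0.
by case: ltnP => //= le_ni; rewrite subSn.
Qed.

Lemma reshape_index_eq c i j : (i < sumn c)%N ->
  (reshape_index c i == j) =
  (sumn (take j c) <= i < sumn (take j c) + nth 0%N c j)%N.
Proof.
elim: c i j => [|n c IH] i j //=; rewrite reshape_index_cons.
case: (ltnP i n) => [lt_in _|le_ni lt_i]; case: j => [|j] /=.
- by rewrite add0n lt_in.
- by apply/esym/negbTE; rewrite negb_and -ltnNge ltn_addr.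
- by rewrite ltnNge le_ni.
- by rewrite eqSS IH; lia.
Qed.

(** [bump] skips the first position of block [j]; the remaining positions keep their blocks, block
    [j] being one shorter. *)
Lemma reshape_index_bump c j a : (0 < nth 0%N c j)%N ->
  reshape_index c (bump (sumn (take j c)) a) =
  reshape_index (set_nth 0%N c j (nth 0%N c j).-1) a.
Proof.
elim: c j a => [|n c IH] [|j] a //= c_j;
  rewrite ?nth_nil // !reshape_index_cons.
- rewrite /bump leq0n add1n; case: n c_j => // n _; rewrite ltnS subSS.
- rewrite -IH //; have -> : (bump (n + sumn (take j c)) a < n)%N = (a < n)%N.
    by rewrite /bump; lia.
  case: ltnP => // le_na; congr (reshape_index _ _).+1.
  by rewrite /bump; lia.
Qed.

Lemma all_decr b j : (j < size b)%N ->
  all (fun z => 0 <= z) (decr b j) =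
  all (fun z => 0 <= z) b && (0 < nth 0%N (map absz b) j)%N.
Proof.
rewrite /decr; elim: b j => [|z b IH] [|j] //=.
  by case: (all _ b); rewrite ?andbF ?andbT //=; lia.
by rewrite ltnS => lt_j; rewrite IH // andbA.
Qed.

Lemma map_decr b j : (j < size b)%N -> all (fun z => 0 <= z) b ->
  (0 < nth 0%N (map absz b) j)%N ->
  map absz (decr b j) = set_nth 0%N (map absz b) j (nth 0%N (map absz b) j).-1.
Proof.
rewrite /decr; elim: b j => [|z b IH] [|j] //= lt_j /andP[z0 b0] c_j.
  by congr (_ :: _); lia.
by rewrite IH.
Qed.

Lemma sumn_set_pred c j : (0 < nth 0%N c j)%N ->
  (sumn (set_nth 0%N c j (nth 0%N c j).-1)).+1 = sumn c.
Proof. by elim: c j => [|n c IH] [|j] //= c_j; [lia|rewrite -addnS IH]. Qed.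

Lemma offset_lt c j : (0 < nth 0%N c j)%N -> (sumn (take j c) < sumn c)%N.
Proof. by elim: c j => [|n c IH] [|j] //= c_j; [lia|rewrite ltn_add2l IH]. Qed.

Lemma mem_Sh N b (s : 'S_N) : reflect
  [/\ all (fun z => 0 <= z) b, sumn (map absz b) = N &
    forall i j : 'I_N, (i < j)%N ->
      reshape_index (map absz b) i = reshape_index (map absz b) j ->
        (s i < s j)%N]
  (s \in Sh N b).
Proof.
rewrite inE; apply: (iffP and3P) => -[b0 bN H]; split=> //; try exact/eqP.
  move=> i j ij E; move/forallP: H => /(_ i)/forallP/(_ j)/implyP; apply.
  by rewrite ij E eqxx.
by apply/forallP => i; apply/forallP => j; apply/implyP => /andP[ij /eqP];
  apply: H.
Qed.

(** As a shuffle increases along its blocks, the position [i] of the smallest value must be the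
    first of its block. *)
Lemma Sh_lift_perm N b j (i : 'I_N.+1) (s : 'S_N) :
  reshape_index (map absz b) i = j -> (j < size b)%N ->
  (lift_perm i ord0 s \in Sh N.+1 b) =
  (offset b j == i) && (s \in Sh N (decr b j)).
Proof.
set c := map absz b => ri lt_j.
have key (c_j : (0 < nth 0%N c j)%N) (oi : offset b j = i) (p q : 'I_N) :
    all (fun z => 0 <= z) b ->
    (reshape_index c (lift i p) = reshape_index c (lift i q)) <->
    (reshape_index (map absz (decr b j)) p =
      reshape_index (map absz (decr b j)) q).
  by move=> b0; rewrite map_decr // -!reshape_index_bump // -/(offset b j) oi.
apply/mem_Sh/andP => [[b0 bN H]|[/eqP oi /mem_Sh[]]].
  have lt_i : (i < sumn c)%N by rewrite bN.
  have := reshape_index_eq j lt_i; rewrite ri eqxx => /esym/andP[le_oi lt_io].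
  have c_j : (0 < nth 0%N c j)%N by lia.
  have oi : offset b j = i.
    apply/eqP; rewrite eqn_leq le_oi leqNgt; apply/negP => lt_oi.
    (* If the block began before [i], the value at its start would be smaller than the value [0] at
       [i]. *)
    have lt_o : (offset b j < N.+1)%N by apply: ltn_trans (ltn_ord i).
    have /= := H (Ordinal lt_o) i lt_oi; rewrite lift_perm_id ltn0 => E;
      apply/notF/E.
    by rewrite ri; apply/eqP;
      rewrite reshape_index_eq ?bN //= leqnn -[X in (X < _)%N]addn0 ltn_add2l.
  split; first exact/eqP.
  apply/mem_Sh; split=> [||p q pq E].
  - by rewrite all_decr // b0.
  - by apply/eqP; rewrite -eqSS map_decr // sumn_set_pred // bN.
  have := H (lift i p) (lift i q); rewrite !lift_perm_lift !lift0 ltnS.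
  by apply; [rewrite /= /bump; lia|apply/key].
rewrite all_decr // => /andP[b0 c_j] sN H; split=> // [|p q].
  by rewrite -(sumn_set_pred c_j) -map_decr // sN.
case: (unliftP i p) => [p'|] ->; case: (unliftP i q) => [q'|] ->.
- rewrite !lift_perm_lift !lift0 ltnS => pq /key E; apply: H; last exact: E.
  by move: pq; rewrite /= /bump; lia.
- move=> lt_pi; rewrite ri => E.
  have lt_i : (lift i p' < sumn c)%N.
    by rewrite -(sumn_set_pred c_j) -map_decr // sN.
  have := reshape_index_eq j lt_i; rewrite E eqxx -/(offset b j) oi.
  by move/esym/andP => [le_ip _]; move: lt_pi; rewrite ltnNge le_ip.
- by rewrite lift_perm_id lift_perm_lift lift0.
- by rewrite ltnn.
Qed.

(** A permutation is determined by the position [i] of the value [0] and by the permutation left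
    after its removal. *)
Lemma big_perm_lift (M : nmodType) N (F : 'S_N.+1 -> M) :
  \sum_s F s = \sum_(i < N.+1) \sum_(s : 'S_N) F (lift_perm i ord0 s).
Proof.
rewrite pair_big /= (reindex (fun p => lift_perm p.1 ord0 p.2)) //=.
pose at0 (s : 'S_N.+1) : 'I_N.+1 := (s^-1 : 'S_N.+1)%g ord0.
have at0K (s : 'S_N.+1) : s (at0 s) = ord0 by rewrite permKV.
pose h (s : 'S_N.+1) k := odflt k (unlift ord0 (s (lift (at0 s) k))).
have hK (s : 'S_N.+1) k : lift ord0 (h s k) = s (lift (at0 s) k).
  have := neq_lift (at0 s) k; rewrite /h.
  by rewrite -(inj_eq (@perm_inj _ s)) at0K => /unlift_some[k' -> ->].
have h_inj s : injective (h s).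
  by move=> x y /(congr1 (lift ord0)); rewrite !hK => /perm_inj/lift_inj.
exists (fun s => (at0 s, perm (h_inj s))) => [[i s] _|s _] /=.
  have E : at0 (lift_perm i ord0 s) = i by rewrite /at0 lift_permV lift_perm_id.
  congr (_, _) => //; apply/permP => k; rewrite permE;
    apply: (@lift_inj _ ord0).
  by rewrite hK E lift_perm_lift.
apply/permP => k; case: (unliftP (at0 s) k) => [k'|] ->.
  by rewrite lift_perm_lift permE hK.
by rewrite lift_perm_id at0K.
Qed.

(* [0] is the first entry of some block [j]; removing it leaves a shuffle in
   which the block [j] is shorter by one. *)
Lemma big_Sh_recl (M : nmodType) N b (F : 'S_N.+1 -> M) :
  \sum_(s in Sh N.+1 b) F s =
  \sum_(j < size b) \sum_(s in Sh N (decr b j))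
    F (lift_perm (inord (offset b j)) ord0 s).
Proof.
set c := map absz b.
have [/andP[b0 /eqP bN]|nb] := boolP (all (fun z =>
  0 <= z) b && (sumn c == N.+1)); last first.
  rewrite big1 => [|s /mem_Sh[b0 bN _]]; last by rewrite b0 bN eqxx in nb.
  rewrite big1 // => j _; rewrite big1 // => s /mem_Sh[].
  rewrite all_decr // => /andP[b0 c_j]; rewrite map_decr // => sN.
  by rewrite b0 /= -(sumn_set_pred c_j) sN eqxx in nb.
have lt_ri (i : 'I_N.+1) : (reshape_index c i < size b)%N.
  by rewrite -(size_map absz); apply: reshape_indexP; rewrite bN.
rewrite big_mkcond big_perm_lift.
pose G (j : 'I_(size b)) (i :
  'I_N.+1) := \sum_(s in Sh N (decr b j)) F (lift_perm i ord0 s).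
transitivity (\sum_(i < N.+1) \sum_(j < size b | (j == reshape_index c i :>
  nat) && (offset b j == i)) G j i).
  apply: eq_bigr => i _; rewrite -big_mkcond /=.
  rewrite (eq_bigl _ _ (fun s => Sh_lift_perm s erefl (lt_ri i))).
  have [oi|noi] := eqVneq (offset b (reshape_index c i)) i; last first.
    rewrite big_pred0 // big_pred0 // => j; apply/negbTE; rewrite negb_and.
    by case: eqVneq => [->|//]; rewrite noi.
  by rewrite (big_pred1 (Ordinal (lt_ri i))) // => j; rewrite /= -val_eqE /=;
    case: eqVneq => [->|//]; rewrite oi eqxx.
rewrite (exchange_big_dep predT) //=; apply: eq_bigr => j _.
have [c_j|c_j] := ltnP 0 (nth 0%N c j); last first.
  rewrite [RHS]big_pred0 => [|s]; last first.
    apply/negP => /mem_Sh[]; rewrite all_decr // => /andP[_].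
    by rewrite ltnNge c_j.
  rewrite big1 // => i _; rewrite /G big_pred0 // => s.
  apply/negP => /mem_Sh[]; rewrite all_decr // => /andP[_].
  by rewrite ltnNge c_j.
have lt_o : (offset b j < sumn c)%N by apply: offset_lt.
rewrite (big_pred1 (inord (offset b j))) // => i.
rewrite /= -val_eqE /= inordK -?bN // [RHS]eq_sym.
case: (eqVneq (offset b j) i) => [<-|_];
  rewrite ?andbF // andbT eq_sym reshape_index_eq //.
by rewrite leqnn -[X in (X < _)%N]addn0 ltn_add2l.
Qed.

Lemma big_Sh0 (M : nmodType) b (F : 'S_0 -> M) :
  \sum_(s in Sh 0 b) F s = if all (fun z => z == 0) b then F 1%g else 0.
Proof.
have E : all (fun z => z == 0) b = all (fun z =>
  0 <= z) b && (sumn (map absz b) == 0%N).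
  elim: b => //= z b ->; case: (all _ b); rewrite ?andbF ?andbT //=; lia.
rewrite E; case: ifPn => [/andP[b0 bN]|nb].
  rewrite (big_pred1 1%g) // => s; rewrite /= (permS0 s) eqxx.
  by apply/mem_Sh; split=> //; try exact/eqP; case.
rewrite big_pred0 // => s; apply/negP => /mem_Sh[b0 bN _].
by rewrite b0 bN in nb.
Qed.

End ShuffleRecursion.

(** * Shuffle sums and insertion *)

Section ShuffleSums.

Lemma map_enum_lift (T : Type) N (f : 'I_N.+1 -> T) (i : 'I_N.+1) :
  [seq f j | j <- enum 'I_N.+1] =
  take i [seq f (lift i j) | j <- enum 'I_N] ++
  f i :: drop i [seq f (lift i j) | j <- enum 'I_N].
Proof.
have s1 M (h : 'I_M -> T) : size [seq h j | j <- enum 'I_M] = M.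
  by rewrite size_map size_enum_ord.
have s2 : size (take i [seq f (lift i j) | j <- enum 'I_N]) = i.
  by rewrite size_take s1; case: ltngtP (leq_ord i).
have n1 M (h : 'I_M -> T) (j : 'I_M) x0 : nth x0 [seq h j | j <- enum 'I_M] j =
  h j.
  by rewrite (nth_map j) ?size_enum_ord // nth_ord_enum.
apply: (@eq_from_nth _ (f i)) => [|j].
  by rewrite s1 size_cat /= s2 size_drop s1 addnS subnKC ?leq_ord.
rewrite s1 => lt_j; rewrite (n1 _ f (Ordinal lt_j)) nth_cat s2.
case: (unliftP i (Ordinal lt_j)) => [j'|] E; have /= Ej := congr1 val E;
  rewrite {}E {lt_j}Ej.
  case: (leqP i j') => [le_ij|lt_ji]; rewrite /bump.
    by rewrite le_ij add1n ltnNge leqW //= subSn //= nth_drop subnKC ?n1.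
  by rewrite (leqNgt i j') lt_ji /= ?add0n lt_ji nth_take ?n1.
by rewrite ltnn subnn.
Qed.

Definition ins (T : Type) (o : nat) (z : T) (w :
  seq T) := take o w ++ z :: drop o w.

Lemma size_ins T o (z : T) w : size (ins o z w) = (size w).+1.
Proof. by rewrite size_cat /= addnS -size_cat cat_take_drop. Qed.

Lemma take_ins T o N (z : T) w : (o <= N)%N -> (o <= size w)%N ->
  take N.+1 (ins o z w) = ins o z (take N w).
Proof.
rewrite /ins; elim: o N w => [|o IH] [|N] [|a w] //= le_oN le_ow;
  rewrite ?take0 ?drop0 //.
by rewrite IH.
Qed.

Lemma drop_ins T o N (z : T) w : (o <= N)%N -> (o <= size w)%N ->
  drop N.+1 (ins o z w) = drop N w.
Proof.
rewrite /ins; elim: o N w => [|o IH] [|N] [|a w] //= le_oN le_ow;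
  rewrite ?take0 ?drop0 //.
by rewrite IH.
Qed.

Variables (k : fieldType) (g : lmodType k).
Implicit Types (F G H : seq g -> g) (x w : seq g).

Lemma size_permute x (s : 'S_(size x)) : size (permute s) = size x.
Proof. by rewrite size_map size_enum_ord. Qed.

Lemma permute_lift z x i (s : 'S_(size x)) :
  @permute g (z :: x) (lift_perm i ord0 s) = ins i z (permute s).
Proof.
rewrite /permute [LHS](map_enum_lift _ i) lift_perm_id /ins.
by congr (take _ _ ++ _ :: drop _ _); apply: eq_map => j;
  rewrite lift_perm_lift lift0.
Qed.

Lemma eq_shuffle_sum b F G x :
  (forall w, all (fun z => 0 <= z) b -> sumn (map absz b) = size x ->
     size w = size x -> F w = G w) ->
  shuffle_sum b F x = shuffle_sum b G x.
Proof.
move=> E; apply: eq_bigr => s /mem_Sh[b0 bN _].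
by rewrite E ?size_permute.
Qed.

Lemma shuffle_sum0 b F x : ~~ all (fun z => 0 <= z) b -> shuffle_sum b F x = 0.
Proof. by move=> /negP nb; rewrite /shuffle_sum big_pred0 // => s;
  apply/negP => /mem_Sh[]. Qed.

Lemma shuffle_sum_size b F x : sumn (map absz b) != size x ->
  shuffle_sum b F x = 0.
Proof.
move=> /eqP nb; rewrite /shuffle_sum big_pred0 // => s.
by apply/negP => /mem_Sh[].
Qed.

Lemma shuffle_sumZ b a F x : shuffle_sum b (fun w => a *: F w) x =
  a *: shuffle_sum b F x.
Proof.
by rewrite /shuffle_sum scaler_sumr; apply: eq_bigr => s _;
  rewrite !scalerA mulrC.
Qed.

Lemma shuffle_sum_nil b F :
  shuffle_sum b F [::] = if all (fun z => z == 0) b then F [::] else 0.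
Proof.
rewrite /shuffle_sum big_Sh0; case: ifP => // _.
rewrite odd_perm1 expr0 scale1r; congr F.
by apply: size0nil; rewrite size_permute.
Qed.

(** The sign counts the entries that precede [0] in the word of the shuffle, all of them larger. *)
Lemma shuffle_sum_cons b F z x :
  shuffle_sum b F (z :: x) = \sum_(j < size b) (-1) ^+ offset b j *:
    shuffle_sum (decr b j) (fun w => F (ins (offset b j) z w)) x.
Proof.
rewrite /shuffle_sum [LHS]big_Sh_recl; apply: eq_bigr => j _.
rewrite scaler_sumr; apply: eq_bigr => s Hs.
have lt_o : (offset b j < (size x).+1)%N.
  case/mem_Sh: Hs => + sN _; have {}sN : _ = size x := sN;
    rewrite all_decr // => /andP[b0 b_j].
  by rewrite -sN map_decr // sumn_set_pred // offset_lt.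
rewrite permute_lift odd_lift_perm !inordK // addbF signr_addb signr_odd.
by rewrite scalerA.
Qed.

(** A single block admits only the identity; on lists of any other length [F] vanishes too. *)
Lemma shuffle_sum1 q F x : hdeg q F -> shuffle_sum [:: q + 1] F x = F x.
Proof.
elim: x q F => [|z x IH] q F dF.
  rewrite shuffle_sum_nil /= andbT; case: eqVneq => // q1.
  by apply/esym/eqP; apply: contraNT q1 => /dF /= <-.
rewrite shuffle_sum_cons big_ord1 /offset /= expr0 scale1r.
rewrite /decr /= [q + 1 - 1]addrAC -[RHS]/(ctr z F x) -(IH _ _ (hdeg_ctr dF)).
by apply: eq_shuffle_sum => w; rewrite /ins take0 drop0.
Qed.

Lemma tau_shuffle_sum b F :
  tau (shuffle_sum b F) = (-1) ^+ (sumn (map absz b)).+1 *: shuffle_sum b F.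
Proof.
apply/funext => x; rewrite appZ /tau /wt.
by have [->//|/shuffle_sum_size ->] := eqVneq (sumn (map absz b)) (size x);
  rewrite !scaler0.
Qed.

Lemma circ_sumr I r (P : pred I) F (G : I -> seq g -> g) : malt F ->
  circ F (\sum_(i <- r | P i) G i) = \sum_(i <- r | P i) circ F (G i).
Proof.
by move=> mF; apply: (big_morph (circ F)) => [A B|]; rewrite ?circAr ?circ0r.
Qed.

Lemma decr_rcons_lt b m j : (j < size b)%N -> decr (rcons b m) j =
  rcons (decr b j) m.
Proof.
move=> lt_j; rewrite /decr nth_rcons lt_j.
by elim: b j lt_j => [|a b IH] [|j] //= lt_j; rewrite IH.
Qed.

Lemma decr_rcons_eq b m : decr (rcons b m) (size b) = rcons b (m - 1).
Proof. by rewrite /decr nth_rcons ltnn eqxx; elim: b => //= a b ->. Qed.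

Lemma offset_rcons_lt b m j : (j <= size b)%N -> offset (rcons b m) j =
  offset b j.
Proof. by move=> le_j;
  rewrite /offset map_rcons -cats1 takel_cat // size_map. Qed.

Lemma appsum (T : Type) (V : lmodType k) I r (P : pred I) (G : I -> T -> V) t :
  (\sum_(i <- r | P i) G i) t = \sum_(i <- r | P i) G i t.
Proof. by rewrite (big_morph (fun f : T -> V =>
  f t) (id1 := 0) (op1 := +%R)). Qed.

(** Bridge from permutations to the recursion of [circ]: a first input in the last block goes to [H]
    after passing [F], any other goes into a block of [b], hence to [F]. *)
Lemma shuffle_sum_insert b m H F x : malt H -> hdeg m H ->
  shuffle_sum (rcons b m) (insert H F m) x = circ H (shuffle_sum b F) x.
Proof.
elim: x b m H F => [|z x IH] b m H F mH dH.
  rewrite shuffle_sum_nil all_rcons /= shuffle_sum_nil andbC.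
  case: (all _ b) => /=; last by rewrite (malt_0 mH [::] [::]).
  case: eqVneq => [_ //|m0]; apply/esym/eqP.
  by apply: contraNT m0 => /dH /= E; apply/eqP; lia.
rewrite shuffle_sum_cons size_rcons big_ord_recr circ_cons; congr (_ + _);
  last first.
  rewrite decr_rcons_eq offset_rcons_lt // tau_shuffle_sum circZr;
    last exact: malt_ctr.
  rewrite /offset take_oversize ?size_map // appZ exprS mulN1r scaleNr -scalerN.
  congr (_ *: _); rewrite -(IH _ _ _ _ (malt_ctr z mH) (hdeg_ctr dH)) -scaleN1r
    -shuffle_sumZ.
  apply: eq_shuffle_sum => w;
    rewrite all_rcons map_rcons sumn_rcons => /andP[m0 b0] sb sw.
  rewrite /insert size_ins sw -sb.
  have -> : ((sumn (map absz b) + `|m - 1|).+1 - `|m| =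
    sumn (map absz b))%N by lia.
  rewrite addnK /ins take_size_cat ?size_takel ?drop_size_cat ?size_takel //;
    try by lia.
  (* Here [z] directly follows the value of [F]; exchanging them gives the -1 that completes the
     shuffle sign to that of [tau]. *)
  by rewrite (malt_swap mH [::]) scaleN1r.
have mE : ctr z (shuffle_sum b F) = \sum_(j < size b) (-1) ^+ offset b j *:
    shuffle_sum (decr b j) (fun w => F (ins (offset b j) z w)).
  by apply/funext => w; rewrite /= shuffle_sum_cons appsum.
rewrite mE circ_sumr // appsum; apply: eq_bigr => j _.
rewrite circZr // appZ /= decr_rcons_lt // offset_rcons_lt; last exact: ltnW.
congr (_ *: _); rewrite -(IH _ m) //; apply: eq_shuffle_sum => w.
rewrite all_rcons map_rcons sumn_rcons all_decr // =>
  /andP[m0 /andP[b0 b_j]] sb sw.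
have lt_o := offset_lt b_j;
  rewrite -/(offset b j) -(sumn_set_pred b_j) -map_decr // in lt_o.
rewrite /insert size_ins sw -sb addnK -addSn addnK.
by rewrite take_ins ?drop_ins ?sw -?sb ?leq_addr //; lia.
Qed.

End ShuffleSums.

(** * Explicit form of the iterated brackets *)

Section Parity.

Definition ipar (z : int) : bool := odd `|z|.
Definition lpar (m : seq int) : bool := odd (sumn (map absz m)).

Lemma iparD a b : ipar (a + b) = ipar a (+) ipar b.
Proof. by rewrite /ipar; lia. Qed.

Lemma iparM a b : ipar (a * b) = ipar a && ipar b.
Proof. by rewrite /ipar abszM oddM. Qed.

Lemma signz (k : fieldType) z : (-1 : k) ^ z = (-1) ^+ ipar z.
Proof.
rewrite /ipar signr_odd; case: z => n //=.
by rewrite NegzE -exprz_inv invrN1.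
Qed.

Lemma lpar_cons a m : lpar (a :: m) = ipar a (+) lpar m.
Proof. by rewrite /lpar /= oddD. Qed.

Lemma lpar_sum m : ipar (\sum_(a <- m) a) = lpar m.
Proof. by elim: m => [|a m IH];
  rewrite ?big_nil // big_cons lpar_cons iparD IH. Qed.

(** Parity of the exponent of the Koszul sign in [compose]: the head [a] contributes [a + 1] times
    the sum of the later degrees. *)
Fixpoint kpar (m : seq int) : bool :=
  if m is a :: m' then (~~ ipar a && lpar m') (+) kpar m' else false.

Lemma kparE (m : seq int) :
  ipar (\sum_(b < size m) \sum_(a < b) m`_b * (m`_a + 1)) = kpar m.
Proof.
elim: m => [|a m IH] /=; first by rewrite big_ord0.
rewrite big_ord_recl big_ord0 add0r.
under eq_bigr do rewrite big_ord_recl /=.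
rewrite big_split /= iparD IH -mulr_suml iparM.
rewrite -(big_mkord xpredT (fun i =>
  m`_i)) -(big_nth 0 xpredT id) lpar_sum iparD andbC.
by rewrite (_ : ipar 1 = true) // addbT.
Qed.

End Parity.

Section IteratedCircle.
Variables (k : fieldType) (W : lmodType k).
Implicit Types (A : seq W -> W) (Bs : seq (seq W -> W)).

Fixpoint hlist (V : lmodType k) (m : seq int) (X : seq (seq V -> V)) : Prop :=
  match m, X with
  | [::], [::] => True
  | a :: m', F :: X' => [/\ malt F, hdeg a F & hlist m' X']
  | _, _ => False
  end.

Lemma hlist_size (V : lmodType k) m (X : seq (seq V -> V)) : hlist m X ->
  size m = size X.
Proof. by elim: m X => [|a m IH] [|F X] //= [_ _ /IH ->]. Qed.

Lemma hlist_nth (V : lmodType k) m (X : seq (seq V -> V)) j : hlist m X ->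
  (j < size X)%N ->
  malt (nth 0 X j) /\ hdeg m`_j (nth 0 X j).
Proof. by elim: m X j => [|a m IH] [|F X] [|j] //= [mF dF hX] lt_j //;
  apply: IH. Qed.

Definition upd (V : lmodType k) (z : V) j (X : seq (seq V ->
  V)) := set_nth 0 X j (ctr z (nth 0 X j)).

Lemma size_upd (V : lmodType k) (z : V) j (X : seq (seq V -> V)) :
  (j < size X)%N -> size (upd z j X) = size X.
Proof. by move=> lt_j; rewrite size_set_nth; apply/maxn_idPr. Qed.

Lemma hlist_upd (V : lmodType k) (z : V) j m (X : seq (seq V -> V)) :
  hlist m X ->
  (j < size X)%N -> hlist (decr m j) (upd z j X).
Proof.
rewrite /upd /decr; elim: m X j => [|a m IH] [|F X] [|j] //= [mF dF hX] lt_j;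
  split=> //.
- exact: malt_ctr.
- exact: hdeg_ctr.
- exact: IH.
Qed.

Lemma foldl_circD a A A' Bs :
  foldl circ (a *: A + A') Bs = a *: foldl circ A Bs + foldl circ A' Bs.
Proof. by elim: Bs A A' => //= B Bs IH A A'; rewrite circDl IH. Qed.

(** Contraction is a derivation acting from the right: it reaches an operand after passing those
    behind it, and [A] after passing all of them. *)
Lemma ctr_foldl_circ z m A Bs : malt A -> hlist m Bs ->
  ctr z (foldl circ A Bs) =
  \sum_(j < size Bs) (-1) ^+ lpar (drop j.+1 m) *: foldl circ A (upd z j Bs)
    + (-1) ^+ lpar m *: foldl circ (ctr z A) Bs.
Proof.
elim: Bs A m => [|B Bs IH] A [|a m] // mA.
  by rewrite big_ord0 add0r expr0 scale1r.
case=> mB dB hBs; rewrite [foldl _ _ _]/= (IH _ m) //; last exact: malt_circ.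
have -> : ctr z (circ A B) =
  (-1) ^+ ipar a *: circ (ctr z A) B + circ A (ctr z B).
  rewrite ctr_circ addrC (hdeg_par dB) circZr //; exact: malt_ctr.
rewrite big_ord_recl foldl_circD scalerDr scalerA -signr_addb lpar_cons addbC.
by rewrite /= drop0 /upd; zmod.
Qed.

(** An input annihilating [B] can only pass it. The sign of passing the constant [B [::]], of odd
    degree -1, cancels against the transposition that restores the order of the arguments. *)
Lemma circ_base A B ys : malt A -> (forall s y t,
  y \in ys -> B (s ++ y :: t) = 0) ->
  circ A B ys = A (B [::] :: ys).
Proof.
elim: ys A B => [|y ys IH] A B mA kB //; rewrite circ_cons.
have -> : ctr y B = 0 by apply/funext => r; apply: (kB [::]); apply: mem_head.
rewrite circ0r // add0r (IH (ctr y A)).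
- rewrite /tau /wt /= expr1 (malt_Z mA [:: y]) scaleN1r.
  by rewrite (malt_swap mA [::]) opprK.
- exact: malt_ctr.
- by move=> s u t uys; rewrite /tau /wt kB ?scaler0 // inE uys orbT.
Qed.

End IteratedCircle.

Section ComposeFormula.
Variables (k : fieldType) (g : lmodType k) (lam : k).
Let W : lmodType k := (g * g)%type.
Implicit Types (m : seq int) (F G : seq g -> g) (X : seq (seq g -> g)) (A :
  seq W -> W).

(** [compose] with bare functions as operands, so that contracted operands are allowed. *)
Definition compose_raw F (m : seq int) X : seq g -> g := fun x =>
  let c := [seq absz (z + 1) | z <- m] in
  (-1) ^+ kpar m *:
  F ([seq e.1 e.2 | e <- zip X (reshape c x)] ++ drop (sumn c) x).

Lemma composeE F m (eta : seq (alt g)) :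
  compose F m eta = compose_raw F m (map (@alt_fun k g) eta).
Proof.
apply/funext => x; rewrite /compose /compose_raw signz kparE.
by congr (_ *: F (_ ++ _)); elim: eta (reshape _ _) => [|e eta IH] [|y r] //=;
  rewrite IH.
Qed.

Lemma ext_base F (s : seq W) : malt F -> (forall z, z \in s -> z.2 = 0) ->
  ext lam F s = (F (map fst s), 0).
Proof.
elim: s F => [|z s IH] F mF z0 //=.
rewrite !IH; try by [apply: malt_ctr | move=> y ys; apply: z0;
  rewrite inE ys orbT].
rewrite z0 ?mem_head // /eps /= (malt_0 mF [::]) scaler0 addr0.
by congr (_, _); rewrite /= addr0.
Qed.

Lemma foldl_circ_hat_nil A m X : malt A -> hlist m X ->
  foldl circ A (map hat X) [::] = A [seq (F [::], 0) | F <- X].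
Proof.
elim: X m A => [|F X IH] [|a m] A mA //= [mF _ hX].
rewrite (IH m) //; last by apply: malt_circ => //; apply: malt_hat.
rewrite circ_base // => s y t /mapP[G _ ->]; exact: hat_kills_base.
Qed.

Local Notation suc m := [seq z + 1 | z <- m].

Lemma lpar_decr m j : (j < size m)%N -> lpar (decr m j) = ~~ lpar m.
Proof.
rewrite /decr; elim: m j => [|a m IH] [|j] //= lt_j; rewrite !lpar_cons.
  by rewrite iparD (_ : ipar (-1) = true) //; case: (ipar _); case: (lpar _).
by rewrite IH // addbN.
Qed.

(** Compares two ways of giving an input to block [j]: on the left the signs of the shuffle and of
    the Koszul rule, on the right the sign of passing the later operands and the Koszul sign after
    contraction. *)
Lemma kpar_decr m j : (j < size m)%N ->
  odd (offset (suc m) j) (+) kpar m = lpar (drop j.+1 m) (+) kpar (decr m j).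
Proof.
rewrite /decr; elim: m j => [|a m IH] [|j] //= lt_j; rewrite ?drop0.
  by rewrite iparD (_ : ipar (-1) = true) // addbT negbK; case: (ipar _);
    case: (lpar _); case: (kpar _).
have := IH j lt_j; rewrite -/(decr m j) lpar_decr // /offset /= oddD.
rewrite -[odd (absz (a + 1))]/(ipar (a + 1)) iparD (_ : ipar 1 = true) //.
case: (ipar a) (lpar m) (lpar (drop _ _)) (kpar m) (kpar (decr _ _)) =>
  [] [] [] [] [];
  by case: odd.
Qed.

Definition block_args m X (x : seq g) : seq g :=
  let c := [seq absz (z + 1) | z <- m] in
  [seq e.1 e.2 | e <- zip X (reshape c x)] ++ drop (sumn c) x.

Arguments block_args : simpl never.

Lemma block_args_cons a m F X x :
  block_args (a :: m) (F :: X) x =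
  F (take `|a + 1| x) :: block_args m X (drop `|a + 1| x).
Proof. by rewrite /block_args /= drop_drop addnC. Qed.

Lemma block_args_ins m X z w j : size X = size m -> (j < size m)%N ->
  all (fun z => 0 <= z) (suc m) -> (0 < nth 0%N (map absz (suc m)) j)%N ->
  (offset (suc m) j <= size w)%N ->
  block_args m X (ins (offset (suc m) j) z w) =
    block_args (decr m j) (upd z j X) w.
Proof.
rewrite /offset /decr /upd /ins.
elim: m X j w => [|a m IH] [|F X] [|j] w //= [sX] lt_j /andP[a0 m0] c_j le_o.
  rewrite take0 drop0 cat0s !block_args_cons subrK.
  by have -> : absz (a + 1) = (absz a).+1 by lia.
have le_a : (absz (a + 1)%R <= size w)%N by apply: leq_trans le_o;
  apply: leq_addr.
rewrite !block_args_cons takeD addnC -drop_drop -catA.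
rewrite take_size_cat ?drop_size_cat ?size_takel // IH // size_drop leq_subRL
  //.
Qed.

Lemma block_args_ins_last m X z w : size X = size m ->
  (sumn (map absz (suc m)) <= size w)%N ->
  block_args m X (ins (sumn (map absz (suc m))) z w) =
  ins (size m) z (block_args m X w).
Proof.
rewrite /ins; elim: m X w => [|a m IH] [|F X] w // sX.
  by rewrite /block_args /= !take0 !drop0.
case: sX => sX; rewrite [sumn _]/= => le_o.
have le_a : (absz (a + 1)%R <= size w)%N by apply: leq_trans le_o;
  apply: leq_addr.
have dE : forall c o, drop (c + o) w = drop o (drop c w) by move=> c o;
  rewrite drop_drop addnC.
have sa : size (take (absz (a + 1)%R) w) = absz (a + 1)%R by rewrite size_takel.
rewrite !block_args_cons takeD dE -catA (take_size_cat _ sa) (drop_size_cat _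
  sa).
by rewrite [size _]/= IH // size_drop leq_subRL.
Qed.

Lemma malt_ins F z w o : malt F -> (o <= size w)%N ->
  F (ins o z w) = (-1) ^+ o *: F (z :: w).
Proof.
rewrite /ins; elim: o F w => [|o IH] F [|y w] mF //= le_o;
  rewrite ?take0 ?drop0 ?scale1r //.
rewrite -[LHS]/(ctr y F (take o w ++ z :: drop o w)) IH //;
  last exact: malt_ctr.
by rewrite /= (malt_swap mF [::]) scalerN exprS mulN1r scaleNr.
Qed.

Lemma size_block_args m X w : size X = size m ->
  (size m <= size (block_args m X w))%N.
Proof. by move=> sX;
  rewrite size_cat size_map size1_zip ?sX ?leq_addr // size_reshape size_map.
    Qed.

Definition epow (n : nat) (z : W) : W := iter n (eps lam) z.

Lemma epowD n u v : epow n (u + v) = epow n u + epow n v.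
Proof. by elim: n => //= n ->; rewrite epsD. Qed.

Lemma epowZ n a u : epow n (a *: u) = a *: epow n u.
Proof. by elim: n => //= n ->; rewrite epsZ. Qed.

Lemma epow0 n : epow n 0 = 0.
Proof. by elim: n => //= n ->; rewrite eps0. Qed.

Lemma ctr_emb_ext F z : malt F -> ctr (emb z) (ext lam F) =
  eps lam \o ext lam (ctr z F).
Proof.
move=> mF; apply/funext => s; rewrite /= (_ : ctr 0 F = 0) ?ext0 ?add0r //.
by apply/funext => r; apply: (malt_0 mF [::]).
Qed.

Lemma foldl_circ_epsl A Bs : foldl circ (eps lam \o A) Bs =
  eps lam \o foldl circ A Bs.
Proof. by elim: Bs A => //= B Bs IH A; rewrite circ_epsl IH. Qed.

Lemma hlist_hat m X : hlist m X -> hlist m (map hat X : seq (seq W -> W)).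
Proof.
elim: m X => [|a m IH] [|F X] //= [mF dF hX]; split; last exact: IH.
  exact: malt_hat.
exact: hdeg_hat.
Qed.

Lemma hat_upd z j X : (j < size X)%N ->
  upd (emb z) j (map hat X : seq (seq W -> W)) = map hat (upd z j X).
Proof. by rewrite /upd; elim: X j => [|F X IH] [|j] //= lt_j; rewrite IH. Qed.

Lemma block_args_nil m X : size X = size m -> block_args m X [::] =
  [seq G [::] | G <- X].
Proof.
elim: m X => [|a m IH] [|G X] // [sX].
by rewrite block_args_cons IH.
Qed.

Lemma kpar_units m : all (fun z => z == 0) (suc m) -> kpar m = false.
Proof.
elim: m => //= a m IH /andP[/eqP a1 /IH ->]; rewrite addbF.
by have -> : a = -1 by lia.
Qed.

Lemma malt_units F m X : malt F -> hlist m X -> ~~ all (fun z =>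
  z == 0) (suc m) ->
  F [seq G [::] | G <- X] = 0.
Proof.
elim: X F m => [|G X IH] F [|a m] //= mF [mG dG hX]; rewrite negb_and.
have [a0 /= nz|a0 _] := eqVneq (a + 1) 0.
  by apply: (IH (ctr (G [::]) F) m) => //; apply: malt_ctr.
have -> : G [::] = 0; last exact: (malt_0 mF [::]).
by apply/eqP; apply: contraNT a0 => /dG /= <-.
Qed.

Lemma decr_suc m j : (j < size m)%N -> decr (suc m) j = suc (decr m j).
Proof.
rewrite /decr; elim: m j => [|a m IH] [|j] //= lt_j; last by rewrite IH.
by rewrite addrAC.
Qed.

Lemma odd_sumn_suc m : odd (sumn (map absz (suc m))) = odd (size m) (+) lpar m.
Proof.
elim: m => //= a m IH;
  rewrite oddD IH lpar_cons -[odd (absz (a + 1))]/(ipar (a + 1)).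
by rewrite iparD (_ : ipar 1 = true) //; case: (ipar a); case: (odd _);
  case: (lpar m).
Qed.

Lemma compose_raw_ins F m X z w j : size X = size m -> (j < size m)%N ->
  all (fun z => 0 <= z) (suc m) -> (0 < nth 0%N (map absz (suc m)) j)%N ->
  (offset (suc m) j <= size w)%N ->
  (-1) ^+ offset (suc m) j *: compose_raw F m X (ins (offset (suc m) j) z w) =
  (-1) ^+ lpar (drop j.+1 m) *: compose_raw F (decr m j) (upd z j X) w.
Proof.
move=> sX lt_j m0 c_j le_o;
  rewrite /compose_raw !scalerA -signr_odd -!signr_addb.
by rewrite kpar_decr // -!/(block_args _ _ _) block_args_ins.
Qed.

Lemma compose_raw_ins_last F m X z w : malt F -> size X = size m ->
  (sumn (map absz (suc m)) <= size w)%N ->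
  (-1) ^+ sumn (map absz (suc m)) *: compose_raw F m X (ins (sumn (map absz
    (suc m))) z w) =
  (-1) ^+ lpar m *: compose_raw (ctr z F) m X w.
Proof.
move=> mF sX le_o; rewrite /compose_raw -!/(block_args _ _ _)
  block_args_ins_last //.
rewrite malt_ins ?size_block_args // !scalerA -signr_odd -[_ ^+ size
  m]signr_odd -!signr_addb.
by rewrite odd_sumn_suc; case: (odd _); case: (lpar m); case: (kpar m).
Qed.

Lemma epow_sum n I r (P : pred I) (G : I -> g) :
  epow n (\sum_(i <- r | P i) G i, 0) = \sum_(i <- r | P i) epow n (G i, 0).
Proof.
rewrite (big_morph (fun v => epow n (v, 0)) (id1 := 0) (op1 := +%R)) //;
  last exact: epow0.
by move=> u v; rewrite -epowD; congr (epow n (_, _)); rewrite /= addr0.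
Qed.

(** The values of the [hat] operands lie in [g] and cost nothing, while each of the remaining
    [n + 1 - size X] inputs of [F] comes from [eps g] and contributes one [eps]. In the induction
    [ctr_foldl_circ] and [shuffle_sum_cons] agree block by block. *)
Lemma foldl_circ_compose n F m X x : malt F -> hdeg n F -> hlist m X ->
  foldl circ (ext lam F) (map hat X) (map emb x) =
  epow (absz (n + 1 - (size X)%:Z)%R)
    (shuffle_sum (rcons (suc m) (n + 1 - (size X)%:Z)) (compose_raw F m X) x,
      0).
Proof.
elim: x n F m X => [|z x IH] n F m X mF dF hX.
  rewrite (foldl_circ_hat_nil (malt_ext lam mF) hX) ext_base //; last first.
    by move=> y /mapP[G _ ->].
  rewrite -map_comp shuffle_sum_nil all_rcons.
  have sX := hlist_size hX.
  have [q0|q0] := eqVneq (n + 1 - (size X)%:Z) 0; last first.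
    rewrite [RHS]epow0; congr (_, _); apply/eqP; apply: contraNT q0 => /dF.
    by rewrite size_map => ->; rewrite subrr.
  rewrite q0 /=; case: ifPn => [m1|nm1].
    by rewrite /compose_raw -/(block_args _ _ _) kpar_units // block_args_nil
      // scale1r.
  by rewrite (malt_units mF hX).
have mE := malt_ext lam mF; have sX := hlist_size hX.
rewrite [map emb _]/= -[LHS]/(ctr (emb z) (foldl circ (ext lam F) (map hat X))
  (map emb x)).
rewrite (ctr_foldl_circ _ mE (hlist_hat hX)) ctr_emb_ext // foldl_circ_epsl.
rewrite shuffle_sum_cons size_rcons !size_map sX big_ord_recr /=.
set q := n + 1 - _.
have pairD (u v : g) : (u + v, 0) = (u, 0) + (v, 0) :> W by congr (_, _);
  rewrite /= addr0.
have pairZ a (u : g) : (a *: u, 0) = a *: ((u, 0) : W) by congr (_, _);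
  rewrite /= scaler0.
rewrite pairD epowD epow_sum appD appsum; congr (_ + _).
  apply: eq_bigr => j _; have lt_jm : (j < size m)%N by rewrite sX.
  rewrite appZ hat_upd // (IH n F _ _ mF dF (hlist_upd z hX (ltn_ord j)))
    size_upd // -/q.
  rewrite decr_rcons_lt ?size_map // offset_rcons_lt ?size_map 1?ltnW //
    decr_suc //.
  rewrite -epowZ -pairZ -!shuffle_sumZ; congr (epow _ (_, _));
    apply: eq_shuffle_sum => w.
  rewrite all_rcons map_rcons sumn_rcons -decr_suc // all_decr ?size_map //.
  move=> /andP[_ /andP[m0 m_j]]; rewrite map_decr ?size_map // => sm sw.
  have := offset_lt m_j;
    rewrite -/(offset _ _) -(sumn_set_pred m_j) ltnS => le_o.
  by rewrite compose_raw_ins // sw -sm; apply: leq_trans le_o _;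
    apply: leq_addr.
rewrite appZ /= (IH (n - 1) _ m) //; [|exact: malt_ctr|exact: hdeg_ctr].
have -> : n - 1 + 1 - (size X)%:Z = q - 1 by rewrite /q; lia.
have -> : size X = size (suc m) by rewrite size_map sX.
rewrite decr_rcons_eq offset_rcons_lt // /offset take_oversize ?size_map //.
(* For [q <= 0] the shortened last block is negative, so both shuffle sums are empty; otherwise one
   factor [eps] splits off. *)
have [q0|q_gt0] := boolP (q <= 0).
  by rewrite !shuffle_sum0 ?all_rcons ?epow0 ?eps0 ?scaler0 ?epow0 //; lia.
have -> : absz q = (absz (q - 1)%R).+1 by lia.
rewrite -epsZ -epowZ -pairZ -!shuffle_sumZ [RHS]/=; congr (eps _ (epow _ (_,
  _))).
apply: eq_shuffle_sum => w;
  rewrite all_rcons map_rcons sumn_rcons => /andP[_ m0] sm sw.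
by rewrite compose_raw_ins_last // sw -sm leq_addr.
Qed.

End ComposeFormula.

Section IteratedBracket.
Variables (k : fieldType) (g : lmodType k) (lam : k).
Let W : lmodType k := (g * g)%type.
Implicit Types (m : seq int) (F G : seq g -> g) (X : seq (seq g -> g)).
Implicit Types (A B C : seq W -> W) (Bs : seq (seq W -> W)).

Lemma base_valued_circ A B : base_valued A -> base_valued (circ A B).
Proof.
move=> vA s; elim: s A B vA => [|z s IH] A B vA; first exact: vA.
rewrite circ_cons /= !IH ?addr0 // => r; exact: vA.
Qed.

Lemma foldl_brD m a A A' Bs : hlist m Bs ->
  foldl br (a *: A + A') Bs = a *: foldl br A Bs + foldl br A' Bs.
Proof.
elim: Bs m A A' => [|B Bs IH] [|b m] A A' //= [mB _ hBs].
by rewrite brDl // (IH m).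
Qed.

(** Once [C] is outermost it stays so: [circ C A] has values in [g], which later operands kill, and
    in the pre-Lie identity the terms with an operand directly inside [C] vanish, so the operand
    acts on [A]. *)
Lemma foldl_br_circ_hat m p q C A X : malt C -> par p C -> kills_base C ->
  base_valued C ->
  malt A -> par q A -> hlist m X ->
  foldl br (circ C A) (map hat X) = circ C (foldl circ A (map hat X)).
Proof.
move=> mC pC kC vC; elim: X m q A => [|F X IH] [|a m] q A mA pA //= [mF dF hX].
have mH := malt_hat mF; have pH := par_hat (hdeg_par dF).
have vH : base_valued (hat F) by [].
rewrite (brE mH (par_circ mC pC pA) pH).
rewrite [circ (hat F) _]circ_kills ?scaler0 ?subr0; last first.
- exact: base_valued_circ.
- exact: hat_kills_base.
have := pre_Lie mC mA mH pA pH; rewrite /assoc.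
rewrite (circ_kills kC vH) circ0l [circ C (circ (hat F) A)]circ_kills //;
  last exact: base_valued_circ.
rewrite subrr scaler0 => /eqP; rewrite subr_eq0 => /eqP ->.
apply: (IH m (q (+) odd `|a|)) => //; first exact: malt_circ.
exact: par_circ.
Qed.

Lemma hlist_omit (V : lmodType k) m (Y : seq (seq V -> V)) j : hlist m Y ->
  hlist (omit j m) (omit j Y).
Proof.
rewrite /omit; elim: j m Y => [|j IH] [|a m] [|F Y] //= [mF dF hY];
  first by rewrite !drop0.
by split=> //; apply: IH.
Qed.

(** At most one operand can end up outermost, by the preceding lemma, hence one correction per
    operand. Its sign comes from passing [A] and the earlier operands. *)
Lemma foldl_br_hat m p A X : malt A -> par p A -> hlist m X ->
  foldl br A (map hat X) = foldl circ A (map hat X)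
  - \sum_(j < size X) (-1) ^+ ((p (+) lpar (take j m)) && ipar m`_j) *:
      circ (hat (nth 0 X j)) (foldl circ A (map hat (omit j X))).
Proof.
elim: X m p A => [|F X IH] [|a m] p A mA pA.
- by rewrite big_ord0 subr0.
- by [].
- by [].
case=> mF dF hX; have mH := malt_hat mF; have pH := par_hat (hdeg_par dF).
rewrite [map _ _]/= [foldl _ _ _ in LHS]/= (brE mH pA pH) addrC -scaleNr.
rewrite (foldl_brD _ _ _ (hlist_hat hX)).
rewrite (foldl_br_circ_hat mH pH (hat_kills_base mF) (@hat_base_valued _ _ F)
  mA pA hX).
rewrite (IH _ _ _ (malt_circ mA mH) (par_circ mA pA pH) hX).
rewrite big_ord_recl /= -[lpar [::]]/false addbF /omit /= drop0 scaleNr.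
set S1 := \sum_(_ < _) _; set S2 := \sum_(_ < _) _.
suff -> : S1 = S2 by zmod.
by apply: eq_bigr => j _; rewrite lpar_cons addbA.
Qed.

Lemma circ_hat_emb F A x : malt F ->
  circ (hat F) A (map emb x) = (circ F (fun u => (A (map emb u)).2) x, 0).
Proof.
elim: x F A => [|z x IH] F A mF //.
rewrite [map _ _]/= !circ_cons.
have -> : ctr (emb z) (hat F) = hat (ctr z F) by [].
rewrite !IH //; last exact: malt_ctr.
congr (_, _); rewrite /= ?addr0 //; congr (_ + circ _ _ _).
by apply/funext => u; rewrite /tau /wt /= size_map.
Qed.

Lemma epow_base n (v : g) : epow lam n (v, 0) =
  if odd n then (0, (- lam) ^+ n./2 *: v) else ((- lam) ^+ n./2 *: v, 0).
Proof.
elim: n => [|n IH]; first by rewrite scale1r.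
rewrite /epow iterS -/(epow lam n _) IH /= uphalf_half.
by case: (odd n); rewrite /= /eps /= ?scaler0 // exprS scalerA.
Qed.

(** In the first term [pr] keeps the [g]-component of [eps ^ q]; in the others the outer operand
    sees the [eps]-component of [eps ^ (q + 1)], one more input being left over when an operand is
    omitted. *)
Lemma pr_foldl_br n F m X x : malt F -> hdeg n F -> hlist m X ->
  let q := n + 1 - (size X)%:Z in
  pr (foldl br (ext lam F) (map hat X)) x =
  (if odd (absz q) then 0 else
     (- lam) ^+ (absz q)./2 *: shuffle_sum (rcons [seq z + 1 | z <- m] q)
       (compose_raw F m X) x)
  - \sum_(j < size X) (-1) ^+ ((ipar n (+) lpar (take j m)) && ipar m`_j) *:
      if odd (absz (q + 1)) then
        (- lam) ^+ (absz (q + 1))./2 *: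
        shuffle_sum (rcons (rcons [seq z + 1 | z <- omit j m] (q + 1)) m`_j)
          (insert (nth 0 X j) (compose_raw F (omit j m) (omit j X)) m`_j) x
      else 0.
Proof.
move=> mF dF hX q; rewrite /pr.
rewrite (foldl_br_hat (malt_ext lam mF) (par_ext lam (hdeg_par dF)) hX).
rewrite appD appN appsum [LHS]/=; congr (_ - _).
  by rewrite (foldl_circ_compose _ _ mF dF hX) -/q epow_base; case: odd.
rewrite (big_morph (fun u : W => u.1) (id1 := 0) (op1 := +%R)) //.
apply: eq_bigr => j _; have [mX dX] := hlist_nth hX (ltn_ord j).
rewrite appZ circ_hat_emb //= shuffle_sum_insert //; congr (_ *: _).
have sq : n + 1 - (size (omit j X))%:Z = q + 1.
  by rewrite /q /omit size_cat size_take size_drop ltn_ord; have := ltn_ord j;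
    lia.
have -> : (fun u => (foldl circ (ext lam F) (map hat (omit j X)) (map emb
  u)).2) =
    (if odd (absz (q + 1)) then (- lam) ^+ (absz (q + 1))./2 else 0) *:
      shuffle_sum (rcons [seq z + 1 | z <- omit j m] (q + 1)) (compose_raw F
        (omit j m) (omit j X)).
  apply/funext => u; rewrite (foldl_circ_compose _ _ mF dF (hlist_omit _ hX))
    sq epow_base appZ.
  by case: odd; rewrite /= ?scale0r.
by rewrite circZr // appZ; case: odd; rewrite ?scale0r.
Qed.

End IteratedBracket.

(** * Derived brackets *)

Section ForallIn.
Variable T : Type.

Fixpoint allp (P : T -> Prop) (t : seq T) : Prop :=
  if t is a :: t' then P a /\ allp P t' else True.

Lemma allp_cat P s t : allp P (s ++ t) <-> allp P s /\ allp P t.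
Proof. by elim: s => [|a s IH] /=; rewrite ?IH; tauto. Qed.

End ForallIn.

(** * Signed sums over splittings of a list *)

Section Unshuffles.
Variables (k : fieldType) (T : Type) (p : T -> bool).

Definition parl (t : seq T) : bool := foldr (fun a b => p a (+) b) false t.

Lemma parl_cat s t : parl (s ++ t) = parl s (+) parl t.
Proof. by elim: s => //= a s ->; rewrite addbA. Qed.

Variable M : lmodType k.
Implicit Types G : seq T -> seq T -> M.

(* [G u v] is summed over the splittings of [t] into two subsequences; an entry
   that goes to [v] passes those that have gone to [u], hence the sign. *)
Fixpoint unshuffle (t : seq T) G : M :=
  if t is a :: t' then
    unshuffle t' (fun u v => G (a :: u) v)
    + unshuffle t' (fun u v => (-1) ^+ (p a && parl u) *: G u (a :: v))
  else G [::] [::].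

Lemma eq_unshuffle_in P t G G' : allp P t ->
  (forall u v, allp P u -> allp P v -> G u v = G' u v) -> unshuffle t G =
    unshuffle t G'.
Proof.
elim: t G G' => [|a t IH] G G' /= => [_ E|[Pa Pt] E]; first exact: E.
by congr (_ + _); apply: IH => // u v Pu Pv; rewrite E.
Qed.

Lemma eq_unshuffle t G G' : (forall u v,
  G u v = G' u v) -> unshuffle t G = unshuffle t G'.
Proof.
move=> E; apply: (@eq_unshuffle_in (fun=> True)) => [|u v _ _]; last exact: E.
by elim: t => /=.
Qed.

Lemma unshuffle_lin c t G G' :
  unshuffle t (fun u v => c *: G u v + G' u v) =
    c *: unshuffle t G + unshuffle t G'.
Proof.
elim: t G G' => [|a t IH] G G' //=; rewrite IH.
have -> : unshuffle t (fun u v =>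
  (-1) ^+ (p a && parl u) *: (c *: G u (a :: v) + G' u (a :: v))) =
    unshuffle t (fun u v =>
      c *: ((-1) ^+ (p a && parl u) *: G u (a :: v)) + (-1) ^+ (p a && parl u)
        *: G' u (a :: v)).
  by apply: eq_unshuffle => u v; rewrite scalerDr !scalerA mulrC.
by rewrite IH scalerDr; zmod.
Qed.

Lemma unshuffle0 t : unshuffle t (fun _ _ => 0) = 0.
Proof.
elim: t => //= a t IH; rewrite IH add0r -[RHS]IH; apply: eq_unshuffle => u v.
exact: scaler0.
Qed.

Lemma unshuffleZ c t G : unshuffle t (fun u v => c *: G u v) =
  c *: unshuffle t G.
Proof.
have := unshuffle_lin c t G (fun _ _ => 0); rewrite unshuffle0 addr0 => <-.
by apply: eq_unshuffle => u v; rewrite addr0.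
Qed.

Lemma unshuffleD t G G' : unshuffle t (fun u v => G u v + G' u v) =
  unshuffle t G + unshuffle t G'.
Proof.
by have := unshuffle_lin 1 t G G'; rewrite scale1r => <-;
  apply: eq_unshuffle => u v; rewrite scale1r.
Qed.

Lemma unshuffle_swap t G :
  unshuffle t G = unshuffle t (fun u v => (-1) ^+ (parl u && parl v) *: G v u).
Proof.
elim: t G => [|a t IH] G /=; first by rewrite scale1r.
rewrite IH [X in _ + X]IH addrC; congr (_ + _); apply: eq_unshuffle => u v.
  rewrite scalerA -signr_addb; congr (_ ^+ _ *: _).
  by case: (p a); case: (parl u); case: (parl v).
rewrite scalerA -signr_addb; congr (_ ^+ _ *: _).
by case: (p a); case: (parl u); case: (parl v).
Qed.

(** When [a] and [b] go to the same side the symmetry of [G] applies; when they are separated, the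
    sign is the one by which [unshuffle] counts their crossing. *)
Lemma unshuffle_adjacent P s a b t G : allp P (s ++ a :: b :: t) ->
  (forall u1 u2 v, allp P (u1 ++ a :: b :: u2) -> allp P v ->
     G (u1 ++ a :: b :: u2) v =
       (-1) ^+ (p a && p b) *: G (u1 ++ b :: a :: u2) v) ->
  (forall u v1 v2, allp P u -> allp P (v1 ++ a :: b :: v2) ->
     G u (v1 ++ a :: b :: v2) =
       (-1) ^+ (p a && p b) *: G u (v1 ++ b :: a :: v2)) ->
  unshuffle (s ++ a :: b :: t) G =
    (-1) ^+ (p a && p b) *: unshuffle (s ++ b :: a :: t) G.
Proof.
elim: s G => [|c s IH] G Pt Gu Gv; last first.
  case: Pt => Pc Pt; rewrite /= scalerDr; congr (_ + _); rewrite IH //.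
  - by move=> u1 u2 v Pu Pv; apply: (Gu (c :: u1)).
  - by move=> u v1 v2 Pu Pv; apply: Gv.
  - move=> u1 u2 v Pu Pv; rewrite Gu // !scalerA mulrC !parl_cat /=.
    by rewrite [p a (+) (p b (+) _)]addbCA.
  - by move=> u v1 v2 Pu Pv; rewrite (Gv u (c :: v1)) // !scalerA mulrC.
case: Pt => Pa [Pb Pt]; rewrite /= !scalerDr -!unshuffleZ -!addrA;
  congr (_ + _).
  by apply: (eq_unshuffle_in Pt) => u v Pu Pv; rewrite (Gu [::]).
rewrite [LHS]addrCA; congr (_ + (_ + _));
  apply: (eq_unshuffle_in Pt) => u v Pu Pv.
- rewrite !scalerA -!signr_addb; congr (_ ^+ _ *: _).
  by case: (p a); case: (p b); case: (parl u).
- rewrite !scalerA -!signr_addb; congr (_ ^+ _ *: _).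
  by case: (p a); case: (p b); case: (parl u).
- rewrite (Gv u [::] v) // !scalerA -!signr_addb; congr (_ ^+ _ *: _).
  by case: (p a); case: (p b); case: (parl u).
Qed.

Lemma unshuffle_additive s t a b c G : p a = p c -> p b = p c ->
  (forall u1 u2 v, G (u1 ++ c :: u2) v =
    G (u1 ++ a :: u2) v + G (u1 ++ b :: u2) v) ->
  (forall u v1 v2, G u (v1 ++ c :: v2) =
    G u (v1 ++ a :: v2) + G u (v1 ++ b :: v2)) ->
  unshuffle (s ++ c :: t) G =
    unshuffle (s ++ a :: t) G + unshuffle (s ++ b :: t) G.
Proof.
move=> pa pb; elim: s G => [|x s IH] G Gu Gv /=.
  rewrite addrACA; congr (_ + _); rewrite -unshuffleD;
    apply: eq_unshuffle => u v; first exact: (Gu [::]).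
  by rewrite pa pb (Gv u [::]) scalerDr.
rewrite (IH (fun u v => G (x :: u) v)) => [|u1 u2 v|u v1 v2]; first last.
- exact: Gv.
- exact: (Gu (x :: u1)).
rewrite (IH (fun u v => _ *: G u (x :: v))) => [|u1 u2 v|u v1 v2]; first last.
- by rewrite (Gv u (x :: v1)) scalerDr.
- by rewrite Gu scalerDr !parl_cat /= pa pb.
by rewrite addrACA.
Qed.

Lemma unshuffle_size0 t G : (forall u v,
  (size u + size v = size t)%N -> G u v = 0) -> unshuffle t G = 0.
Proof.
elim: t G => [|a t IH] G /= G0; first exact: G0.
rewrite !IH ?addr0 // => u v uv; first by rewrite G0 ?scaler0 ?addnS ?uv.
by rewrite G0 // addSn uv.
Qed.

Lemma unshuffle_sum I (r : seq I) t (G : I -> seq T -> seq T -> M) :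
  unshuffle t (fun u v => \sum_(i <- r) G i u v) =
    \sum_(i <- r) unshuffle t (G i).
Proof.
elim: r => [|i r IH].
  by rewrite big_nil -[RHS](unshuffle0 t); apply: eq_unshuffle => u v;
    rewrite big_nil.
by rewrite big_cons -IH -unshuffleD; apply: eq_unshuffle => u v;
  rewrite big_cons.
Qed.

Lemma unshuffle_nil t G : unshuffle t (fun u v =>
  if u is [::] then G u v else 0) = G [::] t.
Proof.
elim: t G => //= a t IH G;
  rewrite unshuffle0 add0r -(IH (fun u v => G u (a :: v))).
by apply: eq_unshuffle => -[|x u] v; rewrite ?scaler0 //= andbF scale1r.
Qed.

End Unshuffles.

Lemma unshuffle_linear (k : fieldType) T p (M M' : lmodType k) (h : M ->
  M') (t : seq T) G :
  (forall a u v, h (a *: u + v) = a *: h u + h v) ->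
  h (unshuffle p t G) = unshuffle p t (fun u v => h (G u v)).
Proof.
move=> hl; have hD u v : h (u + v) =
  h u + h v by rewrite -[u]scale1r hl !scale1r.
have h0 : h 0 = 0 by apply: (addrI (h 0)); rewrite -hD !addr0.
have hZ a u : h (a *: u) = a *: h u by rewrite -[a *: u]addr0 hl h0 addr0.
elim: t G => //= a t IH G; rewrite hD !IH; congr (_ + _).
by apply: eq_unshuffle => u v; rewrite hZ.
Qed.

Lemma unshuffle_map (k : fieldType) T T' p (M : lmodType k) (h : T' -> T) (t :
  seq T') (G : seq T -> seq T -> M) :
  unshuffle p (map h t) G = unshuffle (p \o h) t (fun u v =>
    G (map h u) (map h v)).
Proof.
elim: t G => //= a t IH G; rewrite !IH; congr (_ + _).
apply: eq_unshuffle => u v; congr (_ ^+ (_ && _) *: _).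
by elim: u => //= b u ->.
Qed.

(** * Voronov's identity *)

Section Voronov.
Variables (k : fieldType) (g : lmodType k) (lam : k).
Let W : lmodType k := (g * g)%type.
Implicit Types (F H K : seq g -> g) (A B C : seq W -> W).

Lemma par_ev A : par false (ev A).
Proof.
apply/funext => s; rewrite appZ /tau /ev /wt exprS -signr_odd.
by case: odd; rewrite /= ?expr1 ?mulN1r ?opprK // !scale0r !scaler0.
Qed.

Lemma par_od A : par true (od A).
Proof.
apply/funext => s; rewrite appZ /tau /od /wt exprS -signr_odd.
by case: odd; rewrite /= ?expr0 ?mulr1 // !scale0r !scaler0.
Qed.

(* Two functions in the abelian subalgebra have zero bracket, hence commute as
   operators. *)
Lemma br_hat_comm p q A F H : malt A -> malt F -> malt H -> par p F ->
  par q H ->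
  br (br A (hat F)) (hat H) = (-1) ^+ (p && q) *: br (br A (hat H)) (hat F).
Proof.
(* The Jacobi identity needs a definite parity; a general [A] is split afterwards as
   [ev A + od A]. *)
have E r A' : par r A' -> malt A' -> malt F -> malt H -> par p F -> par q H ->
    br (br A' (hat F)) (hat H) = (-1) ^+ (p && q) *: br (br A' (hat H)) (hat F).
  move=> pA mA mF mH pF pH; have mF' := malt_hat mF; have mH' := malt_hat mH.
  rewrite (br_jacobi mA mF' mH' pA (par_hat pF) (par_hat pH)).
  rewrite (brE mH' (par_hat pF) (par_hat pH)).
  by rewrite !circ_kills ?scaler0 ?subr0 ?br0r ?add0r //; exact: hat_kills_base.
move=> mA mF mH pF pH; rewrite -(evD_od A).
have := malt_ev mA; have := malt_od mA; have := malt_hat mF;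
  have := malt_hat mH => mH' mF' mo me.
have brDl' B C D : malt D -> br (B + C) D = br B D + br C D.
  by move=> mD; have := brDl 1 B C mD; rewrite !scale1r.
rewrite (brDl' (ev A) (od A) _ mF') (brDl' (ev A) (od A) _ mH').
rewrite (brDl' (br (ev A) (hat F)) _ _ mH') (brDl' (br (ev A) (hat H)) _ _ mF').
rewrite (E _ _ (par_ev A)) // (E _ _ (par_od A)) //.
by rewrite [RHS]scalerDr.
Qed.

Definition good (t : bool * (seq g -> g)) := malt t.2 /\ par t.1 t.2.

Definition bhat (A : seq W -> W) (t : seq (bool * (seq g -> g))) : seq W -> W :=
  foldl br A (map (fun x => hat x.2) t).

Lemma malt_bhat A t : malt A -> allp good t -> malt (bhat A t).
Proof.
rewrite /bhat; elim: t A => //= x t IH A mA [[mx _] gt].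
by apply: IH => //; apply: malt_br => //; apply: malt_hat.
Qed.

Lemma par_bhat p A t : malt A -> par p A -> allp good t ->
  par (p (+) parl fst t) (bhat A t).
Proof.
rewrite /bhat; elim: t p A => [|x t IH] p A /= mA pA; first by rewrite addbF.
case=> [[mx px] gt]; rewrite addbA; apply: IH => //.
  by apply: malt_br => //; apply: malt_hat.
by apply: par_br => //; [apply: malt_hat|apply: par_hat].
Qed.

Lemma bhat_move q A K t : malt A -> malt K -> par q K -> allp good t ->
  bhat (br A (hat K)) t = (-1) ^+ (q && parl fst t) *: br (bhat A t) (hat K).
Proof.
rewrite /bhat; elim: t A => [|x t IH] A mA mK pK /=.
  by rewrite andbF scale1r.
case=> [[mx px] gt]; rewrite (br_hat_comm mA mK mx pK px).
have mA' : malt (br A (hat x.2)) by apply: malt_br => //; apply: malt_hat.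
have bZ c B : foldl br (c *: B) (map (fun x => hat x.2) t) = c *: bhat B t.
  elim: t B gt {IH} => //= y t IH B [[my _] gt].
  by rewrite brZl ?IH //; exact: malt_hat.
by rewrite bZ /bhat IH // scalerA -signr_addb; case: q {pK IH}; case: (x.1).
Qed.

(** Each operand acts on [br A B] as a derivation, hence goes to [A] or to [B]. Those that go to [A]
    pass [B], which explains the sign. *)
Lemma bhat_br p q A B t : malt A -> malt B -> par p A -> par q B ->
  allp good t ->
  bhat (br A B) t =
  unshuffle fst t (fun u v =>
    (-1) ^+ (q && parl fst u) *: br (bhat A u) (bhat B v)).
Proof.
have bD c C C' s : allp good s -> bhat (c *: C + C') s =
  c *: bhat C s + bhat C' s.
  rewrite /bhat; elim: s C C' => //= y s IH C C' [[my _] gs].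
  by rewrite brDl ?IH //; exact: malt_hat.
elim: t p q A B => [|x t IH] p q A B mA mB pA pB /=.
  by rewrite andbF scale1r.
case=> [[mx px] gt]; have mx' := malt_hat mx; have px' := par_hat px.
rewrite -[LHS]/(bhat (br (br A B) (hat x.2)) t) (br_jacobi mA mB mx' pA pB px').
rewrite addrC bD //.
have [mAx mBx] : malt (br A (hat x.2)) /\ malt (br B (hat x.2)) by split;
  apply: malt_br.
rewrite (IH _ _ _ _ mAx mB (par_br mA mx' pA px') pB gt).
rewrite (IH _ _ _ _ mA mBx pA (par_br mB mx' pB px') gt) -unshuffleZ;
  congr (_ + _).
  apply: eq_unshuffle => u v; rewrite scalerA -signr_addb; congr (_ ^+ _ *: _).
  by case: q {pB}; case: (x.1); case: (parl _ u).
apply: eq_unshuffle => u v; rewrite scalerA -signr_addb; congr (_ ^+ _ *: _).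
by case: q {pB}; case: (x.1); case: (parl _ u).
Qed.

Definition derived F (X : seq (seq g -> g)) : seq g -> g :=
  pr (foldl br (ext lam F) (map hat X)).

(* Voronov's higher derived bracket identity, with two operands in the big
   Lie algebra. *)
Lemma voronov p q F H t : malt F -> malt H -> par p F -> par q H ->
  allp good t ->
  derived (br F H) (map snd t) =
  unshuffle fst t (fun u v => derived F (derived H (map snd u) :: map snd v))
  - (-1) ^+ (p && q) *:
    unshuffle fst t (fun u v => derived H (derived F (map snd u) :: map snd v)).
Proof.
move=> mF mH pF pH gt; rewrite /derived ext_br // -map_comp -/(bhat _ t).
have [mF' mH'] := (malt_ext lam mF, malt_ext lam mH).
have [pF' pH'] := (par_ext lam pF, par_ext lam pH).
rewrite (bhat_br mF' mH' pF' pH' gt) unshuffle_linear; last exact: pr_lin.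
pose T := unshuffle fst t (fun u v => (-1) ^+ (q && parl fst u) *:
  pr (br (hat (pr (bhat (ext lam F) u))) (bhat (ext lam H) v))).
pose T' := unshuffle fst t (fun u v => (-1) ^+ (q && parl fst u) *:
  pr (br (bhat (ext lam F) u) (hat (pr (bhat (ext lam H) v))))).
transitivity (T' + T).
  rewrite /T /T' -unshuffleD. apply: (@eq_unshuffle_in k _ _ _ good _ _ _ gt)
    => u v gu gv.
  rewrite prZ (pr_br (malt_bhat mF' gu) (malt_bhat mH' gv) (par_bhat mF' pF'
    gu) (par_bhat mH' pH' gv)).
  by rewrite scalerDr addrC.
(* The projected value [K] is bracketed last but must be the first operand; the operands of the
   abelian subalgebra commute up to sign. *)
have move_front r B u K : malt B -> malt K -> par r K -> allp good u ->
    pr (br (bhat B u) (hat K)) =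
    (-1) ^+ (r && parl fst u) *: pr (foldl br B (map hat (K :: map snd u))).
  move=> mB mK pK gu; rewrite /= -map_comp -/(bhat _ u) (bhat_move mB mK pK gu)
    prZ.
  by rewrite scalerA -signr_addb addbb scale1r.
congr (_ + _).
  (* In [T'] the inner bracket uses the second part of the splitting, so the two parts are
     exchanged. *)
  rewrite /T' unshuffle_swap;
    apply: (@eq_unshuffle_in k _ _ _ good _ _ _ gt) => u v gu gv.
  rewrite (move_front (q (+) parl fst u)) //; last 2 first.
  - exact/malt_pr/malt_bhat.
  - exact/par_pr/par_bhat.
  rewrite !scalerA -!signr_addb /bhat -map_comp.
  rewrite (_ : _ (+) _ = false) ?scale1r //.
  by case: q {pH pH' T T'}; case: (parl _ u); case: (parl _ v).
rewrite -scaleNr -unshuffleZ;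
  apply: (@eq_unshuffle_in k _ _ _ good _ _ _ gt) => u v gu gv.
have mK := malt_pr (malt_bhat mF' gu); have pK := par_pr (par_bhat mF' pF' gu).
rewrite (brC (malt_bhat mH' gv) (malt_hat mK) (par_bhat mH' pH' gv) (par_hat
  pK)).
rewrite -scaleNr prZ (move_front _ _ _ _ mH' mK pK gv) !scalerA /bhat -map_comp.
congr (_ *: _); case: p q {pF pH pF' pH' pK T T'} => -[]; case: (parl _ u);
  case: (parl _ v);
  by rewrite /= ?expr1 ?expr0 ?mulr1 ?mul1r ?mulrN1 ?mulN1r ?opprK.
Qed.

End Voronov.

(** * The brackets on sm + a *)

Section AltOperations.
Variables (k : fieldType) (g : lmodType k) (lam : k).
Let W : lmodType k := (g * g)%type.
Implicit Types (f h : alt g) (X : seq (alt g)).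

Lemma malt_alt f : malt f.
Proof. by case: f => F /= /asboolP[mF aF _]; split. Qed.

Lemma bounded_alt f : bounded f.
Proof. by case: f => F /= /asboolP[_ _]. Qed.

Lemma is_altP F : malt F -> bounded F -> F \in is_alt (g := g).
Proof. by case=> mF aF bF; apply/asboolP; split. Qed.

Definition mk_alt F (mF : malt F) (bF : bounded F) :
  alt g := Alt (is_altP mF bF).

Lemma alt_inj f h : (f : seq g -> g) = h -> f = h.
Proof. exact: val_inj. Qed.

Lemma alt_lin a f h : (a *: f + h : alt g) = a *: (f : seq g -> g) + (h :
  seq g -> g) :> (seq g -> g).
Proof. by []. Qed.

Fact bounded_wt c f : bounded (wt c f).
Proof. by have [B bf] := bounded_alt f; exists B; apply: vanish_wt. Qed.

Definition alt_wt c f := mk_alt (malt_wt c (malt_alt f)) (bounded_wt c f).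

Lemma bounded_br (V : lmodType k) (F H : seq V -> V) : malt F -> malt H ->
  bounded F -> bounded H -> bounded (br F H).
Proof.
move=> mF mH [A bF] [B bH]; exists (A + B)%N => s le_s.
have b1 := vanish_circ mF bF bH le_s.
have b2 c : circ (wt c H) F s = 0.
  apply: (vanish_circ (malt_wt c mH) (@vanish_wt _ _ _ c _ _ bH) bF);
    by rewrite addnC.
have bt : vanish_from A (tau F) by apply: vanish_wt.
have b3 c : circ (wt c H) (tau F) s = 0.
  apply: (vanish_circ (malt_wt c mH) (@vanish_wt _ _ _ c _ _ bH) bt);
    by rewrite addnC.
by rewrite /br !appE b1 b2 b3 !subr0.
Qed.

Definition alt_br f h :=
  mk_alt (malt_br (malt_alt f) (malt_alt h))
         (bounded_br (malt_alt f) (malt_alt h) (bounded_alt f) (bounded_alt h)).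

Lemma malt_foldl_br (A : seq W -> W) X : malt A ->
  malt (foldl br A (map (fun f => hat f) X)).
Proof.
elim: X A => //= f X IH A mA; apply/IH/malt_br => //.
exact/malt_hat/malt_alt.
Qed.

Lemma bounded_foldl_br (A : seq W -> W) X : malt A -> bounded A ->
  bounded (foldl br A (map (fun f => hat f) X)).
Proof.
elim: X A => //= f X IH A mA bA; have mf := malt_hat (malt_alt f).
apply: IH; first exact: malt_br.
apply: bounded_br => //; have [B bf] := bounded_alt f.
by exists B; apply: vanish_hat.
Qed.

Fact malt_derived f X : malt (pr (foldl br (ext lam f) (map (fun f =>
  hat f) X))).
Proof. exact/malt_pr/malt_foldl_br/malt_ext/malt_alt. Qed.

Fact bounded_derived f X : bounded (pr (foldl br (ext lam f) (map (fun f =>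
  hat f) X))).
Proof.
have mE := malt_ext lam (malt_alt f).
have bE : bounded (ext lam f).
  by have [B bf] := bounded_alt f; exists B; apply: vanish_ext.
by have [B bB] := bounded_foldl_br X mE bE; exists B; apply: vanish_pr.
Qed.

Definition alt_derived f X := mk_alt (malt_derived f X) (bounded_derived f X).

Lemma alt_derivedE' f X :
  alt_derived f X = pr (foldl br (ext lam f) (map (fun f =>
    hat f) X)) :> (seq g -> g).
Proof. by []. Qed.

Lemma alt_derivedE f X : alt_derived f X =
  derived lam f (map (@alt_fun k g) X) :> (seq g -> g).
Proof. by rewrite /alt_derived /derived /= -map_comp. Qed.

Lemma foldl_br_lin a (A A' : seq W -> W) X :
  foldl br (a *: A + A') (map (fun f => hat f) X) =
  a *: foldl br A (map (fun f => hat f) X) + foldl br A' (map (fun f =>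
    hat f) X).
Proof.
elim: X A A' => //= f X IH A A'.
by rewrite brDl ?IH //; exact/malt_hat/malt_alt.
Qed.

Lemma alt_derived_linl a f h X :
  alt_derived (a *: f + h) X = a *: alt_derived f X + alt_derived h X.
Proof.
by apply: alt_inj; rewrite alt_lin !alt_derivedE' alt_lin ext_lin foldl_br_lin.
Qed.

Lemma alt_derived_linr f s t a u v :
  alt_derived f (s ++ (a *: u + v) :: t) =
  a *: alt_derived f (s ++ u :: t) + alt_derived f (s ++ v :: t).
Proof.
apply: alt_inj; rewrite alt_lin !alt_derivedE' -pr_lin !map_cat !foldl_cat.
set A := foldl br (ext lam f) [seq hat (alt_fun f) | f <- s].
rewrite -[LHS]/(pr (foldl br (br A (hat (a *: u + v : alt g))) (map (fun f =>
  hat f) t))).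
rewrite -[RHS]/(pr (a *: foldl br (br A (hat u)) (map (fun f =>
  hat f) t) + foldl br (br A (hat v)) (map (fun f => hat f) t))).
rewrite -foldl_br_lin alt_lin hat_lin brDr //;
  exact/malt_foldl_br/malt_ext/malt_alt.
Qed.

Lemma alt_brE f h : alt_br f h = br f h :> (seq g -> g). Proof. by []. Qed.
Lemma alt_wtE c f : alt_wt c f = wt c f :> (seq g -> g). Proof. by []. Qed.

Lemma alt_br_linl a f f' h : alt_br (a *: f + f') h =
  a *: alt_br f h + alt_br f' h.
Proof. by apply: alt_inj; rewrite alt_lin !alt_brE alt_lin brDl //;
  exact: malt_alt. Qed.

Lemma alt_br_linr a f h h' : alt_br f (a *: h + h') =
  a *: alt_br f h + alt_br f h'.
Proof. by apply: alt_inj; rewrite alt_lin !alt_brE alt_lin brDr //;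
  exact: malt_alt. Qed.

Lemma alt_wt_lin c a f h : alt_wt c (a *: f + h) = a *: alt_wt c f + alt_wt c h.
Proof.
by apply: alt_inj; apply/funext => s;
  rewrite alt_lin !alt_wtE !appE /wt alt_lin !appE scalerDr !scalerA mulrC.
Qed.

Definition alt_tau := alt_wt (fun n => (-1) ^+ n.+1).
Definition alt_ev := alt_wt (fun n => (odd n)%:R).
Definition alt_od := alt_wt (fun n => (~~ odd n)%:R).

End AltOperations.

Section Brackets.
Variables (k : fieldType) (g : lmodType k) (lam : k).
Local Notation D := (@alt_derived k g lam).
Implicit Types (f h : alt g) (pre post : seq (alt g)) (x : seq (smL g)).

(* The derived bracket of [s f] and [pre ++ post], for [s f] placed between
   [pre] and [post]: moving [s f] to the front produces the sign [tau] on [pre]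
   when [s f] is odd, that is on the even part of [f]. *)
Definition mixed pre f post : alt g :=
  D (alt_od f) (pre ++ post) + D (alt_ev f) (map (@alt_tau k g) pre ++ post).

(** Sum over the position of the single argument taken from [sm]; [pre] accumulates the
    [a]-components standing before it. *)
Fixpoint l_a pre x : alt g :=
  if x is y :: x' then mixed pre y.1 (map snd x') + l_a (rcons pre y.2) x' else
    0.

Definition l_sm x : alt g :=
  if x is [:: a; b] then alt_br (alt_tau a.1) b.1 else 0.

Definition lbr x : smL g := (l_sm x, l_a [::] x).

Lemma mixed_linm pre a f h post :
  mixed pre (a *: f + h) post = a *: mixed pre f post + mixed pre h post.
Proof.
by rewrite /mixed /alt_od /alt_ev !alt_wt_lin !alt_derived_linl scalerDr; zmod.
Qed.

Lemma mixed_linl p q a u v f post :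
  mixed (p ++ (a *: u + v) :: q) f post =
  a *: mixed (p ++ u :: q) f post + mixed (p ++ v :: q) f post.
Proof.
rewrite /mixed !map_cat /= /alt_tau alt_wt_lin -!catA /= !alt_derived_linr.
by rewrite scalerDr; zmod.
Qed.

Lemma mixed_linr pre f p q a u v :
  mixed pre f (p ++ (a *: u + v) :: q) =
  a *: mixed pre f (p ++ u :: q) + mixed pre f (p ++ v :: q).
Proof. by rewrite /mixed !catA !alt_derived_linr scalerDr; zmod. Qed.

Lemma l_a_linl p q a u v x :
  l_a (p ++ (a *: u + v) :: q) x =
    a *: l_a (p ++ u :: q) x + l_a (p ++ v :: q) x.
Proof.
elim: x q => [|y x IH] q /=; first by rewrite scaler0 addr0.
by rewrite mixed_linl !rcons_cat /= IH [in RHS]scalerDr; zmod.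
Qed.

Lemma l_a_linr pre s t a u v :
  l_a pre (s ++ (a *: u + v) :: t) =
    a *: l_a pre (s ++ u :: t) + l_a pre (s ++ v :: t).
Proof.
elim: s pre => [|y s IH] pre /=.
  by rewrite mixed_linm -!cats1 l_a_linl [in RHS]scalerDr; zmod.
by rewrite !map_cat /= mixed_linr IH [in RHS]scalerDr; zmod.
Qed.

Lemma l_sm_lin s t a u v :
  l_sm (s ++ (a *: u + v) :: t) = a *: l_sm (s ++ u :: t) + l_sm (s ++ v :: t).
Proof.
case: s => [|y [|y' [|y'' s]]] /=; try by rewrite scaler0 addr0.
- case: t => [|z [|z' t]]; try by rewrite scaler0 addr0.
  by rewrite /alt_tau alt_wt_lin alt_br_linl.
- by case: t => [|z t]; rewrite ?alt_br_linr ?scaler0 ?addr0.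
Qed.

Lemma lbr_multilinear : multilinear lbr.
Proof. by move=> s t a u v; rewrite /lbr l_sm_lin l_a_linr. Qed.

End Brackets.

(** * Graded symmetry *)

Section GradedSymmetry.
Variables (k : fieldType) (g : lmodType k) (lam : k).
Local Notation D := (@alt_derived k g lam).
Local Notation mixed := (@mixed k g lam).
Local Notation l_a := (@l_a k g lam).
Local Notation lbr := (@lbr k g lam).
Implicit Types (f h u v : alt g) (pre post : seq (alt g)) (y z : smL g) (x :
  seq (smL g)).

(** Parity as a condition on the support: it implies [par] and determines [alt_ev] and [alt_od]
    directly. *)
Definition hpar (p : bool) (F : seq g -> g) := forall s,
  F s != 0 -> odd (size s) = ~~ p.

Lemma hdeg_hpar n (F : seq g -> g) : hdeg n F -> hpar (ipar n) F.
Proof. by move=> dF s /dF E; rewrite /ipar; lia. Qed.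

Lemma hpar_wt c p (F : seq g -> g) : hpar p F -> hpar p (wt c F).
Proof.
move=> pF s; have [F0|F0 _] := eqVneq (F s) 0; last exact: pF.
by rewrite /wt F0 scaler0 eqxx.
Qed.

Lemma hpar0 p : hpar p (0 : seq g -> g).
Proof. by move=> s; rewrite eqxx. Qed.

Lemma hpar_tau p (F : seq g -> g) : hpar p F -> par p F.
Proof.
move=> pF; apply/funext => s; rewrite appZ /tau /wt.
have [->|/pF ds] := eqVneq (F s) 0; first by rewrite !scaler0.
by rewrite -signr_odd /= ds negbK.
Qed.

Lemma alt_tau_par p f : hpar p f -> alt_tau f = (-1) ^+ p *: f.
Proof. by move=> /hpar_tau pf; apply: alt_inj; rewrite /= -/(tau f) pf. Qed.

Lemma alt_ev_par p f : hpar p f -> alt_ev f = if p then 0 else f.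
Proof.
move=> pf; apply: alt_inj; apply/funext => s; rewrite /= /wt.
have [f0|/pf ->] := eqVneq (f s) 0; first by rewrite f0 scaler0; case: p {pf}.
by case: p {pf}; rewrite /= ?scale0r ?scale1r.
Qed.

Lemma alt_od_par p f : hpar p f -> alt_od f = if p then f else 0.
Proof.
move=> pf; apply: alt_inj; apply/funext => s; rewrite /= /wt.
have [f0|/pf ->] := eqVneq (f s) 0; first by rewrite f0 scaler0; case: p {pf}.
by case: p {pf}; rewrite /= ?scale0r ?scale1r.
Qed.

Lemma alt_derived0l X : D 0 X = 0.
Proof. by have := alt_derived_linl lam (-1) 0 0 X;
  rewrite addr0 scaler0 scaleN1r addNr. Qed.

Lemma alt_derivedZl a f X : D (a *: f) X = a *: D f X.
Proof. by have := alt_derived_linl lam a f 0 X;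
  rewrite alt_derived0l !addr0. Qed.

Lemma alt_derived0r f s t : D f (s ++ 0 :: t) = 0.
Proof. by have := alt_derived_linr lam f s t (-1) 0 0;
  rewrite addr0 scaler0 scaleN1r addNr. Qed.

Lemma alt_derivedZr a f s u t : D f (s ++ (a *: u) :: t) =
  a *: D f (s ++ u :: t).
Proof. by have := alt_derived_linr lam f s t a u 0;
  rewrite alt_derived0r !addr0. Qed.

Lemma mixedE p pre f post : hpar p f ->
  mixed pre f post = D f ((if p then pre else map (@alt_tau k g) pre) ++ post).
Proof.
move=> pf; rewrite /mixed (alt_ev_par pf) (alt_od_par pf).
by case: p {pf}; rewrite alt_derived0l ?add0r ?addr0.
Qed.

Lemma alt_derived_comm p q f s u v t : hpar p u -> hpar q v ->
  D f (s ++ u :: v :: t) = (-1) ^+ (p && q) *: D f (s ++ v :: u :: t).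
Proof.
move=> pu qv; apply: alt_inj;
  rewrite -[(_ *: _)]addr0 alt_lin addr0 !alt_derivedE' -prZ; congr pr.
rewrite !map_cat !foldl_cat;
  set A := foldl br (ext lam f) [seq hat (alt_fun f) | f <- s].
have mA : malt A by exact/malt_foldl_br/malt_ext/malt_alt.
rewrite -[LHS]/(foldl br (br (br A (hat u)) (hat v)) [seq hat (alt_fun f) | f
  <- t]).
rewrite (br_hat_comm mA (malt_alt u) (malt_alt v) (hpar_tau pu) (hpar_tau qv)).
rewrite -[X in foldl br X]addr0 foldl_br_lin.
rewrite (_ : foldl br 0 _ = 0) ?addr0 //.
by elim: t => //= w t IH; rewrite br0l //; exact/malt_hat/malt_alt.
Qed.

Lemma mixed_comm p q s u v t f post : hpar p u -> hpar q v ->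
  mixed (s ++ u :: v :: t) f post =
    (-1) ^+ (p && q) *: mixed (s ++ v :: u :: t) f post.
Proof.
move=> pu qv; rewrite /mixed !map_cat /= -!catA /= scalerDr.
rewrite (alt_derived_comm _ _ _ pu qv); congr (_ + _).
by apply: alt_derived_comm; apply: hpar_wt.
Qed.

Lemma l_a_comm_pre p q s u v t x : hpar p u -> hpar q v ->
  l_a (s ++ u :: v :: t) x = (-1) ^+ (p && q) *: l_a (s ++ v :: u :: t) x.
Proof.
move=> pu qv; elim: x t => [|y x IH] t /=; first by rewrite scaler0.
by rewrite !rcons_cat /= IH (mixed_comm _ _ _ _ pu qv) [RHS]scalerDr.
Qed.

(** The tag is the parity of the degree in [sm + a]; the shift gives the underlying function in [m]
    the opposite parity. *)
Definition goodL (t : bool * smL g) := hpar (~~ t.1) t.2.1 /\ hpar t.1 t.2.2.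

Lemma mixed_shift d e pre f v post : hpar (~~ d) f -> hpar e v ->
  mixed pre f (v :: post) = (-1) ^+ (d && e) *: mixed (rcons pre v) f post.
Proof.
move=> pf pv; rewrite !(mixedE _ _ pf) map_rcons.
case: d {pf} => /=; rewrite cat_rcons ?scale1r //.
by rewrite (alt_tau_par pv) alt_derivedZr scalerA -signr_addb addbb scale1r.
Qed.

Lemma l_a_comm pre s y z t d e : goodL (d, y) -> goodL (e, z) ->
  l_a pre (s ++ y :: z :: t) = (-1) ^+ (d && e) *: l_a pre (s ++ z :: y :: t).
Proof.
case=> /= py1 py2 [/= pz1 pz2]; elim: s pre => [|w s IH] pre.
  have E : l_a (rcons (rcons pre y.2) z.2) t =
      (-1) ^+ (d && e) *: l_a (rcons (rcons pre z.2) y.2) t.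
    by rewrite -!cats1 -!catA /= (l_a_comm_pre _ _ _ py2 pz2).
  rewrite /= E (mixed_shift _ _ py1 pz2) (mixed_shift _ _ pz1 py2) [in
    RHS]scalerDr.
  rewrite [in RHS]scalerA andbC -signr_addb addbb scale1r [in RHS]scalerDr.
  by rewrite addrCA.
rewrite !cat_cons /= IH [RHS]scalerDr; congr (_ + _).
rewrite !map_cat /= /mixed !catA scalerDr.
by rewrite !(alt_derived_comm _ _ _ py2 pz2).
Qed.

Lemma alt_br0l f : alt_br 0 f = 0.
Proof. by have := alt_br_linl (-1) 0 0 f;
  rewrite addr0 scaler0 scaleN1r addNr. Qed.

Lemma alt_br0r f : alt_br f 0 = 0.
Proof. by have := alt_br_linr (-1) f 0 0;
  rewrite addr0 scaler0 scaleN1r addNr. Qed.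

Lemma alt_brZl a f h : alt_br (a *: f) h = a *: alt_br f h.
Proof. by have := alt_br_linl a f 0 h; rewrite alt_br0l !addr0. Qed.

Lemma alt_brC p q f h : hpar p f -> hpar q h ->
  alt_br h f = - ((-1) ^+ (p && q) *: alt_br f h).
Proof.
move=> pf ph; apply: alt_inj.
exact: (brC (malt_alt f) (malt_alt h) (hpar_tau pf) (hpar_tau ph)).
Qed.

(** The sign of [alt_tau] turns the antisymmetry of the bracket into graded symmetry for the shifted
    degrees. *)
Lemma l_sm_comm s y z t d e : goodL (d, y) -> goodL (e, z) ->
  l_sm (s ++ y :: z :: t) = (-1) ^+ (d && e) *: l_sm (s ++ z :: y :: t).
Proof.
case=> /= py1 _ [/= pz1 _].
case: s => [|w [|w' s]]; rewrite ?scaler0 //; last by case: s => [|? ?];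
  rewrite /= scaler0.
case: t => [|w t]; rewrite ?scaler0 //=.
rewrite (alt_tau_par py1) (alt_tau_par pz1) !alt_brZl (alt_brC pz1 py1).
by case: d e {py1 pz1} => -[];
  rewrite /= ?expr1 ?expr0 ?scaleN1r ?scale1r ?opprK.
Qed.

Lemma lbr_comm s y z t d e : goodL (d, y) -> goodL (e, z) ->
  lbr (s ++ y :: z :: t) = (-1) ^+ (d && e) *: lbr (s ++ z :: y :: t).
Proof. by move=> gy gz;
  rewrite /lbr (l_a_comm _ _ _ gy gz) (l_sm_comm _ _ gy gz). Qed.

End GradedSymmetry.

Section Degrees.
Variables (k : fieldType) (g : lmodType k) (lam : k).
Implicit Types (f h : alt g) (X pre : seq (alt g)).

Lemma hdeg_br (V : lmodType k) p q (F G : seq V -> V) : malt F -> malt G ->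
  hdeg p F -> hdeg q G -> hdeg (p + q) (br F G).
Proof.
move=> mF mG dF dG.
have dGF c H : hdeg p H -> hdeg (p + q) (circ (wt c G) H).
  by move=> dH; rewrite addrC; apply: hdeg_circ => //;
    [apply: malt_wt|apply: hdeg_wt].
rewrite /br; apply: hdegD; last by apply/hdegN/dGF/hdeg_wt.
by apply: hdegD; [apply: hdeg_circ|apply/hdegN/dGF].
Qed.

Fixpoint degs (m : seq int) X : Prop :=
  match m, X with
  | [::], [::] => True
  | a :: m', f :: X' => hdeg a f /\ degs m' X'
  | _, _ => False
  end.

Lemma degs_cat m n X Y : degs m X -> degs n Y -> degs (m ++ n) (X ++ Y).
Proof. by elim: m X => [|a m IH] [|f X] //= [df dX] dY; split=> //;
  apply: IH. Qed.

Lemma degs_tau m X : degs m X -> degs m (map (@alt_tau k g) X).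
Proof. by elim: m X => [|a m IH] [|f X] //= [df dX]; split;
  [apply: hdeg_wt|apply: IH]. Qed.

Lemma hdeg_alt_derived n m f X : hdeg n f -> degs m X ->
  hdeg (n + \sum_(a <- m) a) (alt_derived lam f X).
Proof.
move=> df dX; rewrite alt_derivedE'; apply: hdeg_pr.
have := @hdeg_ext _ _ lam _ _ df; have := malt_ext lam (malt_alt f).
move: (ext lam f) => A; elim: X m n A dX {df} => [|h X IH] [|a m] n A //=;
  first by rewrite big_nil addr0.
case=> dh dX mA dA; rewrite big_cons addrA; have mh := malt_hat (malt_alt h).
by apply: IH => //; [apply: malt_br|apply: hdeg_br => //; apply: hdeg_hat].
Qed.

Lemma hdeg_mixed n m m' pre f post : hdeg n f -> degs m pre -> degs m' post ->
  hdeg (n + \sum_(a <- m ++ m') a) (mixed lam pre f post).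
Proof.
move=> df dp dq; apply: hdegD; apply: hdeg_alt_derived; try exact: hdeg_wt.
  exact: degs_cat.
by apply: degs_cat => //; apply: degs_tau.
Qed.

Fixpoint homogl (d : seq int) (x : seq (smL g)) : Prop :=
  match d, x with
  | [::], [::] => True
  | a :: d', y :: x' => [/\ hdeg (a + 1) y.1, hdeg a y.2 & homogl d' x']
  | _, _ => False
  end.

Lemma homogl_degs d x : homogl d x -> degs d (map snd x).
Proof. by elim: d x => [|a d IH] [|y x] //= [_ dy hx]; split=> //;
  apply: IH. Qed.

Lemma hdeg_l_a m pre d x : degs m pre -> homogl d x ->
  hdeg (\sum_(a <- m ++ d) a + 1) (l_a lam pre x).
Proof.
elim: x m d pre => [|y x IH] m [|a d] pre //= dp; first by move=> _;
  apply: hdeg0.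
case=> dy1 dy2 hx; apply: hdegD.
  have -> : \sum_(b <- m ++ a :: d) b + 1 = a + 1 + \sum_(b <- m ++ d) b.
    by rewrite !big_cat big_cons /=; lia.
  by apply: hdeg_mixed => //; apply: homogl_degs.
rewrite -cat_rcons; apply: IH => //.
by rewrite -!cats1; apply: degs_cat.
Qed.

Lemma hdeg_l_sm d x : homogl d x -> hdeg (\sum_(a <- d) a + 1 + 1) (l_sm x).
Proof.
case: d x => [|a [|b [|c d]]] [|y [|z [|w x]]] //=; try by move=> _;
  apply: hdeg0.
- by case=> _ _ [].
- case=> dy _ [dz _ _]; rewrite !big_cons big_nil addr0.
  have -> : a + b + 1 + 1 = a + 1 + (b + 1) by lia.
  apply: hdeg_br => //; try exact: malt_alt.
    exact/malt_wt/malt_alt.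
  exact: hdeg_wt.
- by case=> _ _ [].
Qed.

End Degrees.

(** * The generalized Jacobi relation *)

Section Relation.
Variables (k : fieldType) (g : lmodType k) (lam : k).
Local Notation D := (@alt_derived k g lam).
Local Notation mixed := (@mixed k g lam).
Local Notation l_a := (@l_a k g lam).
Local Notation lbr := (@lbr k g lam).
Implicit Types (f h : alt g) (y z : smL g) (x : seq (smL g)) (t :
  seq (bool * smL g)).

(* The left-hand side of the L-infinity[1] relation, the first components of the
   entries of [t] being the parities of the second ones. *)
Definition jac t : smL g :=
  unshuffle fst t (fun u v => lbr (lbr (map snd u) :: map snd v)).

Lemma lbrD (s : seq (smL g)) a b (t : seq (smL g)) : lbr (s ++ (a + b) :: t) =
  lbr (s ++ a :: t) + lbr (s ++ b :: t).
Proof. by have := @lbr_multilinear k g lam s t 1 a b; rewrite !scale1r. Qed.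

Lemma lbr0 (s t : seq (smL g)) : lbr (s ++ 0 :: t) = 0.
Proof. by apply: (addrI (lbr (s ++ 0 :: t))); rewrite -lbrD !addr0. Qed.

Lemma lbrZ (s : seq (smL g)) c a (t : seq (smL g)) : lbr (s ++ (c *: a) :: t) =
  c *: lbr (s ++ a :: t).
Proof. by have := @lbr_multilinear k g lam s t c a 0; rewrite lbr0 !addr0. Qed.

Lemma jacD s d a b t :
  jac (s ++ (d, a + b) :: t) = jac (s ++ (d, a) :: t) + jac (s ++ (d, b) :: t).
Proof.
apply: unshuffle_additive => // [u1 u2 v|u v1 v2]; rewrite !map_cat /=.
  by rewrite lbrD (lbrD [::]).
by rewrite -!cat_cons lbrD.
Qed.

Lemma jac_comm s a b t : allp (@goodL k g) (s ++ a :: b :: t) ->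
  jac (s ++ a :: b :: t) = (-1) ^+ (a.1 && b.1) *: jac (s ++ b :: a :: t).
Proof.
move=> gt; apply: (unshuffle_adjacent gt) => [u1 u2 v gu _|u v1 v2 _ gv];
  rewrite !map_cat /=.
  have /allp_cat[_ /= [ga [gb _]]] := gu.
  by rewrite (@lbr_comm _ _ _ _ _ _ _ a.1 b.1) -?surjective_pairing // (lbrZ
    [::]).
have /allp_cat[_ /= [ga [gb _]]] := gv.
by rewrite -!cat_cons (@lbr_comm _ _ _ _ _ _ _ a.1 b.1) -?surjective_pairing.
Qed.

Lemma mixed0m pre post : mixed pre 0 post = 0.
Proof. by have := mixed_linm lam pre (-1) 0 0 post;
  rewrite addr0 scaler0 scaleN1r addNr. Qed.

Lemma mixed0l p q f post : mixed (p ++ 0 :: q) f post = 0.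
Proof. by have := mixed_linl lam p q (-1) 0 0 f post;
  rewrite addr0 scaler0 scaleN1r addNr. Qed.

Lemma mixed0r pre f p q : mixed pre f (p ++ 0 :: q) = 0.
Proof. by have := mixed_linr lam pre f p q (-1) 0 0;
  rewrite addr0 scaler0 scaleN1r addNr. Qed.

Lemma mixed_nil f post : mixed [::] f post = D f post.
Proof.
rewrite /mixed /= -[D _ _]scale1r -alt_derived_linl scale1r; congr (D _ _).
by apply: alt_inj; rewrite /= -[RHS]evD_od addrC.
Qed.

Lemma l_a0 p q x : l_a (p ++ 0 :: q) x = 0.
Proof. by elim: x q => //= y x IH q; rewrite mixed0l rcons_cat /= IH addr0. Qed.

Lemma l_a_two pre s1 y s2 z s3 : y.2 = 0 -> z.2 = 0 ->
  l_a pre (s1 ++ y :: s2 ++ z :: s3) = 0.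
Proof.
move=> y0 z0; elim: s1 pre => [|w s1 IH] pre /=.
  by rewrite map_cat /= z0 mixed0r y0 -cats1 l_a0 addr0.
by rewrite IH !map_cat /= y0 mixed0r addr0.
Qed.

Lemma lbr_many s1 y s2 z s3 : y.2 = 0 -> z.2 = 0 ->
  size (s1 ++ y :: s2 ++ z :: s3) != 2%N -> lbr (s1 ++ y :: s2 ++ z :: s3) = 0.
Proof.
move=> y0 z0 sz; rewrite /lbr l_a_two //; congr (_, _).
by case: (_ ++ _) sz => [|a [|b [|c r]]].
Qed.

Lemma l_a_all_a pre x : allp (fun y : smL g => y.1 = 0) x -> l_a pre x = 0.
Proof. by elim: x pre => //= y x IH pre [-> /IH ->]; rewrite mixed0m addr0. Qed.

Lemma lbr_all_a x : allp (fun y : smL g => y.1 = 0) x -> lbr x = 0.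
Proof.
move=> ax; rewrite /lbr l_a_all_a //; congr (_, _).
by case: x ax => [|a [|b [|c r]]] //= [_ [-> _]]; apply: alt_br0r.
Qed.

Lemma lbr_sm_a f x : allp (fun y : smL g => y.1 = 0) x ->
  lbr (in_sm f :: x) = in_a (D f (map snd x)).
Proof.
move=> ax; rewrite /lbr /= l_a_all_a // addr0 mixed_nil; congr (_, _).
by case: x ax => [|b [|c r]] //= [-> _]; apply: alt_br0r.
Qed.

Lemma lbr_a_sm_a K f x : allp (fun y : smL g => y.1 = 0) x ->
  lbr (in_a K :: in_sm f :: x) = in_a (mixed [:: K] f (map snd x)).
Proof.
move=> ax; rewrite /lbr /= l_a_all_a // addr0 mixed0m add0r; congr (_, _).
case: x ax => [|b x] //= _.
have -> : alt_tau (0 : alt g) = 0 by apply: alt_inj; apply/funext => s;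
  apply: scaler0.
exact: alt_br0l.
Qed.

Lemma lbr_sm_sm f h : lbr [:: in_sm f; in_sm h] = in_sm (alt_br (alt_tau f) h).
Proof. by congr (_, _); apply: (@l_a_two _ [::] _ [::] _ [::]). Qed.

Lemma voronov_alt p q f h t : hpar p f -> hpar q h -> allp (@goodL k g) t ->
  D (alt_br f h) (map (fun e => e.2.2) t) =
  unshuffle fst t (fun u v => D f (D h (map (fun e =>
    e.2.2) u) :: map (fun e => e.2.2) v))
  - (-1) ^+ (p && q) *:
    unshuffle fst t (fun u v => D h (D f (map (fun e =>
      e.2.2) u) :: map (fun e => e.2.2) v)).
Proof.
move=> pf ph gt; apply: alt_inj.
rewrite alt_derivedE -map_comp.
pose c (e : bool * smL g) := (e.1, alt_fun e.2.2).
have E (u : seq (bool * smL g)) : map (@alt_fun k g) (map (fun e => e.2.2) u) =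
  map snd (map c u).
  by rewrite -!map_comp.
have gct : allp (@good k g) (map c t).
  elim: t gt => //= y t IH [[_ gy] gt]; split; last exact: IH.
  by split; [exact: malt_alt|exact: hpar_tau].
have := voronov lam (malt_alt f) (malt_alt h) (hpar_tau pf) (hpar_tau ph) gct.
rewrite !unshuffle_map -map_comp => ->.
have vS G : (unshuffle fst t G : alt g) = unshuffle fst t (fun u v =>
  alt_fun (G u v)) :> (seq g -> g).
  exact: (@unshuffle_linear _ _ _ _ _ (@alt_fun k g)).
set S1 := unshuffle fst t (fun u v => D f _);
  set S2 := unshuffle fst t (fun u v => D h _).
rewrite -[RHS]/(alt_fun S1 - (-1) ^+ (p && q) *: alt_fun S2) /S1 /S2 !vS.
congr (_ - _ *: _); apply: eq_unshuffle => u v;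
  by rewrite alt_derivedE map_cons alt_derivedE !E.
Qed.

Definition good_sm (t : bool * smL g) := goodL t /\ t.2.2 = 0.
Definition good_a (t : bool * smL g) := goodL t /\ t.2.1 = 0.

Lemma good_a_1 t : allp good_a t -> allp (fun y : smL g => y.1 = 0) (map snd t).
Proof. by elim: t => //= a t IH [[_ a0] /IH]. Qed.

Lemma good_a_good t : allp good_a t -> allp (@goodL k g) t.
Proof. by elim: t => //= a t IH [[ga _] /IH]. Qed.

Lemma good_sm_good t : allp good_sm t -> allp (@goodL k g) t.
Proof. by elim: t => //= a t IH [[ga _] /IH]. Qed.

(** Two of the three arguments in [sm] share a bracket. If it is the inner one and has no other
    argument, its value lies in [sm] and meets the third in an outer bracket of length at least 3,
    since [t] is nonempty. *)
Lemma jac_many (a b c : bool * smL g) t : a.2.2 = 0 -> b.2.2 = 0 -> c.2.2 =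
  0 -> t != [::] ->
  jac (a :: b :: c :: t) = 0.
Proof.
move=> a0 b0 c0 t0.
have big (y1 y2 y3 : bool * smL g) (u v : seq (bool * smL g)) : y1.2.2 = 0 ->
  y2.2.2 = 0 -> y3.2.2 = 0 ->
    (size u + size v = size t)%N ->
    lbr (lbr (y1.2 :: y2.2 :: map snd u) :: y3.2 :: map snd v) = 0.
  move=> e1 e2 e3; case: u => [|w u] uv.
    rewrite -[y1.2]/(y1.2) (surjective_pairing y1.2) (surjective_pairing y2.2)
      e1 e2.
    rewrite -!/(in_sm _) lbr_sm_sm; apply: (@lbr_many [::] _ [::]) => //=.
    by rewrite size_map !eqSS -[size v]add0n uv size_eq0.
  by rewrite (@lbr_many [::] _ [::] _ (map snd (w :: u))) // (lbr0 [::]).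
have two (y1 y2 : bool * smL g) z u : y1.2.2 = 0 -> y2.2.2 = 0 ->
    lbr (z :: y1.2 :: y2.2 :: u) = 0.
  by move=> e1 e2; apply: (@lbr_many [:: z] _ [::]).
have three (y1 y2 y3 : bool * smL g) u x : y1.2.2 = 0 -> y2.2.2 = 0 ->
    lbr (lbr (y1.2 :: y2.2 :: y3.2 :: u) :: x) = 0.
  by move=> e1 e2; rewrite (@lbr_many [::] _ [::]) // (lbr0 [::]).
have add0 (y z : smL g) : y = 0 -> z = 0 -> y + z = 0 by move=> -> ->;
  rewrite addr0.
rewrite /jac /=; repeat refine (add0 _ _ _ _);
  refine (@unshuffle_size0 _ _ _ _ _ _ _) => u v uv /=.
all: try by rewrite two ?scaler0.
- exact: three.
- by refine (eq_trans (congr1 _ (big a b c u v a0 b0 c0 uv)) (scaler0 _ _)).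
- by refine (eq_trans (congr1 _ (big a c b u v a0 c0 b0 uv)) (scaler0 _ _)).
- by refine (eq_trans (congr1 _ (big b c a u v b0 c0 a0 uv)) (scaler0 _ _)).
Qed.

Lemma alt_br_jacobi p q r f h (e : alt g) : hpar p f -> hpar q h -> hpar r e ->
  alt_br (alt_br f h) e = - ((-1) ^+ (p && (q (+) r)) *: alt_br (alt_br h e) f)
    + (-1) ^+ (q && r) *: alt_br (alt_br f e) h.
Proof.
move=> /hpar_tau pf /hpar_tau ph /hpar_tau pe.
have [[mf mh] me] := (malt_alt f, malt_alt h, malt_alt e).
apply: alt_inj; rewrite -[RHS]/(- ((-1) ^+ (p && (q (+) r)) *: br (br h e) f) +
  (-1) ^+ (q && r) *: br (br f e) h).
rewrite !alt_brE (br_jacobi mf mh me pf ph pe); congr (_ + _).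
by rewrite (brC (malt_br mh me) mf (par_br mh me ph pe) pf) andbC.
Qed.

Lemma in_smZ a f : in_sm (a *: f) = a *: in_sm f.
Proof. by congr (_, _); rewrite /= scaler0. Qed.

Lemma in_aZ a f : in_a (a *: f) = a *: in_a f.
Proof. by congr (_, _); rewrite /= scaler0. Qed.

Lemma lbr_sm3 p q f h (e : alt g) : hpar (~~ p) f -> hpar (~~ q) h ->
  lbr [:: lbr [:: in_sm f; in_sm h]; in_sm e] =
  (-1) ^+ (~~ q) *: in_sm (alt_br (alt_br f h) e).
Proof.
move=> pf ph; rewrite !lbr_sm_sm -in_smZ (alt_tau_par pf) alt_brZl.
have tZ a u : alt_tau (a *: u) = a *: alt_tau u :> alt g.
  have := alt_wt_lin (fun n => (-1) ^+ n.+1) a u 0.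
  by rewrite -/(alt_tau _) => E; apply: alt_inj; rewrite /= -/(tau _) tauZ.
have tbr : alt_tau (alt_br f h) = (-1) ^+ (p (+) q) *: alt_br f h.
  apply: alt_inj; have := par_br (malt_alt f) (malt_alt h) (hpar_tau pf)
    (hpar_tau ph).
  by rewrite addNb addbN negbK.
rewrite tZ tbr !alt_brZl scalerA -signr_addb; congr (in_sm (_ ^+ _ *: _)).
by case: p q {pf ph tbr} => -[].
Qed.

Lemma jac_sm3 (a b c : bool * smL g) : allp good_sm [:: a; b; c] -> jac [:: a;
  b; c] = 0.
Proof.
case: a b c => [p [f f']] [q [h h']] [r [e e']] [[[/= pf _] /= ->] [[[/= ph _]
  /= ->] [[[/= pe _] /= ->] _]]].
rewrite /jac /= !addbF -![(_, 0)]/(in_sm _) !andbF !scale1r.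
rewrite (@lbr_many [::] _ [::] _ [:: _]) // (lbr0 [::] [::]).
have two u v y : lbr [:: y; in_sm u;
  in_sm v] = 0 by apply: (@lbr_many [:: y] _ [::] _ [::]).
have tre u v w y : lbr [:: y; in_sm u; in_sm v;
  in_sm w] = 0 by apply: (@lbr_many [:: y] _ [::] _ [:: _]).
rewrite !two !tre !scaler0 (lbr_sm3 _ pf ph) (lbr_sm3 _ pf pe) (lbr_sm3 _ ph
  pe).
rewrite (alt_br_jacobi pf ph pe) -!in_smZ.
have smD u v : in_sm u + in_sm v = in_sm (u + v) by congr (_, _);
  rewrite /= addr0.
rewrite -[0 in RHS]/(in_sm 0) ?addr0 ?add0r !smD; congr in_sm.
by case: p q r {pf ph pe} => -[] [];
  rewrite /= ?expr1 ?expr0 ?scaleN1r ?scale1r; zmod.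
Qed.

Lemma jac_sm0 t : allp good_a t -> jac t = 0.
Proof.
move=> ga; rewrite /jac (@eq_unshuffle_in _ _ _ _ _ _ _ (fun _ _ =>
  0) ga) ?unshuffle0 // => u v gu gv.
by rewrite (lbr_all_a (good_a_1 gu)) (lbr0 [::]).
Qed.

(** An inner bracket using the argument of [sm] has its value in [a], leaving the outer bracket
    without any; an inner bracket not using it is zero. *)
Lemma jac_sm1 (a : bool * smL g) t : good_sm a -> allp good_a t ->
  jac (a :: t) = 0.
Proof.
case: a => [p [f f']] [_ /= ->] ga; rewrite /jac /= -![(f, 0)]/(in_sm f).
rewrite (@eq_unshuffle_in _ _ _ _ _ _ _ (fun _ _ => 0) ga) ?unshuffle0 =>
  [|u v gu gv]; last first.
  by rewrite (lbr_sm_a _ (good_a_1 gu)) lbr_all_a //=; split=> //;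
    exact: good_a_1.
rewrite (@eq_unshuffle_in _ _ _ _ _ _ _ (fun _ _ =>
  0) ga) ?unshuffle0 ?addr0 // => u v gu gv.
by rewrite (lbr_all_a (good_a_1 gu)) (lbr0 [::]) scaler0.
Qed.

Lemma par_derived p f t : hpar p f -> allp (@goodL k g) t ->
  par (p (+) parl fst t) (D f (map (fun e => e.2.2) t)).
Proof.
move=> pf gt; pose c (e : bool * smL g) := (e.1, alt_fun e.2.2).
have gct : allp (@good k g) (map c t).
  elim: t gt => //= y t IH [[_ gy] gt]; split; last exact: IH.
  by split; [exact: malt_alt|exact: hpar_tau].
have := par_pr (par_bhat (malt_ext lam (malt_alt f)) (par_ext lam (hpar_tau
  pf)) gct).
rewrite /bhat -map_comp alt_derivedE' -map_comp.
by have -> : parl fst (map c t) = parl fst t by elim: (t) => //= e s ->.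
Qed.

Lemma jac_sm2 (a b : bool * smL g) t : allp good_sm [:: a;
  b] -> allp good_a t ->
  jac [:: a, b & t] = 0.
Proof.
case: a b => [p [f f']] [q [h h']] [[[/= pf _] /= ->] [[[/= ph _] /= ->] _]] ga.
rewrite /jac /= -![(_, 0)]/(in_sm _).
have gL := good_a_good ga.
have snd2 (u : seq (bool * smL g)) : map snd (map snd u) = map (fun e =>
  e.2.2) u by rewrite -map_comp.
have in_a_lin (c : k) (u v : alt g) : in_a (c *: u + v) = c *: in_a u + in_a v.
  by congr (_, _); rewrite /= scaler0 addr0.
(* With both arguments of [sm] in the inner bracket only the splitting with empty [u] survives. *)
rewrite [X in X + _ + _](_ : _ = in_a (D (alt_br (alt_tau f) h) (map (fun e =>
  e.2.2) t))); last first.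
  rewrite -snd2 -lbr_sm_a; last exact: good_a_1.
  rewrite -lbr_sm_sm -(unshuffle_nil fst t (fun u v => lbr (lbr [:: in_sm f,
    in_sm h & map snd u] :: map snd v))).
  apply: eq_unshuffle => -[|w u] v //.
  by rewrite (@lbr_many [::] _ [::] _ (map snd (w :: u))) // (lbr0 [::]).
have term r s (f1 f2 : alt g) (u v : seq (bool * smL g)) : hpar (~~ r) f1 ->
  hpar (~~ s) f2 ->
    allp good_a u -> allp good_a v ->
    lbr [:: lbr (in_sm f1 :: map snd u), in_sm f2 & map snd v] =
    (-1) ^+ (s && (~~ r (+) parl fst u)) *:
      in_a (D f2 (D f1 (map (fun e => e.2.2) u) :: map (fun e => e.2.2) v)).
  move=> pf1 pf2 gu gv;
    rewrite (lbr_sm_a _ (good_a_1 gu)) (lbr_a_sm_a _ _ (good_a_1 gv)) !snd2.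
  rewrite (mixedE _ _ _ pf2); case: s {pf2} => /=; rewrite ?scale1r //.
  have pK := par_derived pf1 (good_a_good gu).
  have -> : alt_tau (D f1 (map (fun e => e.2.2) u)) =
      (-1) ^+ (~~ r (+) parl fst u) *: D f1 (map (fun e =>
        e.2.2) u) by exact: alt_inj.
  by rewrite (@alt_derivedZr k g lam _ _ [::]) in_aZ.
pose S1 := unshuffle fst t (fun u v => D f (D h (map (fun e =>
  e.2.2) u) :: map (fun e => e.2.2) v)).
pose S2 := unshuffle fst t (fun u v => D h (D f (map (fun e =>
  e.2.2) u) :: map (fun e => e.2.2) v)).
rewrite [X in _ + X + _](_ : _ = (-1) ^+ (q && ~~ p) *: in_a S2); last first.
  rewrite (unshuffle_linear _ _ _ in_a_lin) -unshuffleZ;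
    apply: (@eq_unshuffle_in _ _ _ _ good_a _ _ _ ga) => u v gu gv.
  rewrite (term p q) // scalerA -signr_addb; congr (_ ^+ _ *: _).
  by case: q {ph}; case: (parl fst u); case: p {pf}.
rewrite [X in _ + (X + _)](_ : _ = (-1) ^+ p *: in_a S1); last first.
  rewrite (unshuffle_linear _ _ _ in_a_lin) -unshuffleZ;
    apply: (@eq_unshuffle_in _ _ _ _ good_a _ _ _ ga) => u v gu gv.
  rewrite (term q p) // scalerA -signr_addb; congr (_ ^+ _ *: _).
  by case: q {ph}; case: (parl fst u); case: p {pf}.
(* Both arguments of [sm] outside: the inner bracket has arguments in [a] only. *)
rewrite [X in _ + (_ + X)](_ : _ = 0); last first.
  rewrite (@eq_unshuffle_in _ _ _ _ good_a _ _ (fun _ _ =>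
    0) ga) ?unshuffle0 // => u v gu gv.
  by rewrite (lbr_all_a (good_a_1 gu)) (lbr0 [::]) !scaler0.
rewrite (alt_tau_par pf) alt_brZl alt_derivedZl (voronov_alt pf ph gL) -/S1
  -/S2 in_aZ.
rewrite [S1 - _]addrC -scaleNr in_a_lin.
by clearbody S1 S2; case: p q {pf ph term} => -[];
  rewrite /= ?expr1 ?expr0 ?opprK ?scaleN1r ?scale1r; zmod.
Qed.

Lemma jac_sorted s t : allp good_sm s -> allp good_a t -> jac (s ++ t) = 0.
Proof.
case: s => [|a [|b [|c s]]] gs gt.
- exact: jac_sm0.
- by case: gs => ga _; apply: jac_sm1.
- exact: jac_sm2.
- case: gs => -[ga a0] [[gb b0] [[gc c0] gs]].
  have [st|/eqP st] := eqVneq (size (s ++ t)) 0%N; last first.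
    by rewrite /= jac_many //; case: (s ++ t) st.
  by rewrite /= (size0nil st); apply: jac_sm3.
Qed.

(** Only the existence of the scalar matters, as it will multiply zero. *)
Lemma jac_front s t a r : allp (@goodL k g) (s ++ t ++ a :: r) ->
  exists c : k, jac (s ++ t ++ a :: r) = c *: jac (s ++ a :: t ++ r).
Proof.
elim: t s => [|b t IH] s; first by exists 1; rewrite scale1r.
rewrite cat_cons -cat_rcons => ga; have [c Ec] := IH _ ga.
have gb : allp (@goodL k g) (s ++ b :: a :: t ++ r).
  move: ga => /allp_cat[gsb /allp_cat[gt [gaa gr]]].
  move: gsb; rewrite -cats1 => /allp_cat[gs [gb _]].
  by apply/allp_cat; split=> //; split=> //; split=> //; apply/allp_cat.
exists (c * (-1) ^+ (b.1 && a.1)).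
by rewrite Ec cat_rcons jac_comm // scalerA.
Qed.

Lemma jac_eq0 t : allp (@goodL k g) t -> jac t = 0.
Proof.
(* The list [r] is yet to be sorted. Its head splits into a component in [a], which extends [u], and
   one in [sm], which is moved across [u] to extend [s]. *)
suff H r s u : allp good_sm s -> allp good_a u -> allp (@goodL k g) r ->
  jac (s ++ u ++ r) = 0.
  exact: (H t [::] [::]).
elim: r s u => [|[d [f xi]] r IH] s u gs gu; first by rewrite cats0 => _;
  apply: jac_sorted.
case=> -[/= pf px] gr.
have -> : (f, xi) = in_sm f + in_a xi by congr (_, _); rewrite /= ?addr0 ?add0r.
have g1 : good_sm (d, in_sm f) by split=> //; split=> //; apply: hpar0.
have g2 : good_a (d, in_a xi) by split=> //; split=> //; apply: hpar0.
rewrite catA jacD -!catA -[X in _ + jac (_ ++ X)]cat_rcons (IH s (rcons u _))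
  //; last first.
  by rewrite -cats1; apply/allp_cat.
have [|c ->] := @jac_front s u (d, in_sm f) r.
  apply/allp_cat; split; first exact: good_sm_good.
  by apply/allp_cat; split; [exact: good_a_good|split=> //; case: g1].
rewrite -cat_rcons IH ?scaler0 ?addr0 //.
by rewrite -cats1; apply/allp_cat.
Qed.

End Relation.

(** * Koszul signs of permutations *)

Section KoszulSigns.
Variable k : fieldType.

Definition word N (s : 'S_N) : seq nat := [seq (s i : nat) | i <- enum 'I_N].

Lemma size_word N (s : 'S_N) : size (word s) = N.
Proof. by rewrite size_map size_enum_ord. Qed.

Lemma nth_word N (s : 'S_N) (i : 'I_N) : nth 0%N (word s) i = s i.
Proof. by rewrite (nth_map i) ?size_enum_ord // nth_ord_enum. Qed.

Lemma word_lift_perm N (i : 'I_N.+1) (s : 'S_N) :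
  word (lift_perm i ord0 s) = ins i 0%N (map succn (word s)).
Proof.
rewrite /word (map_enum_lift _ i) lift_perm_id /ins -map_comp.
by congr (take _ _ ++ _ :: drop _ _); apply: eq_map => j;
  rewrite lift_perm_lift.
Qed.

Lemma permuteE (V : nmodType) (x : seq V) (s : 'S_(size x)) :
  permute s = [seq x`_j | j <- word s].
Proof. by rewrite /permute /word -map_comp. Qed.

Lemma lift_perm_surj N (s : 'S_N.+1) : exists i (s' : 'S_N),
  s = lift_perm i ord0 s'.
Proof.
(* Surjectivity by counting: the indicator of [s] has sum 1, so it cannot vanish on every
   [lift_perm i ord0 s']. *)
have := big_perm_lift (M := nat) (fun t => (t == s) : nat).
rewrite (bigD1 s) //= eqxx big1 ?addr0 => [E|t /negPf -> //].
have [/existsP[i /existsP[s' /eqP <-]]|] := boolP [exists i, exists s' : 'S_N,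
  lift_perm i ord0 s' == s].
  by exists i, s'.
move=> /existsPn H; move: E; rewrite big1 // => i _; rewrite big1 // => s' _.
by have /existsPn/(_ s')/negPf -> := H i.
Qed.

Definition zpar (d : seq int) (j : nat) : bool := ipar d`_j.

(** The inversions involving the value [0] pair it with exactly the entries standing before it in
    the word. *)
Lemma koszul_sign_lift N a d (i : 'I_N.+1) (s : 'S_N) :
  koszul_sign k (a :: d) (lift_perm i ord0 s) =
  (-1) ^+ (ipar a && parl (zpar d) (take i (word s))) * koszul_sign k d s.
Proof.
rewrite /koszul_sign (bigD1_ord i) //= big1 ?mul1r; last first.
  by move=> j /andP[_]; rewrite lift_perm_id ltn0.
under eq_bigr => p _.
  rewrite big_mkcond (bigD1_ord i) //= lift_perm_id lift_perm_lift /=.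
  over.
rewrite big_split /=; congr (_ * _); last first.
  apply: eq_bigr => p _; rewrite [RHS]big_mkcond; apply: eq_bigr => q _ /=.
  rewrite lift_perm_lift.
  by rewrite (_ : (bump i p < bump i q)%N = (p < q)%N) //; rewrite /bump; lia.
have -> : (-1 : k) ^+ (ipar a && parl (zpar d) (take i (word s))) =
    \prod_(j <- take i (word s)) (-1) ^+ (ipar a && zpar d j).
  elim: (take _ _) => [|j w IH]; first by rewrite big_nil andbF.
  by rewrite big_cons -IH -signr_addb /=; case: (ipar a).
rewrite (big_nth 0%N) size_takel ?size_word ?leq_ord // big_mkord.
rewrite (big_ord_widen N (fun p =>
  (-1) ^+ (ipar a && zpar d (nth 0%N (take i (word s)) p)))) ?leq_ord //.
rewrite [RHS]big_mkcond; apply: eq_bigr => p _.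
rewrite (_ : (bump i p < i)%N = (p < i)%N); last by rewrite /bump; lia.
rewrite andbT; case: ifP => // lt_pi;
  rewrite nth_take // nth_word signz iparM andbC.
by [].
Qed.

Lemma koszul_sign0 d (s : 'S_0) : koszul_sign k d s = 1.
Proof. by rewrite /koszul_sign big_ord0. Qed.

Lemma map_succ_iota N : iota 0 N.+1 = 0%N :: map succn (iota 0 N).
Proof. by rewrite /= -[1%N]addn0 iotaDl. Qed.

Lemma parl_succ a d w : parl (zpar (a :: d)) (map succn w) = parl (zpar d) w.
Proof. by elim: w => //= j w ->. Qed.

Section Symmetry.
Variable M : lmodType k.

Lemma move_front d (Phi : seq nat -> M) a u v :
  (forall s x y t, Phi (s ++ x :: y :: t) =
    (-1) ^+ (zpar d x && zpar d y) *: Phi (s ++ y :: x :: t)) ->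
  Phi (u ++ a :: v) = (-1) ^+ (zpar d a && parl (zpar d) u) *: Phi (a :: u ++
    v).
Proof.
move=> sw; have H s : Phi (s ++ u ++ a :: v) =
    (-1) ^+ (zpar d a && parl (zpar d) u) *: Phi (s ++ a :: u ++ v).
  elim: u s => [|x u IH] s; first by rewrite andbF scale1r.
  rewrite cat_cons -cat_rcons IH cat_rcons sw scalerA -signr_addb /=.
  by congr (_ ^+ _ *: _); case: (zpar d a); case: (zpar d x); case: (parl _ u).
exact: (H [::]).
Qed.

Lemma koszul_sym N d (Phi : seq nat -> M) (s : 'S_N) :
  (forall s x y t, Phi (s ++ x :: y :: t) =
    (-1) ^+ (zpar d x && zpar d y) *: Phi (s ++ y :: x :: t)) ->
  Phi (word s) = koszul_sign k d s *: Phi (iota 0 N).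
Proof.
elim: N d Phi s => [|N IH] d Phi s sw.
  by rewrite koszul_sign0 scale1r; congr Phi; apply: size0nil;
    rewrite size_word.
have [i [s' ->]] := lift_perm_surj s.
(* The list [d] may be empty; padding it with the default [0] changes none of its entries. *)
have dE j : zpar d j = zpar (d`_0 :: behead d) j by rewrite /zpar;
  case: (d) j => [|? ?] [|?]; rewrite /= ?nth_nil.
have parE w : parl (zpar d) w = parl (zpar (d`_0 :: behead d)) w by elim: w =>
  //= j w ->; rewrite dE.
have kE (t : 'S_N.+1) : koszul_sign k d t = koszul_sign k (d`_0 :: behead d) t.
  apply: eq_bigr => p _; apply: eq_bigr => q _.
  have nE j : d`_j = (d`_0 :: behead d)`_j by case: (d) j => [|? ?] [|?];
    rewrite /= ?nth_nil.
  by rewrite -!nE.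
rewrite kE koszul_sign_lift word_lift_perm (move_front _ _ _ sw) parE.
rewrite -map_take parl_succ -scalerA; congr (_ *: _).
rewrite -map_drop -map_cat cat_take_drop map_succ_iota.
apply: (IH (behead d) (fun w => Phi (0%N :: map succn w))) => r x y t.
rewrite !map_cat /= -!cat_cons sw; congr (_ ^+ _ *: _).
by rewrite !dE.
Qed.

(** The value [0] opens one of the two blocks of a shuffle, which matches the two branches of
    [unshuffle]; the test on sizes selects the prescribed block lengths. *)
Lemma koszul_unshuffle N d (G : seq nat -> seq nat -> M) (i j : int) : size d =
  N ->
  \sum_(s in Sh N [:: i; j])
    koszul_sign k d s *: G (take `|i| (word s)) (drop `|i| (word s)) =
  unshuffle (zpar d) (iota 0 N)
    (fun u v => if ((size u)%:Z == i) && ((size v)%:Z == j) then G u v else 0).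
Proof.
elim: N d G i j => [|N IH] [|a d] G i j // sd.
  rewrite big_Sh0 /= andbT eq_sym [0 == j]eq_sym; case: ifP => // _.
  by rewrite koszul_sign0 scale1r (size0nil (size_word 1%g)) take_oversize //
    drop_oversize.
case: sd => sd; rewrite big_Sh_recl map_succ_iota [RHS]/= !unshuffle_map.
rewrite big_ord_recl big_ord1; congr (_ + _).
  transitivity (\sum_(s in Sh N [:: i - 1; j]) koszul_sign k d s *:
    G (0%N :: map succn (take `|i - 1|%N (word s))) (map succn (drop `|i - 1|%N
      (word s)))).
    apply: eq_bigr => s /mem_Sh[/= /andP[i0 _] _ _].
    have -> : inord (offset [:: i; j] (ord0 : 'I_2)) = ord0 :> 'I_N.+1.
      by apply: ord_inj; rewrite inordK.
    rewrite koszul_sign_lift word_lift_perm /ins /= !take0 drop0 /= andbF mul1r.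
    have -> : absz i = (absz (i - 1)%R).+1 by lia.
    by rewrite /= map_take map_drop.
  rewrite (IH d (fun u v => G (0%N :: map succn u) (map succn v))) //.
  apply: eq_unshuffle => u v; rewrite /= !size_map.
  by have -> : ((size u)%:Z == i - 1) = ((size u).+1%:Z == i) by lia.
transitivity (\sum_(s in Sh N [:: i; j - 1]) koszul_sign k d s *:
  ((-1) ^+ (ipar a && parl (zpar d) (take `|i| (word s))) *:
   G (map succn (take `|i| (word s))) (0%N :: map succn (drop `|i| (word s))))).
  apply: eq_bigr => s /mem_Sh[_ /= sN _].
  have oE : offset [:: i;
    j] (lift (ord0 : 'I_2) (ord0 : 'I_1)) = absz i by rewrite /offset /= addn0.
  have le_i : (absz i <= N)%N by rewrite -sN leq_addr.
  rewrite oE koszul_sign_lift word_lift_perm inordK ?ltnS // /ins.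
  have sz : size (take `|i| (map succn (word s))) = `|i|%N.
    by rewrite size_takel // (size_map succn) size_word.
  rewrite (take_size_cat _ sz) (drop_size_cat _ sz).
  by rewrite map_take map_drop scalerA mulrC.
apply: etrans (IH d (fun u v => (-1) ^+ (ipar a && parl (zpar d) u) *:
  G (map succn u) (0%N :: map succn v)) i (j - 1) sd) _.
apply: eq_unshuffle => u v; rewrite /= !size_map parl_succ.
have -> : ((size v)%:Z == j - 1) = ((size v).+1%:Z == j) by lia.
by case: ifP; rewrite ?scaler0.
Qed.

End Symmetry.

End KoszulSigns.

(** * Gradings and explicit formulas *)

Section Grading.
Variables (k : fieldType) (g : lmodType k).
Implicit Types f : alt g.

Lemma app_alt_sum I r (F : I -> alt g) (s : seq g) :
  (\sum_(i <- r) F i : alt g) s = \sum_(i <- r) F i s.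
Proof. by rewrite (big_morph (fun f : alt g =>
  f s) (id1 := 0) (op1 := +%R)). Qed.

Definition component (n : int) f := alt_wt (fun N => (N%:Z == n + 1)%:R) f.

Lemma component_deg n f : alt_deg n (component n f).
Proof.
move=> s; have [//|ne] := eqVneq (size s)%:Z (n + 1).
by rewrite /= /wt (negPf ne) scale0r eqxx.
Qed.

(** The offset [c] accounts for the shift: 1 on [sm] and 0 on [a]. *)
Lemma component_sum c (ds : seq int) f B : vanish_from B f -> uniq ds ->
  (forall N, (N < B)%N -> N%:Z - 1 - c \in ds) ->
  f = \sum_(d <- ds) component (d + c) f.
Proof.
move=> bf uds dsP; apply: alt_inj; apply/funext => s; rewrite app_alt_sum.
rewrite [RHS](eq_bigr (fun d => if d == (size s)%:Z - 1 - c then f s else 0));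
  last first.
  move=> d _; rewrite /= /wt (_ : (_ == d + c + 1) =
    (d == (size s)%:Z - 1 - c)); last by lia.
  by case: eqP => _; rewrite ?scale0r ?scale1r.
rewrite -big_mkcond /=; have [lt_sB|le_Bs] := ltnP (size s) B; last first.
  by rewrite bf // big1.
by rewrite -big_filter filter_pred1_uniq ?dsP // big_seq1.
Qed.

Lemma smL_grading : is_grading (@smL_deg k g).
Proof.
split.
- move=> d; split; first by split=> x; rewrite eqxx.
  move=> a u v [du1 du2] [dv1 dv2].
  by split; apply: hdegD => //; apply: hdegZ.
- case=> f xi; have [[A bf] [B bxi]] := (bounded_alt f, bounded_alt xi).
  (* Degrees start at -2: a constant has degree -1 in [m], hence -2 after the shift. *)
  exists [seq j%:Z - 2 | j <- iota 0 (maxn A B).+2],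
    (fun d => (component (d + 1) f, component d xi)).
  split; first by move=> d; split; apply: component_deg.
  have uds : uniq [seq j%:Z - 2 | j <- iota 0 (maxn A B).+2].
    by rewrite map_inj_uniq ?iota_uniq // => i j; lia.
  have pair_sum (r : seq int) F G : \sum_(d <- r) (F d,
    G d) = (\sum_(d <- r) F d, \sum_(d <- r) G d) :> smL g.
    by elim: r => [|d r IH]; rewrite ?big_nil // !big_cons IH.
  rewrite pair_sum -(component_sum bf uds); last first.
    move=> N lt_N; apply/mapP; exists N; last by lia.
    by rewrite mem_iota /= add0n; lia.
  rewrite (_ : \sum_(d <- _) component d xi = xi) //.
  rewrite {2}(@component_sum 0 _ xi B bxi uds).
    by apply: eq_bigr => d _; rewrite addr0.
  move=> N lt_N; apply/mapP; exists N.+1; last by lia.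
  by rewrite mem_iota /= add0n; lia.
- move=> ds y uds dy y0 d dds.
  have main c (Y : int -> alt g) : (forall e,
    alt_deg (e + c) (Y e)) -> \sum_(e <- ds) Y e = 0 -> Y d = 0.
    move=> dY Y0; apply: alt_inj; apply/funext => s;
      have := congr1 (fun f : alt g => f s) Y0.
    rewrite app_alt_sum (bigD1_seq d) //=;
      have [->//|/dY sd] := eqVneq (Y d s) 0.
    rewrite big1 ?addr0 // => e ne_ed; apply/eqP; apply: contraNT ne_ed => /dY;
      lia.
  have proj (r : seq int) : \sum_(e <- r) y e = (\sum_(e <- r) (y e).1,
    \sum_(e <- r) (y e).2).
    by elim: r => [|e r IH]; rewrite ?big_nil // !big_cons IH.
  move: y0; rewrite proj => -[y1 y2]; rewrite [y d]surjective_pairing;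
    congr (_, _).
    by apply: (main 1 (fun e => (y e).1)) => // e; case: (dy e).
  by apply: (main 0 (fun e => (y e).2)) => // e; rewrite addr0; case: (dy e).
Qed.

End Grading.

(** * Comparison with the explicit formulas *)

Section Formulas.
Variables (k : fieldType) (g : lmodType k) (lam : k).
Implicit Types (f h : alt g) (m : seq int) (xi : seq (alt g)).

Lemma NR_compE p q f h : hdeg p f -> hdeg q h -> NR_comp p q f h = circ f h.
Proof.
move=> df dh; apply/funext => x; rewrite /NR_comp.
rewrite -[[:: _; _]]/(rcons [:: q + 1] p) shuffle_sum_insert //;
  last exact: malt_alt.
by congr (circ _ _ x); apply/funext => u; apply: shuffle_sum1.
Qed.

Lemma NR_bracketE p q f h : hdeg p f -> hdeg q h -> NR_bracket p q f h = br f h.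
Proof.
move=> df dh; apply/funext => x; rewrite /NR_bracket !NR_compE //.
by rewrite (brE (malt_alt h) (hdeg_par df) (hdeg_par dh)) !appE signz iparM.
Qed.

Lemma nth_alt_fun xi j : nth 0 (map (@alt_fun k g) xi) j = xi`_j.
Proof.
have [lt_j|le_j] := ltnP j (size xi); first by rewrite (nth_map 0).
by rewrite !nth_default ?size_map.
Qed.

Lemma homogeneous_hlist m xi : homogeneous (@alt_deg k g) m xi ->
  hlist m (map (@alt_fun k g) xi).
Proof.
elim: xi m => [|e xi IH] [|a m] [//= [sz] H].
split; [exact: malt_alt|exact: (H 0%N)|apply: IH; split=> // i lt_i].
exact: (H i.+1).
Qed.

Lemma map_omit (T T' : Type) (F : T -> T') j s : map F (omit j s) =
  omit j (map F s).
Proof. by rewrite /omit map_cat map_take map_drop. Qed.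

Lemma derived_formula n f m xi x : alt_deg n f ->
  homogeneous (@alt_deg k g) m xi ->
  ~~ odd (absz (n - (size xi).+1%:Z)) ->
  alt_derived lam f xi x = mRB_formula lam n f m xi x.
Proof.
move=> df hxi ev_q; have hX := homogeneous_hlist hxi.
rewrite alt_derivedE -[LHS]/(pr (foldl br (ext lam f) (map hat (map (@alt_fun k
  g) xi))) x).
rewrite (pr_foldl_br lam x (malt_alt f) df hX) size_map /mRB_formula.
set q := n + 1 - (size xi)%:Z.
have qE : n - (size xi).+1%:Z + 2 = q by rewrite /q; lia.
have qE' : n + 2 - (size xi).+1%:Z = q by rewrite /q; lia.
have qE'' : n + 3 - (size xi).+1%:Z = q + 1 by rewrite /q; lia.
have ev : odd (absz q) = false by move: ev_q; rewrite /q; lia.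
have od1 : odd (absz (q + 1)) by move: ev; lia.
rewrite qE qE' qE'' ev od1.
(* For negative [q] the integer power differs from the natural one, but then the shuffle sum is
   empty: [q] is even, so [q + 1] is negative as well. *)
have cE (b : seq int) (F : seq g -> g) : (q < 0 -> shuffle_sum b F x = 0) ->
    (- lam) ^ (q %/ 2)%Z *: shuffle_sum b F x =
      (- lam) ^+ (absz q)./2 *: shuffle_sum b F x.
  have [q0|q0] := boolP (q < 0); first by move=> ->; rewrite ?scaler0.
  move=> _; congr (_ *: _); rewrite exprnP; congr (_ ^ _); move: q0; lia.
congr (_ - _).
  rewrite -composeE -cE // => q0; apply: shuffle_sum0; rewrite all_rcons; lia.
apply: eq_bigr => j _;
  rewrite signz iparM iparD -(big_mkord xpredT (fun i => m`_i)).
have sz : size m = size xi by case: hxi.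
have -> : \sum_(0 <= i < j) m`_i = \sum_(a <- take j m) a.
  rewrite [RHS](big_nth 0) size_takel; last by rewrite sz ltnW.
  by apply: eq_big_nat => i /andP[_ lt_ij]; rewrite nth_take.
rewrite lpar_sum -scalerA composeE map_omit nth_alt_fun; congr (_ *: _).
rewrite -[[:: q + 1; _]]cat1s catA !cats1 cE => [|q0]; last first.
  by apply: shuffle_sum0; rewrite !all_rcons; lia.
have [q0|q0] := boolP (q < 0).
  by rewrite shuffle_sum0 ?scaler0 // !all_rcons; lia.
congr (_ ^+ _ *: _); lia.
Qed.

Lemma derived_formula0 n f m xi : alt_deg n f ->
  homogeneous (@alt_deg k g) m xi ->
  odd (absz (n - (size xi).+1%:Z)) -> alt_derived lam f xi = 0.
Proof.
move=> df hxi od_q; have hX := homogeneous_hlist hxi; apply: alt_inj;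
  apply/funext => x.
rewrite alt_derivedE -[LHS]/(pr (foldl br (ext lam f) (map hat (map (@alt_fun k
  g) xi))) x).
rewrite (pr_foldl_br lam x (malt_alt f) df hX) size_map.
set q := n + 1 - (size xi)%:Z.
have od1 : odd (absz q) by move: od_q; rewrite /q; lia.
have ev : odd (absz (q + 1)) = false by move: od1; lia.
by rewrite od1 ev big1 ?subr0 // => j _; rewrite scaler0.
Qed.

Lemma derived_nil n f : alt_deg n f ->
  alt_derived lam f [::] =
  if (2 %| n)%Z then 0 else (- lam) ^ ((n + 1) %/ 2)%Z *: f.
Proof.
move=> df; have h0 : homogeneous (@alt_deg k g) [::] [::] by split.
case: ifPn => n2; first by apply: (derived_formula0 df h0); rewrite /=; lia.
apply: alt_inj; apply/funext => x; rewrite (derived_formula x df h0) /=;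
  last by lia.
rewrite /mRB_formula big_ord0 subr0 /= -[RHS]/(_ *: f x).
have -> : n - 1 + 2 = n + 1 by lia.
have -> : n + 2 - 1 = n + 1 by lia.
congr (_ *: _); rewrite -[RHS](shuffle_sum1 _ df);
  apply: eq_shuffle_sum => w _ _ _.
by rewrite composeE /compose_raw /= expr0 scale1r drop0.
Qed.

Lemma homogeneous_homogl d (x : seq (smL g)) :
  homogeneous (@smL_deg k g) d x -> homogl d x.
Proof.
elim: x d => [|y x IH] [|a d] [//= [sz] H].
have [y1 y2] := H 0%N isT; split=> //; apply: IH; split=> // i lt_i;
  exact: (H i.+1).
Qed.

Lemma homogeneous_good d (x : seq (smL g)) j : homogeneous (@smL_deg k g) d x ->
  goodL (zpar d j, x`_j).
Proof.
move=> [sz H]; have [lt_j|le_j] := ltnP j (size x); last first.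
  (* Beyond the list the entry is [0], which has every parity. *)
  by rewrite nth_default //; split; apply: hpar0.
have [H1 H2] := H j lt_j; split; last exact: hdeg_hpar.
have -> : ~~ zpar d j = ipar (d`_j + 1) by rewrite iparD (_ : ipar 1 =
  true) // addbT.
exact: hdeg_hpar.
Qed.

Lemma lbr_permute d (x : seq (smL g)) (s : 'S_(size x)) :
  homogeneous (@smL_deg k g) d x ->
  lbr lam (permute s) = koszul_sign k d s *: lbr lam x.
Proof.
move=> hx; rewrite permuteE.
rewrite (koszul_sym (d := d) (Phi := fun w => lbr lam [seq x`_j | j <- w])) =>
  [|r a b t].
  by rewrite -[map _ (iota _ _)]/(mkseq _ _) mkseq_nth.
rewrite !map_cat /=; apply: lbr_comm; exact: homogeneous_good.
Qed.

Lemma lbr_relation d (x : seq (smL g)) : homogeneous (@smL_deg k g) d x ->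
  \sum_(1 <= i < (size x).+1) \sum_(s in Sh (size x) [:: i%:Z;
    (size x - i)%N%:Z])
    koszul_sign k d s *: lbr lam (lbr lam (take i (permute s)) :: drop i
      (permute s)) = 0.
Proof.
move=> hx; have sd : size d = size x by case: hx.
pose G (u v : seq nat) := lbr lam (lbr lam [seq x`_j | j <- u] :: [seq x`_j | j
  <- v]).
transitivity (\sum_(1 <= i < (size x).+1) unshuffle (zpar d) (iota 0 (size x))
    (fun u v => if ((size u)%:Z == i%:Z) && ((size v)%:Z == (size x - i)%N%:Z)
      then G u v else 0)).
  apply: eq_bigr => i _; rewrite -(koszul_unshuffle G _ _ sd);
    apply: eq_bigr => s _.
  by rewrite permuteE -map_take -map_drop.
rewrite -unshuffle_sum; set S := unshuffle _ _ _.
have -> : S = unshuffle (zpar d) (iota 0 (size x)) G.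
  apply/eqP; rewrite -subr_eq0 -scaleN1r addrC -unshuffle_lin;
    apply/eqP/unshuffle_size0 => u v.
  rewrite size_iota scaleN1r => uv.
  (* The splitting with empty [u] is missing from the sum over [i >= 1]; it contributes nothing
     since [lbr] vanishes on the empty list. *)
  have [u0|u1] := posnP (size u).
    rewrite (size0nil u0) big1 => [|i _];
      first by rewrite addr0 /G (lbr0 lam [::]) oppr0.
    by case: ifP => // _; rewrite /G (lbr0 lam [::]).
  have mu : size u \in index_iota 1 (size x).+1 by rewrite mem_index_iota u1
    ltnS -uv leq_addr.
  rewrite (bigD1_seq _ mu (iota_uniq _ _)) /= eqxx.
  rewrite (_ : (size v)%:Z == (size x - size u)%N%:Z); last by apply/eqP; lia.
  rewrite big1 ?addr0 ?addNr // => i ne_i.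
  by rewrite (_ : ((size u)%:Z == i%:Z) = false) //; apply/negbTE; lia.
pose tag j := (zpar d j, x`_j).
rewrite -(jac_eq0 lam (t := map tag (iota 0 (size x)))).
  rewrite /jac unshuffle_map; apply: eq_unshuffle => u v.
  by rewrite /G -!map_comp.
elim: (iota _ _) => //= j r IH; split=> //; exact: homogeneous_good.
Qed.

Lemma count_two T (p : pred T) (y : seq T) : (1 < count p y)%N ->
  exists s1 a s2 b s3, [/\ y = s1 ++ a :: s2 ++ b :: s3, p a & p b].
Proof.
have one z : (0 < count p z)%N -> exists s1 a s2, z = s1 ++ a :: s2 /\ p a.
  elim: z => //= a z IH;
    case: (boolP (p a)) => [pa _|_ /IH[s1 [b [s2 [-> pb]]]]].
    by exists [::], a, z.
  by exists (a :: s1), b, s2.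
elim: y => //= a y IH;
  case: (boolP (p a)) => [pa|_ /IH[s1 [b [s2 [c [s3 [-> pb pc]]]]]]].
  rewrite add1n ltnS => /one[s1 [b [s2 [-> pb]]]].
  by exists [::], a, s1, b, s2.
by exists (a :: s1), b, s2, c, s3.
Qed.

End Formulas.

Theorem corollary5p8 (k : fieldType) (g : lmodType k) (lam : k)
    (char0 : [pchar k] =i pred0)
    (sqrt_lam : exists r : k, r ^+ 2 = - (4%:R * lam)) :
  exists l : seq (smL g) -> smL g,
    Linfty1_algebra (@smL_deg k g) l /\
    [/\ (* l_1 (s f) *)
        forall (n : int) (f : alt g), alt_deg n f ->
          l [:: in_sm f] =
          if (2 %| n)%Z then 0
          else in_a ((- lam) ^ ((n + 1) %/ 2)%Z *: f),
        (* l_2 (s f, s g) *)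
        forall (n m : int) (f h : alt g), alt_deg n f -> alt_deg m h ->
          (forall x, (l [:: in_sm f; in_sm h]).1 x
                     = (-1) ^ n *: NR_bracket n m f h x) /\
          (l [:: in_sm f; in_sm h]).2 = 0,
        (* l_i (s f, xi_1, ..., xi_(i-1)), i >= 2, n - i even *)
        forall (i n : int) (f : alt g) (m : seq int) (xi : seq (alt g)),
          2 <= i -> (size xi)%:Z = i - 1 -> (2 %| n - i)%Z ->
          alt_deg n f -> homogeneous (@alt_deg k g) m xi ->
          (l (in_sm f :: [seq in_a z | z <- xi])).1 = 0 /\
          (forall x, (l (in_sm f :: [seq in_a z | z <- xi])).2 x
                     = mRB_formula lam n f m xi x),
        (* l_i (s f, xi_1, ..., xi_(i-1)), i >= 2, n - i odd *)
        forall (i n : int) (f : alt g) (m : seq int) (xi : seq (alt g)),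
          2 <= i -> (size xi)%:Z = i - 1 -> ~~ (2 %| n - i)%Z ->
          alt_deg n f -> homogeneous (@alt_deg k g) m xi ->
          l (in_sm f :: [seq in_a z | z <- xi]) = 0
      & (* all components with no argument in sm, or with several arguments
           in sm (except l_2 (s f, s g)), vanish *)
        forall y : seq (alt g + alt g),
          count is_inl y != 1%N ->
          ~~ ((count is_inl y == 2%N) && (size y == 2%N)) ->
          l [seq pure z | z <- y] = 0].
Proof.
have a1 (xi : seq (alt g)) : allp (fun y : smL g => y.1 =
  0) [seq in_a z | z <- xi].
  by elim: xi.
have mapK (xi : seq (alt g)) : [seq y.2 | y <- [seq in_a z | z <- xi]] = xi.
  by rewrite -map_comp map_id.
exists (lbr lam); split; [split|split].
- exact: smL_grading.
- exact: lbr_multilinear.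
- move=> d x _ /homogeneous_homogl hx; split; first exact: hdeg_l_sm.
  by apply: (@hdeg_l_a k g lam [::] [::]).
- by move=> d x s _; apply: lbr_permute.
- by move=> d x _; apply: lbr_relation.
- move=> n f df; rewrite lbr_sm_a // (derived_nil lam df).
  by case: ifP.
- move=> n m f h df dh; rewrite lbr_sm_sm; split=> // x.
  have -> : (in_sm (alt_br (alt_tau f) h)).1 = (-1) ^+ ipar n *: alt_br f h.
    by rewrite /= (alt_tau_par (hdeg_hpar df)) alt_brZl.
  by rewrite -[LHS]/(_ *: br f h x) -(NR_bracketE df dh) signz.
- move=> i n f m xi _ sz n2 df dxi; rewrite lbr_sm_a //; split=> // x.
  rewrite [_.2]/= mapK; apply: derived_formula => //; lia.
- move=> i n f m xi _ sz n2 df dxi; rewrite lbr_sm_a // mapK.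
  by rewrite (derived_formula0 lam df dxi) //; lia.
- move=> y y1 y2; have [c2|c1] := ltnP 1 (count is_inl y); last first.
    have c0 : count is_inl y = 0%N by lia.
    apply: lbr_all_a; elim: y c0 {y1 y2 c1} => [|[f|xi] y IH] //= c0.
    by split=> //; apply: IH.
  (* A list of length 2 with at least two arguments in [sm] would have exactly two, the excluded
     case. *)
  have sy : size y != 2%N.
    apply: contraNN y2 => /eqP sy; rewrite sy eqxx andbT.
    by have := count_size is_inl y; lia.
  have [s1 [a [s2 [b [s3 [E pa pb]]]]]] := count_two c2.
  rewrite E !map_cat /= map_cat /=; apply: lbr_many.
  + by case: a pa {E}.
  + by case: b pb {E}.
  + by move: sy; rewrite E !size_cat /= !size_cat /= !size_map.
Qed.
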